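(* There is a universal constant $C\ge1$ such that the following holds. Let $Y=(Y_1,\dots,Y_d)$ have independent, symmetric, nonzero coordinates such that each $N_i(u)=-\log\mathbb P(|Y_i|\ge u)$, $u\ge0$, is closed, convex and nondecreasing with $N_i(0)=0$ (value $+\infty$ allowed), normalized so that $q_i(1)=1$, where $q_i(p)=\sup\{u\ge0:N_i(u)\le p\}$. Let $H=(H_1,\dots,H_d)$ be the associated dyadic slope expansion defined in the context (with independent coordinates). Then for every $i$, $$C^{-1}Y_i\preceq_{\rm cx}H_i\preceq_{\rm cx}C\,Y_i.$$ Hence $C^{-1}B_Y(\mu)\le B_H(\mu)\le C\,B_Y(\mu)$ for every finitely supported probability law $\mu$ on $\mathbb R^d$.
   Context: Convex order: $A\preceq_{\rm cx}B$ means $\mathbb E f(A)\le\mathbb E f(B)$ for every convex $f$ (for which the expectations are defined in $(-\infty,\infty]$). Slopes. Let $b_i=\lim_{p\to\infty}q_i(p)\in[1,\infty]$. If $b_i>1$ define $V_i(u)=u^2$ for $|u|\le 1$, $V_i(u)=2N_i(|u|)-1$ for $1<|u|\le b_i$, and $V_i(u)=+\infty$ for $|u|>b_i$. If $b_i=1$ define $V_i(u)=u^2$ on $[-1,1]$ and $+\infty$ outside. For $0<s<b_i$ let $\sigma_i(s)=V'_{i,+}(s)$ (right derivative). Expansion. For integers $j\ge0$ put $s_j=2^{j+1}$, $a_j=2^{-j}$, $A_{ij}=\{u\in[1,b_i):s_j\le\sigma_i(u)<2s_j\}$, $w_{ij}=s_j|A_{ij}|\in[0,\infty]$ ($|\cdot|$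 is Lebesgue measure), and for $j$ with $w_{ij}\ge1$ put $\beta_{ij}=(w_{ij}+1)/2\in[1,\infty]$. A symmetric exponential with cap $\beta\in[1,\infty]$ is a random variable distributed as $\varepsilon\min(E,\beta)$, where $\varepsilon$ is a symmetric random sign and $E$ an independent mean-one exponential. Let $\Xi_{i,*}$ have cap $1$ and $\Xi_{ij}$ (for $j$ with $w_{ij}\ge1$) have cap $\beta_{ij}$, all these variables being independent (over all $i$ and $j$), and define $$H_i=\Xi_{i,*}+\sum_{j:\,w_{ij}\ge1}a_j\,\Xi_{ij}$$ (the series converges absolutely almost surely and in every $L_p$). Pairing. For a centered integrable random vector $A$ in $\mathbb R^d$, $B_A(\mu)=\sup\mathbb E\langle X,A\rangle$ over all couplings $(X,A)$ with $X\sim\mu$ and $A$ having its prescribed law. *)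

(* Defs.v *)
From HB Require Import structures.
From mathcomp Require Import all_boot all_order all_algebra.
From mathcomp Require Import finmap.
From mathcomp Require Import all_classical all_reals all_analysis.

Set Implicit Arguments.
Unset Strict Implicit.
Unset Printing Implicit Defensive.

Import Order.TTheory GRing.Theory Num.Theory.
Import numFieldNormedType.Exports.

Local Open Scope classical_set_scope.
Local Open Scope ring_scope.

(* Mutual independence of the subfamily (X i)_{i in D}. *)
Definition mutually_independent {d} {T : measurableType d} {R : realType}
    (P : probability T R) {I : choiceType} (D : set I) (X : I -> T -> R) :=
  forall (J : {fset I}) (B : I -> set R), [set` J] `<=` D ->
    (forall i, measurable (B i)) ->
    (P (\bigcap_(i in [set` J]) (X i @^-1` B i)) =
      \prod_(i <- J) P (X i @^-1` B i))%E.

Definition symmetric_rv {d} {T : measurableType d} {R : realType}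
    (P : probability T R) (X : T -> R) :=
  forall B : set R, measurable B -> P (X @^-1` B) = P ((fun w => - X w) @^-1` B).

(* The library integral is int f^+ - int f^-; for f^- with finite integral it
   is the expectation in (-oo, +oo], and only such f are tested. *)
Definition convex_le {d} {T : measurableType d} {d'} {T' : measurableType d'}
    {R : realType} (P : probability T R) (A : T -> R)
    (Q : probability T' R) (B : T' -> R) :=
  forall f : R^o -> R^o, convex_function [set: R^o] f ->
    ('E_P[(f \o A)^\-] < +oo)%E -> ('E_Q[(f \o B)^\-] < +oo)%E ->
    ('E_P[f \o A] <= 'E_Q[f \o B])%E.

Section tail_exponent.
Context {R : realType}.
Implicit Types (N : R -> \bar R) (s u p : R).
Local Open Scope ereal_scope.

(* [lne 0 = -oo], so the value is +oo where the tail vanishes. *)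
Definition tail_exponent {d} {T : measurableType d}
    (P : probability T R) (X : T -> R) : R -> \bar R :=
  fun u => - lne (P [set w | u <= `|X w|]%R).

(* The three properties are required on the half-line u >= 0 only. *)
Definition closed_fun N :=
  closed [set z : R * R | (0 <= z.1)%R /\ N z.1 <= z.2%:E].

Definition convex_efun N := forall u v t : R, (0 <= u)%R -> (0 <= v)%R ->
  (0 <= t <= 1)%R ->
  N (t * u + (1 - t) * v)%R <= t%:E * N u + (1 - t)%:E * N v.

Definition nondecreasing_efun N :=
  forall u v : R, (0 <= u)%R -> (u <= v)%R -> N u <= N v.

Definition qinv N p : \bar R :=
  ereal_sup [set u%:E | u in [set u : R | (0 <= u)%R /\ N u <= p%:E]].

Definition endpoint N : \bar R := lim (qinv N p @[p --> +oo%R]).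

(* When the endpoint is 1 the middle case is empty. *)
Definition Vfun N u : \bar R :=
  if (`|u| <= 1)%R then (u ^+ 2)%:E
  else if `|u|%:E <= endpoint N then 2%:E * N `|u|%R - 1
  else +oo.

(* Right derivative of [Vfun N]; meaningful for 0 < s < endpoint N, where
   [Vfun N] is finite at s and on a right neighbourhood of s. *)
Definition slope N s : \bar R :=
  lim ((Vfun N (s + h)%R - Vfun N s) * (h^-1)%:E @[h --> 0^'+]).

Definition sj (j : nat) : R := 2 ^+ j.+1.
Definition aj (j : nat) : R := 2 ^- j.

Definition slope_set N (j : nat) : set R :=
  [set u | (1 <= u)%R /\ u%:E < endpoint N /\
           (sj j)%:E <= slope N u < (2 * sj j)%:E].

Definition width N (j : nat) : \bar R :=
  (sj j)%:E * lebesgue_measure (slope_set N j).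

Definition cap N (j : nat) : \bar R := (width N j + 1) * (2^-1)%:E.

(* Law of eps * min(E, beta), beta in [1, +oo]. *)
Definition symexp_law (beta : \bar R) : set R -> \bar R :=
  pushforward (bernoulli_prob 2^-1 \x exponential_prob 1)
    (fun z : bool * R => (-1) ^+ z.1 * fine (mine z.2%:E beta))%R.

End tail_exponent.

Section slope_expansion.
Context {R : realType} {d} {T : measurableType d}.
Local Open Scope ereal_scope.

(* The variables are indexed by [option nat]: [None] is the starred variable
   (cap 1), [Some j] the variable of level j, present when the width is >= 1. *)
Definition active (N : R -> \bar R) (k : option nat) : Prop :=
  if k is Some j then 1 <= width N j else True.

Definition level_cap (N : R -> \bar R) (k : option nat) : \bar R :=
  if k is Some j then cap N j else 1.

(* [Xi] realizes the independent capped exponentials; inactive variables are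
   unconstrained and unused. *)
Definition slope_variables (P : probability T R) {n : nat}
    (N : 'I_n -> R -> \bar R) (Xi : 'I_n -> option nat -> {RV P >-> R}) :=
  mutually_independent P [set ik : 'I_n * option nat | active (N ik.1) ik.2]
    (fun ik => Xi ik.1 ik.2 : T -> R) /\
  forall i k, active (N i) k -> forall B : set R, measurable B ->
    distribution P (Xi i k) B = symexp_law (level_cap (N i) k) B.

Definition slope_expansion (N : R -> \bar R) (Xi : option nat -> T -> R)
    (w : T) : R :=
  (Xi None w +
   limn (fun n => \sum_(j < n | `[< active N (Some (j : nat)) >])
                    aj j * Xi (Some (j : nat)) w))%R.

End slope_expansion.

Section pairing.
Context {R : realType} {n : nat}.
Local Open Scope ereal_scope.

Definition vector_law {d} {T : measurableType d} (P : probability T R)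
    (A : 'I_n -> T -> R) : set (n.-tuple R) -> \bar R :=
  pushforward P (fun w => [tuple A i w | i < n]).

Definition dotp (x a : n.-tuple R) : R :=
  (\sum_(i < n) tnth x i * tnth a i)%R.

Definition coupling (mu nu : set (n.-tuple R) -> \bar R)
    (pi : probability (n.-tuple R * n.-tuple R)%type R) :=
  (forall B, measurable B -> pi (fst @^-1` B) = mu B) /\
  (forall B, measurable B -> pi (snd @^-1` B) = nu B).

(* [nu] is the law of A. *)
Definition pairing (nu mu : set (n.-tuple R) -> \bar R) : \bar R :=
  ereal_sup [set 'E_pi[fun z => dotp z.1 z.2] | pi in coupling mu nu].

Definition finitely_supported (mu : set (n.-tuple R) -> \bar R) :=
  exists2 F : set (n.-tuple R), finite_set F & mu F = 1.

End pairing.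

(* Main.v *)
Require Import Defs.
From HB Require Import structures.
From mathcomp Require Import all_boot all_order all_algebra.
From mathcomp Require Import finmap.
From mathcomp Require Import all_classical all_reals all_analysis.
From mathcomp Require Import measurable_realfun.
From mathcomp Require Import ring lra.

Set Implicit Arguments.
Unset Strict Implicit.
Unset Printing Implicit Defensive.

Import Order.TTheory GRing.Theory Num.Theory.
Import numFieldNormedType.Exports.

Local Open Scope classical_set_scope.
Local Open Scope ring_scope.

(* One coordinate.  Cutting [1, u) along the slope sets of N gives lengths x_j <= |A_j| with
   sum x_j = u - 1 and sum 2^j x_j <= N u.  Forcing Xi_* >= 1 and every Xi_j with
   2^j x_j >= 2 above 2^j x_j / 4 has probability at least const * exp (- N u) and makes H
   at least const * u.  Conversely, if j0 is the slope level at v, then the caps bound the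
   levels below j0 by 2 sum |A_j| <= 2 (v - 1), and a union bound shows that the levels
   above j0 exceed const * v with probability at most const * exp (- N v).  So Y and H have
   comparable tails.  Subtracting from a convex function its tangent at 0, which has mean
   zero on both sides, turns this comparison into convex order up to a constant.

   The pairing.  Convex order passes to functions of independent coordinates by exchanging
   one coordinate at a time.  Let mu have atoms x_k of mass p_k, k <= m.  For every phi and
   every coupling, E <X, A> <= sum p_k phi_k + E lse (<x_k, A> - phi_k), and the last term
   is the mean of a convex function of A, so it increases when A is replaced by c B.  At a
   phi minimizing the new bound the weights softmax (<x_k, c B> - phi_k) have means p_k and
   hence define a coupling of mu with B, which attains the bound up to m + 1.  Applying this
   to large multiples of the x_k removes the error. *)

(** * The slopes of a convex tail exponent *)

(** The tails of H and Y agree only up to a dilation and a numerical factor. A level of width below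
    1 is absent from H, and a present level takes the favourable sign with probability 1/2 only.
    Over unboundedly many levels such losses would multiply. They do not: a forced level is asked
    for a quarter of its share, and the other three quarters of its exponent pay for the sign; a
    level too short to be forced loses at most a geometrically small length. A dilation is harmless
    in convex order; a factor in front of the tails is not, and convexity turns it into a dilation.

    Convex order is given through test functions, without a martingale coupling, so couplings of A
    are not transported to B directly; the supremum is bounded by a dual expression that is the mean
    of a convex function of A. The maximum over the atoms would be the exact dual, but its optimal
    potentials produce ties, which have to be split to recover the first marginal. Log-sum-exp has
    no ties: its gradient is the soft-max, and stationarity of the dual is the marginal condition
    itself, at a price depending on the number of atoms only. *)

Section exponent.
Context {R : realType} (N : R -> \bar R).
Context (N_ge0 : forall u, (0 <= N u)%E) (N_cvx : convex_efun N).
Context (N_nd : nondecreasing_efun N) (N0 : N 0 = 0%E) (qN1 : qinv N 1 = 1%E).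
Local Notation b := (endpoint N).
Local Notation n := (fun u => fine (N u)).

Lemma endpointE : b = ereal_sup (range (qinv N)).
Proof.
apply/cvg_lim => //; apply: nondecreasing_cvge => p q pq.
apply: ub_ereal_sup => _ [u [u0 Nu] <-].
apply: ereal_sup_ubound; exists u => //; split => //.
by apply: (le_trans Nu); rewrite lee_fin.
Qed.

Lemma fin_num_lt_endpoint u : 0 <= u -> (u%:E < b)%E -> N u \is a fin_num.
Proof.
rewrite endpointE => u0 /ereal_sup_gt[_ [p _ <-]].
move=> /ereal_sup_gt[_ [v [v0 Nv] <-]]; rewrite lte_fin => uv.
rewrite ge0_fin_numE//; apply: le_lt_trans (ltry p).
by apply: le_trans Nv; apply: N_nd => //; exact: ltW.
Qed.

Lemma le_endpoint u : 0 <= u -> (N u < +oo)%E -> (u%:E <= b)%E.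
Proof.
move=> u0 Nu; rewrite endpointE.
apply: le_trans (ereal_sup_ubound _); last first.
  by exists (fine (N u)).
apply: ereal_sup_ubound; exists u => //; split => //.
by rewrite fineK// ge0_fin_numE.
Qed.

Lemma endpoint_ge1 : (1 <= b)%E.
Proof. by rewrite endpointE -qN1; apply: ereal_sup_ubound; exists 1. Qed.

Lemma le1_of_lt1 u : 0 <= u -> u < 1 -> (N u <= 1)%E.
Proof.
move=> u0 u1.
have : (u%:E < qinv N 1)%E by rewrite qN1 lte_fin.
move=> /ereal_sup_gt[_ [v [v0 Nv] <-]]; rewrite lte_fin => uv.
by apply: le_trans Nv; apply: N_nd => //; exact: ltW.
Qed.

Lemma gt1_of_gt1 u : 1 < u -> (1 < N u)%E.
Proof.
move=> u1; rewrite ltNge; apply/negP => Nu.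
have : (u%:E <= qinv N 1)%E.
  by apply: ereal_sup_ubound; exists u => //; split => //; apply: ltW; lra.
by rewrite qN1 lee_fin leNgt u1.
Qed.

(** Convexity at [y], a barycentre of [x] and [z]; denominators are cleared for the arithmetic
    tactics. *)
Lemma chord x y z : 0 <= x -> x < y -> y < z -> (z%:E < b)%E ->
  (n y - n x) * (z - y) <= (n z - n y) * (y - x).
Proof.
move=> x0 xy yz zb.
have z0 : 0 <= z by lra.
have y0 : 0 <= y by lra.
have fz := fin_num_lt_endpoint z0 zb.
have yb : (y%:E < b)%E by apply: lt_trans zb; rewrite lte_fin.
have xb : (x%:E < b)%E by apply: lt_trans yb; rewrite lte_fin.
have fx := fin_num_lt_endpoint x0 xb.
have fy := fin_num_lt_endpoint y0 yb.
pose t := (z - y) / (z - x).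
have zx : 0 < z - x by lra.
have t01 : 0 <= t <= 1.
  rewrite /t divr_ge0; [|lra..]; rewrite ler_pdivrMr//; lra.
have yE : y = t * x + (1 - t) * z by rewrite /t; field; lra.
have := N_cvx x0 z0 t01; rewrite -yE -(fineK fx) -(fineK fy) -(fineK fz).
rewrite -!EFinM -EFinD lee_fin => h.
have : n y * (z - x) <= (t * n x + (1 - t) * n z) * (z - x) by rewrite ler_wpM2r// ltW.
have -> : (t * n x + (1 - t) * n z) * (z - x) = (z - y) * n x + (y - x) * n z.
  by rewrite /t; field; lra.
rewrite /=; lra.
Qed.

Lemma n_le x y : 0 <= x -> x <= y -> (y%:E < b)%E -> n x <= n y.
Proof.
move=> x0 xy yb; have y0 := le_trans x0 xy.
apply: fine_le; last exact: N_nd.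
  by apply: fin_num_lt_endpoint => //; apply: le_lt_trans yb; rewrite lee_fin.
exact: fin_num_lt_endpoint.
Qed.

Lemma lt_endpoint_ex u : (u%:E < b)%E -> exists2 v, u < v & (v%:E < b)%E.
Proof.
case: b => [r||] //; last by exists (u + 1); [lra|rewrite ltry].
by rewrite lte_fin => ur; exists ((u + r) / 2); [|rewrite lte_fin]; lra.
Qed.

(** The normalization puts [N] below 1 to the left of 1 and above 1 to the right. A convex function
    has no jump at an interior point, and 1 is interior when it lies strictly below the endpoint. *)
Lemma exponent_at1 : (1 < b)%E -> n 1 = 1.
Proof.
move=> b1; have [v v1 vb] := lt_endpoint_ex b1.
have nle u : 0 <= u -> u < 1 -> n u <= 1.
  move=> u0 u1; rewrite -lee_fin fineK; first exact: le1_of_lt1.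
  by apply: fin_num_lt_endpoint => //; apply: lt_trans b1; rewrite lte_fin.
have nge u : 1 < u -> (u%:E < b)%E -> 1 <= n u.
  move=> u1 ub; rewrite -lee_fin fineK; first exact/ltW/gt1_of_gt1.
  by apply: fin_num_lt_endpoint => //; lra.
have v0 : 0 < v - 1 by lra.
have nv := nge _ v1 vb.
apply/eqP; rewrite eq_le; apply/andP; split; apply/ler_addgt0Pl => e e0.
(* The chord over [[1 - d, 1]] is no steeper than the one over [[1, v]], so [n 1] exceeds
   [n (1 - d)] by at most [d * n v / (v - 1) <= e]. *)
- have [d /andP[d0 d1] dv] : exists2 d, 0 < d <= 1 & d * n v <= e * (v - 1).
    exists (Num.min 1 (e * (v - 1) / n v)); last first.
      by rewrite -ler_pdivlMr ?ge_min ?lexx ?orbT//; lra.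
    by rewrite lt_min ltr01/= divr_gt0 ?mulr_gt0 ?ge_min ?lexx//; lra.
  have := @chord (1 - d) 1 v; move=> /(_ ltac:(lra) ltac:(lra) v1 vb).
  have := nle (1 - d) ltac:(lra) ltac:(lra).
  have : 0 <= n 1 by exact/fine_ge0.
  have -> : 1 - (1 - d) = d by ring.
  move=> n10 h1 h2.
  rewrite -(ler_pM2r v0) mulrDl; nra.
- have [d /andP[d0 d1] dv] : exists2 d, 0 < d < v - 1 & d * n v <= e * (v - 1).
    exists (Num.min ((v - 1) / 2) (e * (v - 1) / n v)); last first.
      by rewrite -ler_pdivlMr ?ge_min ?lexx ?orbT//; lra.
    rewrite lt_min; apply/andP; split; last by rewrite gt_min; apply/orP; left; lra.
    by apply/andP; split; [lra | rewrite divr_gt0 ?mulr_gt0//; lra].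
  have db : ((1 + d)%:E < b)%E by apply: lt_trans vb; rewrite lte_fin; lra.
  have := @chord 1 (1 + d) v ltac:(lra) ltac:(lra) ltac:(lra) vb.
  have := nge (1 + d) ltac:(lra) db.
  have : 0 <= n 1 by exact/fine_ge0.
  have -> : 1 + d - 1 = d by ring.
  move=> n10 h1 h2.
  rewrite -(ler_pM2r v0) mulrDl; nra.
Qed.

(** Difference quotients of a convex function decrease with [h], so the limit is an infimum; [e]
    keeps all points below the endpoint. Only the branch [2 * N - 1] of [Vfun] remains, because at 1
    both branches take the value 1. *)
Lemma slope_ereal_inf s e : 1 <= s -> 0 < e -> ((s + e)%:E < b)%E ->
  slope N s = ereal_inf [set (2 * (n (s + h) - n s) / h)%:E | h in `]0, e] ].
Proof.
move=> s1 e0 seb.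
have b1 : (1 < b)%E by apply: le_lt_trans seb; rewrite lee_fin; lra.
have sb : (s%:E < b)%E by apply: le_lt_trans seb; rewrite lee_fin; lra.
pose q h := ((Vfun N (s + h)%R - Vfun N s) * (h^-1)%:E)%E.
have qE h : 0 < h <= e -> q h = (2 * (n (s + h) - n s) / h)%:E.
  move=> /andP[h0 he].
  have shb : ((s + h)%:E < b)%E by apply: le_lt_trans seb; rewrite lee_fin; lra.
  have VsE : Vfun N s = (2 * n s - 1)%:E.
    rewrite /Vfun; case: ifPn => [sle|_]; last first.
      rewrite ger0_norm ?(ltW sb); last lra.
      by rewrite EFinB EFinM fineK// fin_num_lt_endpoint//; lra.
    have -> : s = 1 by move: sle; rewrite ger0_norm; lra.
    by rewrite exponent_at1//; congr EFin; ring.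
  rewrite /q VsE /Vfun ger0_norm; last lra.
  rewrite ifF; last by apply/negbTE; rewrite -ltNge; lra.
  rewrite (ltW shb) -[N (s + h)]fineK; last by apply: fin_num_lt_endpoint => //; lra.
  by rewrite -EFinM /=; congr EFin; ring.
rewrite /slope -/q.
have -> : [set (2 * (n (s + h) - n s) / h)%:E | h in `]0, e] ] =
    q @` [set` Interval (BRight 0) (BRight e)].
  by apply: eq_imagel => h; rewrite /= in_itv/= => hh; exact/esym/qE.
apply/cvg_lim => //; apply: nondecreasing_at_right_cvge; first by rewrite bnd_simp.
move=> h k; rewrite !in_itv/= => hh kk hk; rewrite -/(q h) -/(q k) !qE// lee_fin.
case/andP: hh => h0 he; case/andP: kk => k0 ke.
have [->|hk'] := eqVneq h k; first by [].
have {}hk : h < k by rewrite lt_neqAle hk' hk.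
have := @chord s (s + h) (s + k) ltac:(lra) ltac:(lra) ltac:(lra).
move=> /(_ ltac:(by apply: le_lt_trans seb; rewrite lee_fin; lra)).
move=> c; rewrite ler_pdivrMr// mulrAC ler_pdivlMr//.
move: c; rewrite /=; set A := fine _; set B := fine _; set D := fine _; nra.
Qed.

Lemma slope_le s t : 1 <= s -> s < t -> (t%:E < b)%E ->
  (slope N s <= (2 * (n t - n s) / (t - s))%:E)%E.
Proof.
move=> s1 st tb; rewrite (@slope_ereal_inf s (t - s)) ?subr_gt0//; last first.
  by rewrite addrC subrK.
apply: ereal_inf_lbound; exists (t - s); first by rewrite /= in_itv/= lexx subr_gt0 st.
by rewrite (addrC s) subrK.
Qed.

Lemma slope_ge r s : 0 <= r -> 1 <= s -> r < s -> (s%:E < b)%E ->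
  ((2 * (n s - n r) / (s - r))%:E <= slope N s)%E.
Proof.
move=> r0 s1 rs sb; have [t st tb] := lt_endpoint_ex sb.
rewrite (@slope_ereal_inf s (t - s)) ?subr_gt0//; last by rewrite addrC subrK.
apply: le_ereal_inf_tmp => _ [h /= +] <-; rewrite in_itv/= => /andP[h0 hts].
rewrite lee_fin ler_pdivrMr ?subr_gt0// mulrAC ler_pdivlMr//.
have := @chord r s (s + h) r0 rs ltac:(lra) ltac:(by apply: le_lt_trans tb; rewrite lee_fin; lra).
rewrite /=; set A := fine _; set B := fine _; set D := fine _; nra.
Qed.

Lemma slope_nd s t : 1 <= s -> s <= t -> (t%:E < b)%E -> (slope N s <= slope N t)%E.
Proof.
move=> s1; rewrite le_eqVlt => /predU1P[->//|st] tb.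
by apply: (le_trans (slope_le s1 st tb)); apply: slope_ge => //; lra.
Qed.

(** The chord of [N] from 0 to 1 already has slope 1, and [Vfun] doubles it. Since [sj 0 = 2], the
    dyadic levels start low enough to reach every point of [[1, b)]. *)
Lemma slope_ge2 s : 1 <= s -> (s%:E < b)%E -> (2%:E <= slope N s)%E.
Proof.
move=> s1 sb; apply: le_trans (slope_nd (lexx 1) s1 sb).
have b1 : (1 < b)%E by apply: le_lt_trans sb; rewrite lee_fin.
apply: le_trans (slope_ge (lexx 0) (lexx 1) ltr01 b1).
by rewrite exponent_at1// N0 /= !subr0 mulr1 divr1.
Qed.

Lemma slope_fin s : 1 <= s -> (s%:E < b)%E -> slope N s \is a fin_num.
Proof.
move=> s1 sb; have [t st tb] := lt_endpoint_ex sb.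
rewrite ge0_fin_numE; first exact: le_lt_trans (slope_le s1 st tb) (ltry _).
by apply: le_trans (slope_ge2 s1 sb); rewrite lee_fin.
Qed.

(** The slope is nondecreasing, so each level set is an interval. *)
Lemma measurable_slope_set j : measurable (slope_set N j).
Proof.
apply: is_interval_measurable => x y [x1 [xb /andP[sx _]]] [_ [yb /andP[_ sy]]] z.
move=> /andP[xz zy]; have zb : (z%:E < b)%E by apply: le_lt_trans yb; rewrite lee_fin.
have z1 := le_trans x1 xz.
split=> //; split=> //; apply/andP; split.
  exact: le_trans sx (slope_nd x1 xz zb).
exact: le_lt_trans (slope_nd z1 zy yb) sy.
Qed.

Lemma sjS j : 2 * sj j = sj j.+1 :> R.
Proof. by rewrite /sj -exprS. Qed.

Lemma ler_sj i j : (i <= j)%N -> sj i <= sj j :> R.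
Proof. by move=> ij; rewrite /sj ler_weXn2l// ler1n. Qed.

Lemma trivIset_slope_set : trivIset setT (slope_set N).
Proof.
suff H i j w : (i < j)%N -> slope_set N i w -> slope_set N j w -> False.
  move=> i j _ _ [w [wi wj]].
  by case: (ltngtP i j) => // ij; [case: (H _ _ _ ij wi wj)|case: (H _ _ _ ij wj wi)].
move=> ij [_ [_ /andP[_ wi]]] [_ [_ /andP[wj _]]].
by move: (le_lt_trans wj wi); rewrite lte_fin sjS ltNge ler_sj.
Qed.

Lemma slope_set_sum m v : 1 <= v ->
  (forall j, (j < m)%N -> slope_set N j `<=` `[1, v[) ->
  (\sum_(j < m) lebesgue_measure (slope_set N j) <= (v - 1)%:E)%E.
Proof.
move=> v1 sub.
rewrite -measure_bigsetU//; last exact: trivIset_slope_set.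
  have -> : (v - 1)%:E = lebesgue_measure (`[1, v[%classic : set R).
    rewrite lebesgue_measure_itv/= lte_fin; case: ltP => [//|v1'].
    by congr EFin; lra.
  apply: le_measure; rewrite ?inE//.
    by apply: bigsetU_measurable => i _; exact: measurable_slope_set.
  by rewrite -bigcup_mkord => w [j /= jm]; exact: sub.
by move=> j; exact: measurable_slope_set.
Qed.

Lemma slope_set_sum_endpoint m v : 1 <= v -> (b <= v%:E)%E ->
  (\sum_(j < m) lebesgue_measure (slope_set N j) <= (v - 1)%:E)%E.
Proof.
move=> v1 bv; apply: slope_set_sum => // j _ w [w1 [wb _]].
by rewrite /= in_itv/= w1 -lte_fin; exact: lt_le_trans bv.
Qed.

(** [j0] is the dyadic level of the slope at [v]. The chord of [N] from 1/2, where [N <= 1], to [v]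
    has slope at most [sj j0], and by monotonicity the points of lower level lie to the left of
    [v]. *)
Lemma slope_level v : 1 <= v -> (v%:E < b)%E -> exists j0,
  [/\ n v <= 1 + sj j0 * v &
      (\sum_(j < j0) lebesgue_measure (slope_set N j) <= (v - 1)%:E)%E].
Proof.
move=> v1 vb; have sf := slope_fin v1 vb; have s2 := slope_ge2 v1 vb.
have ex : exists j, (slope N v < (sj j)%:E)%E.
  exists (Num.bound (fine (slope N v))).
  rewrite -(fineK sf) lte_fin /sj; apply: upper_nthrootP.
  exact: leqnSn.
(* The least strict upper bound has positive index because the slope is at least [sj 0]; its
   predecessor is the level. *)
have [[|j0] jv jmin] := ex_minnP ex.
  by move: jv; rewrite ltNge s2.
exists j0; split.
  have := @slope_ge 2^-1 v ltac:(lra) v1 ltac:(lra) vb => h.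
  have := le_trans h (ltW jv); rewrite lee_fin -sjS ler_pdivrMr; last lra.
  have : n 2^-1 <= 1.
    rewrite -lee_fin fineK; first by apply: le1_of_lt1; lra.
    by apply: fin_num_lt_endpoint; [lra | apply: lt_le_trans endpoint_ge1; rewrite lte_fin; lra].
  have : 0 < (sj j0 : R) by rewrite exprn_gt0.
  rewrite /=; set A := fine _; set B := fine _; nra.
apply: slope_set_sum => // j jj0 w [w1 [wb /andP[_ sw]]].
rewrite /= in_itv/= w1/= ltNge; apply/negP => vw.
have /jmin : (slope N v < (sj j.+1)%:E)%E.
  by rewrite -sjS; apply: le_lt_trans sw; exact: slope_nd.
by rewrite ltnNge jj0.
Qed.

(** The cut points are the places where the slope crosses the values [sj j]. Between [t j] and
    [t j.+1] the slope of [2 * N - 1] is at least [2 ^+ j.+1], so [N] grows at rate at least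
    [2 ^+ j]. *)
Lemma slope_steps u : 1 <= u -> (u%:E < b)%E ->
  exists (x : nat -> R) (m : nat),
    [/\ forall j, 0 <= x j,
        forall j, ((x j)%:E <= lebesgue_measure (slope_set N j))%E,
        \sum_(j < m) x j = u - 1 & \sum_(j < m) 2 ^+ j * x j <= n u].
Proof.
move=> u1 ub.
(* Putting [u] into every [B j] keeps the set nonempty and stops the cut points at [u]. *)
pose B j : set R := [set w | w = u \/ 1 <= w < u /\ ((sj j)%:E <= slope N w)%E].
have Bu j : B j u by left.
have B1 j : lbound (B j) 1 by move=> w [->//|[/andP[]]].
have hB j : has_inf (B j) by split; [exists u|exists 1].
pose t j := inf (B j).
have t1 j : 1 <= t j by apply: lb_le_inf; [exists u|].
have tu j : t j <= u by apply: ge_inf; [exists 1|].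
have tnd j : t j <= t j.+1.
  apply: lb_le_inf; first by exists u.
  move=> w Bw; apply: ge_inf; first by exists 1.
  case: Bw => [->|[w1 sw]]; [exact: Bu|right; split=> //].
  by apply: le_trans sw; rewrite lee_fin ler_sj.
have t0 : t 0%N = 1.
  apply/eqP; rewrite eq_le t1 andbT; have [uE|u1'] := eqVneq u 1.
    by rewrite -[leRHS]uE.
  apply: ge_inf; first by exists 1.
  right; rewrite lexx lt_neqAle eq_sym u1' u1; split=> //.
  rewrite /sj expr1; apply: slope_ge2 => //; apply: le_lt_trans ub.
  by rewrite lee_fin.
have tlo j w : 1 <= w -> w < t j -> (slope N w < (sj j)%:E)%E.
  move=> w1 wt; rewrite ltNge; apply/negP => sw.
  have : t j <= w.
    apply: ge_inf; first by exists 1.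
    by right; rewrite w1 (lt_le_trans wt (tu j)).
  by rewrite leNgt wt.
have thi j w : t j < w -> w <= u -> ((sj j)%:E <= slope N w)%E \/ w = u.
  move=> tw wu; have [v Bv vw] := inf_lt (hB j).1 tw.
  have [->|wu'] := eqVneq w u; [by right|left].
  have {}wu : w < u by rewrite lt_neqAle wu' wu.
  case: Bv => [vE|[/andP[v1 vu] sv]]; first by move: vw; rewrite vE ltNge ltW.
  apply: (le_trans sv); apply: slope_nd => //; first exact: ltW.
  by apply: lt_trans ub; rewrite lte_fin.
have [m tm] : exists m, t m = u.
  have sf := slope_fin u1 ub.
  exists (Num.bound (fine (slope N u))).
  apply/eqP; rewrite eq_le tu /=; apply: lb_le_inf; first by exists u.
  move=> w [->//|[/andP[w1 wu] sw]].
  have : (slope N w < (sj (Num.bound (fine (slope N u))))%:E)%E.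
    apply: (le_lt_trans (slope_nd w1 (ltW wu) ub)).
    rewrite -(fineK sf) lte_fin /sj; apply: upper_nthrootP.
    exact: leqnSn.
  by rewrite ltNge sw.
have tb j : ((t j)%:E < b)%E by apply: le_lt_trans ub; rewrite lee_fin.
have step j : 2 ^+ j * (t j.+1 - t j) <= n (t j.+1) - n (t j).
  have [->|tne] := eqVneq (t j.+1) (t j); first by rewrite !subrr mulr0.
  have tlt : t j < t j.+1 by rewrite lt_neqAle eq_sym tne tnd.
  apply/ler_addgt0Pl => e e0.
  have p2 : 0 < 2 ^+ j :> R by rewrite exprn_gt0.
  (* The lower bound on the slope is known only to the right of [t j]; starting from a nearby [w]
     costs at most [e]. *)
  pose w := t j + Num.min ((t j.+1 - t j) / 2) (e / 2 ^+ j).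
  have wt : t j < w.
    by rewrite /w ltrDl lt_min !divr_gt0 ?subr_gt0.
  have wt1 : w < t j.+1.
    rewrite /w -ltrBrDl gt_min; apply/orP; left; lra.
  have wu : w < u by exact: lt_le_trans wt1 (tu _).
  have w1 : 1 <= w by apply: le_trans (t1 j) (ltW wt).
  have [sw|wE] := thi j w wt (ltW wu); last by move: wu; rewrite wE ltxx.
  have := le_trans sw (slope_le w1 wt1 (tb _)).
  rewrite lee_fin ler_pdivlMr ?subr_gt0// /sj exprS => h.
  have := n_le (le_trans ler01 (t1 j)) (ltW wt) (lt_trans (_ : w%:E < (t j.+1)%:E)%E (tb _)).
  rewrite lte_fin => /(_ wt1) h2.
  have : 2 ^+ j * (w - t j) <= e.
    rewrite mulrC -ler_pdivlMr// /w addrAC subrr add0r ge_min.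
    by rewrite lexx orbT.
  move: h h2; rewrite /=; set A := fine _; set A' := fine _; set D := fine _; nra.
exists (fun j => t j.+1 - t j), m; split => [j|j||].
- by rewrite subr_ge0.
- have [->|tne] := eqVneq (t j.+1) (t j); first by rewrite subrr.
  have tlt : t j < t j.+1 by rewrite lt_neqAle eq_sym tne tnd.
  have -> : (t j.+1 - t j)%:E = lebesgue_measure (`]t j, t j.+1[%classic : set R).
    by rewrite lebesgue_measure_itv/= lte_fin tlt.
  apply: le_measure; rewrite ?inE//; first exact: measurable_slope_set.
  move=> w; rewrite /= in_itv/= => /andP[tw wt].
  have w1 : 1 <= w by apply: le_trans (t1 j) (ltW tw).
  have wu : w < u by exact: lt_le_trans wt (tu _).
  split=> //; split; first by apply: lt_trans ub; rewrite lte_fin.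
  rewrite sjS tlo// andbT.
  by case: (thi j w tw (ltW wu)) => // wE; move: wu; rewrite wE ltxx.
- rewrite (_ : _ - 1 = t m - t 0%N); last by rewrite tm t0.
  elim: m {tm} => [|m ih]; first by rewrite big_ord0 subrr.
  by rewrite big_ord_recr/= ih; ring.
- have : \sum_(j < m) 2 ^+ j * (t j.+1 - t j) <= n (t m) - n (t 0%N).
    elim: m {tm} => [|m ih]; first by rewrite big_ord0 subrr.
    rewrite big_ord_recr/=; move: ih (step m); rewrite /=; lra.
  rewrite tm; have : 0 <= n (t 0%N) by exact: fine_ge0.
  rewrite /=; lra.
Qed.

End exponent.

(** * Capped symmetric exponentials *)

Section capped_exponential.
Context {R : realType}.
Implicit Types (z : R) (beta : \bar R).

Local Notation expo := (exponential_distribution_exponential_prob__canonical__probability_measure_Probability (@ltr01 R)).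

Let expo_lt0 : expo `]-oo, 0[%classic = 0%E.
Proof.
apply: integral0_eq => x; rewrite /= in_itv/= => x0.
by rewrite lt0_exponential_pdf.
Qed.

Let expo_setC z : 0 < z ->
  expo (~` `[0, z]%classic) = (expR (- z))%:E.
Proof.
move=> z0; rewrite probability_setC//.
have -> : expo `[0, z]%classic = (1 - (expR (- 1 * z))%:E)%E :=
  exponential_prob_itv0c 1 z0.
by rewrite mulN1r -EFinB /=; congr EFin; ring.
Qed.

Let expo_gt z : 0 < z -> ((expR (- z))%:E <= expo `]z, +oo[%classic)%E.
Proof.
move=> z0; rewrite -expo_setC//.
rewrite -[leRHS]add0e -expo_lt0; apply: le_trans (measureU2 _ _ _) => //.
apply: le_measure; rewrite ?inE//; [exact: measurableC|exact: measurableU|].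
move=> x /=; rewrite !in_itv/= andbT => /negP; rewrite negb_and -!ltNge.
by move=> /orP[]; [left|right].
Qed.

(** The exponential law is a measure on all of [R] whose negative half-line is null, although the
    capped map takes negative values there; hence the condition for [e >= 0] only. *)
Let expo_far z (D : set R) : measurable D -> 0 <= z -> (forall e : R, D e -> 0 <= e -> z < e) ->
  (expo D <= (expR (- z))%:E)%E.
Proof.
move=> mD; rewrite le_eqVlt => /predU1P[<- _|z0 Dz].
  by rewrite oppr0 expR0; exact: probability_le1.
rewrite -expo_setC//; apply: le_measure; rewrite ?inE//; first exact: measurableC.
move=> e De /=; rewrite in_itv/=; move=> /andP[e0 ez].
by move: (Dz e De e0); rewrite ltNge ez.
Qed.

Let expo_null (D : set R) : measurable D -> (forall e : R, D e -> e < 0) -> expo D = 0%E.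
Proof.
move=> mD De; apply/eqP; rewrite eq_le measure_ge0 andbT -expo_lt0.
by apply: le_measure; rewrite ?inE// => e /De; rewrite /= in_itv.
Qed.

Let capped beta (e : R) : R := fine (mine e%:E beta).

Let cappedE beta e : (1 <= beta)%E ->
  capped beta e = if beta is r%:E then Num.min e r else e.
Proof.
case: beta => [r||]//= _; rewrite /capped; last by rewrite miney.
by rewrite -fine_min.
Qed.

Let measurable_capped beta : (1 <= beta)%E -> measurable_fun setT (capped beta).
Proof.
move=> b1; rewrite (funext (fun e => cappedE e b1)).
by case: beta b1 => [r||]//= _; exact: measurable_minr.
Qed.

Let symexp_lawE beta (D : set R) : symexp_law beta D =
  (2^-1%:E * expo (capped beta @^-1` D) +
   2^-1%:E * expo ((fun e => (- capped beta e)%R) @^-1` D))%E.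
Proof.
rewrite /symexp_law /pushforward /product_measure1.
rewrite integral_bernoulli_prob//; last 2 first.
  by rewrite invr_ge0 ler0n invf_le1 ?ler1n.
  by move=> x; exact: (measure_ge0 expo).
have -> : unstable.onem 2^-1 = 2^-1 :> R by rewrite /unstable.onem; lra.
rewrite addeC; congr (_ * _ + _ * _)%E; congr (exponential_prob 1 _);
  apply/seteqP; split => e; rewrite /xsection/= ?inE/= ?mul1r ?expr0 ?mul1r//.
- by rewrite expr1 mulN1r.
- by rewrite expr1 mulN1r.
Qed.

Context {d} {T : measurableType d} (Q : probability T R) (X : {RV Q >-> R}).
Context (beta : \bar R) (beta1 : (1 <= beta)%E).
Context (lawX : forall B : set R, measurable B ->
  distribution Q X B = symexp_law beta B).

Let mcap (D : set R) : measurable D -> measurable (capped beta @^-1` D).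
Proof. by move=> mD; rewrite -[_ @^-1` _]setTI; exact: measurable_capped. Qed.

Let mcapN (D : set R) : measurable D ->
  measurable ((fun e => - capped beta e) @^-1` D).
Proof.
move=> mD; rewrite -[_ @^-1` _]setTI.
exact: (measurableT_comp (@oppr_measurable R setT) (measurable_capped beta1)).
Qed.

Let law_le (D : set R) x y : measurable D ->
  (expo (capped beta @^-1` D) <= x%:E)%E ->
  (expo ((fun e => (- capped beta e)%R) @^-1` D) <= y%:E)%E ->
  (Q (X @^-1` D) <= (2^-1 * x + 2^-1 * y)%:E)%E.
Proof.
move=> mD h1 h2; have := lawX mD; rewrite /distribution/pushforward => ->.
rewrite symexp_lawE EFinD !EFinM.
by apply: leeD; apply: lee_wpmul2l => //; rewrite lee_fin.
Qed.

Let capped_lt0 e : capped beta e < 0 -> e < 0.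
Proof.
rewrite cappedE//; case: beta beta1 => [r||]//; rewrite lee_fin => r1.
by rewrite gt_min => /orP[//|]; lra.
Qed.

Let capped_le e : capped beta e <= e.
Proof. by rewrite cappedE//; case: beta => [r||]//; rewrite ge_min lexx. Qed.

Let capped_leb e : ((capped beta e)%:E <= beta)%E.
Proof.
by rewrite cappedE//; case: beta beta1 => [r||]// _; rewrite ?leey// lee_fin ge_min lexx orbT.
Qed.

Let mnormr_gt s : measurable [set x : R | s < `|x|].
Proof.
rewrite -[X in measurable X]setTI; have := @normr_measurable R setT.
by move=> /(_ measurableT `]s, +oo[%classic (measurable_itv _));
  rewrite set_itvoy.
Qed.

Lemma symexp_sym : symmetric_rv Q X.
Proof.
move=> B mB; have mNB : measurable (-%R @^-1` B).
  by rewrite -[_ @^-1` _]setTI; exact: oppr_measurable.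
have := lawX mB; have := lawX mNB; rewrite /distribution/pushforward /= => h1 h2.
rewrite h2; apply: etrans (esym h1); rewrite !symexp_lawE addeC.
congr (_ * _ + _ * _)%E; congr (exponential_prob 1 _).
by apply/seteqP; split => e /=; rewrite opprK.
Qed.

Lemma symexp_tail s : 0 <= s -> (Q [set w | (s < `|X w|)%R] <= (expR (- s))%:E)%E.
Proof.
move=> s0; have -> : expR (- s) = 2^-1 * expR (- s) + 2^-1 * expR (- s) by lra.
apply: (@law_le [set x | s < `|x|]) => //; apply: expo_far => //; [exact: mcap| |exact: mcapN|].
  move=> e /=; case: (ltP 0 (capped beta e)) => [c0|c0 + e0].
    by rewrite gtr0_norm// => h _; exact: lt_le_trans (capped_le e).
  have : capped beta e = 0.
    by apply/eqP; rewrite eq_le c0 leNgt; apply/negP => /capped_lt0; rewrite ltNge e0.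
  by move=> ->; rewrite normr0 ltNge s0.
move=> e /=; rewrite normrN; case: (ltP 0 (capped beta e)) => [c0|c0 + e0].
  by rewrite gtr0_norm// => h _; exact: lt_le_trans (capped_le e).
have : capped beta e = 0.
  by apply/eqP; rewrite eq_le c0 leNgt; apply/negP => /capped_lt0; rewrite ltNge e0.
by move=> ->; rewrite normr0 ltNge s0.
Qed.

Lemma symexp_cap : Q [set w | (beta < `|X w|%:E)%E] = 0%E.
Proof.
have mD : measurable [set x : R | (beta < `|x|%:E)%E].
  case: beta beta1 => [r||] //= _; first by under eq_set do rewrite lte_fin.
  by rewrite [X in measurable X](_ : _ = set0)//; apply/seteqP; split.
apply/eqP; rewrite eq_le measure_ge0 andbT.
have -> : 0%E = (2^-1 * 0 + 2^-1 * 0)%:E :> \bar R by rewrite mulr0 addr0.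
apply: (@law_le [set x : R | (beta < `|x|%:E)%E]) => //.
  rewrite expo_null//; first exact: mcap.
  move=> e /= h; apply: capped_lt0; rewrite ltNge; apply/negP => c0.
  by move: h; rewrite ger0_norm// ltNge capped_leb.
rewrite expo_null//; first exact: mcapN.
move=> e /= h; apply: capped_lt0; rewrite ltNge; apply/negP => c0.
by move: h; rewrite normrN ger0_norm// ltNge capped_leb.
Qed.

Let signX (c : bool) (D : set R) : measurable D ->
  Q [set w | D ((-1) ^+ c * X w)] = Q (X @^-1` D).
Proof.
case: c => mD; last by under eq_set do rewrite expr0 mul1r.
rewrite symexp_sym//; congr (Q _); apply/seteqP; split => w /=;
  by rewrite expr1 mulN1r.
Qed.

(** The right sign has probability 1/2, and an exponential beyond [z] stays at least [z] after
    capping because [z <= beta]. *)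
Lemma symexp_ge (c : bool) z : 0 < z -> (z%:E <= beta)%E ->
  ((2^-1 * expR (- z))%:E <= Q [set w | (z <= (-1) ^+ c * X w)%R])%E.
Proof.
move=> z0 zb; have mD : measurable [set x : R | z <= x].
  by rewrite -set_itvcy; exact: measurable_itv.
rewrite (@signX c [set x | z <= x])//.
have := lawX mD; rewrite /distribution/pushforward => ->.
rewrite symexp_lawE EFinM.
apply: (@le_trans _ _ (2^-1%:E * expo (capped beta @^-1` [set x | (z <= x)%R]))%E).
  apply: lee_wpmul2l; first by rewrite lee_fin.
  apply: (le_trans (expo_gt z0)); apply: le_measure; rewrite ?inE//.
    exact: mcap.
  move=> e /=; rewrite in_itv/= andbT cappedE//.
  by case: beta zb => [r||]//; [rewrite lee_fin le_min => -> /ltW->|move=> _ /ltW].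
by rewrite leeDl// mule_ge0.
Qed.

(** Failure takes the wrong sign, of probability 1/2, and an exponential beyond [y]. The bound tends
    to 1 as [y] grows, which allows such a condition on infinitely many levels at once. *)
Lemma symexp_geN (c : bool) y : 0 <= y ->
  ((1 - 2^-1 * expR (- y))%:E <= Q [set w | (- y <= (-1) ^+ c * X w)%R])%E.
Proof.
move=> y0; have mD : measurable [set x : R | x < - y].
  by rewrite -set_itvNyo; exact: measurable_itv.
rewrite (@signX c [set x | - y <= x])//; last first.
  by rewrite -set_itvcy; exact: measurable_itv.
have -> : X @^-1` [set x | - y <= x] = ~` (X @^-1` [set x | x < - y]).
  by apply/seteqP; split => w /= h; [apply/negP; rewrite -leNgt|rewrite leNgt; apply/negP].
rewrite probability_setC; last by apply: measurable_funPTI.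
rewrite EFinB; apply: leeB => //.
have -> : 2^-1 * expR (- y) = 2^-1 * 0 + 2^-1 * expR (- y) by rewrite mulr0 add0r.
apply: law_le => //.
  rewrite expo_null//; first exact: mcap.
  by move=> e /= h; apply: capped_lt0; lra.
apply: expo_far => //; first exact: mcapN.
by move=> e /= h e0; apply: lt_le_trans (capped_le e); lra.
Qed.

(** The mean of [|X|] is the integral of its tail, which is at most [expR (- s)], the exponential
    density. *)
Lemma symexp_norm_le1 : (\int[Q]_w `|X w|%:E <= 1)%E.
Proof.
pose Y : {RV Q >-> R} := (@Num.norm R R) \o X.
have := ge0_expectation_ccdf (X := Y) (fun w => normr_ge0 _).
rewrite expectation_def => ->.
have mpdf : measurable_fun setT (EFin \o @exponential_pdf R 1).
  by apply/measurable_EFinP; exact: measurable_exponential_pdf.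
have pdf0 (x : R) : (0 <= (exponential_pdf 1 x)%:E)%E.
  by rewrite lee_fin exponential_pdf_ge0.
have H : (\int[lebesgue_measure]_(x in `[0%R, +oo[) (exponential_pdf (1 : R) x)%:E <= 1)%E.
  rewrite -(integral_exponential_pdf (@ltr01 R)).
  exact: (@ge0_subset_integral _ _ R lebesgue_measure
  `[0%R, +oo[%classic setT (measurable_itv _) measurableT _ mpdf
  (fun x _ => pdf0 x) (@subsetT _ _)).
apply: le_trans H.
apply: ge0_le_integral => //.
- by apply: measurable_funTS; exact: ccdf_measurable.
- exact: measurable_funTS.
- move=> x; rewrite /= in_itv/= andbT => x0.
  rewrite exponential_pdfE// mul1r mulN1r.
  apply: le_trans (symexp_tail x0).
  by rewrite /ccdf /distribution /pushforward set_itvoy.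
Qed.

Lemma symexp_integrable : Q.-integrable setT (EFin \o X).
Proof.
apply/integrableP; split; first exact/measurable_EFinP.
exact: le_lt_trans symexp_norm_le1 (ltry _).
Qed.

End capped_exponential.

Lemma symmetric_mean0 {R : realType} {d} {T : measurableType d}
    (P : probability T R) (X : {RV P >-> R}) :
  symmetric_rv P X -> P.-integrable setT (EFin \o X) ->
  (\int[P]_w (X w)%:E = 0)%E.
Proof.
move=> sX iX; pose Y : {RV P >-> R} := (- X)%R.
have mE : measurable_fun [set: R] (@EFin R) by exact/measurable_EFinP.
have iY : P.-integrable setT (EFin \o Y).
  by apply: eq_integrable (integrableN iX) => // w _ /=.
have : (\int[distribution P X]_x x%:E = \int[distribution P Y]_x x%:E)%E.
  apply: eq_measure_integral => A mA _.
  exact: sX.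
rewrite !integral_distribution//= => h.
have f : (\int[P]_w (X w)%:E)%E \is a fin_num by exact: integrable_fin_num.
have : (\int[P]_w (Y w)%:E = - \int[P]_w (X w)%:E)%E.
  by rewrite -integralN//=; exact: integrable_add_def.
rewrite -h; move: f; case: (\int[P]_w _)%E => // r _ /eqP.
rewrite -EFinN eqe => /eqP rr; congr EFin; lra.
Qed.

(** * Convex order from tail comparison *)

Section tail_comparison.
Context {R : realType} {d} {T : measurableType d} (P : probability T R)
        {d'} {T' : measurableType d'} (Q : probability T' R).

Section one_sided.
Context (X : {RV P >-> R}) (Z : {RV Q >-> R}) (K : R) (K0 : 0 <= K).
Context (tail : forall u, 0 < u ->
  (P [set w | (u <= X w)%R] <= K%:E * Q [set w | (u <= Z w)%R])%E).

(** Superlevel sets of a monotone function may be open half-lines, so the comparison is also needed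
    for strict tails; it passes to them by exhaustion with closed ones. *)
Let strict_tail r : 0 <= r ->
  (P [set w | (r < X w)%R] <= K%:E * Q [set w | (r < Z w)%R])%E.
Proof.
move=> r0; pose F (S : Type) (V : S -> R) n := [set w : S | r + n.+1%:R^-1 <= V w].
have FE (S : Type) (V : S -> R) : [set w | r < V w] = \bigcup_n F S V n.
  apply/seteqP; split => w /=; last first.
    by move=> [n _] /=; apply: lt_le_trans; rewrite ltrDl.
  rewrite -subr_gt0 => h; exists (Num.bound (V w - r)^-1) => //=.
  rewrite /F/= -lerBrDl -[leRHS]invrK lef_pV2 ?posrE ?invr_gt0//.
  apply: ltW; apply: lt_trans (archi_boundP _) _; first by rewrite invr_ge0 ltW.
  by rewrite ltr_nat.
have Fcvg d0 (S : measurableType d0) (M : probability S R) (V : {RV M >-> R}) :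
    M (F S V n) @[n --> \oo] --> M [set w | r < V w].
  rewrite FE; apply: nondecreasing_cvg_mu => //.
  - move=> n; rewrite (_ : F _ _ _ = V @^-1` `[r + n.+1%:R^-1, +oo[%classic); last first.
      by rewrite set_itvcy.
    exact: measurable_funPTI.
  - apply: bigcup_measurable => n _.
    rewrite (_ : F _ _ _ = V @^-1` `[r + n.+1%:R^-1, +oo[%classic); last first.
      by rewrite set_itvcy.
    exact: measurable_funPTI.
  - move=> n m nm; apply/subsetPset => w /=; apply: le_trans.
    by rewrite lerD2l lef_pV2 ?posrE// ler_nat.
have cX := Fcvg _ _ _ X.
have cZ : (K%:E * Q (F _ Z n))%E @[n --> \oo] --> (K%:E * Q [set w | (r < Z w)%R])%E.
  by apply: cvgeZl => //; exact: Fcvg.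
rewrite -(cvg_lim _ cX)// -(cvg_lim _ cZ)//; apply: lee_lim.
- by apply/cvg_ex; eexists; exact: cX.
- by apply/cvg_ex; eexists; exact: cZ.
- by near=> n; apply: tail; rewrite ltr_wpDl.
Unshelve. all: by end_near. Qed.

(** Layer-cake formula: for [t >= 0] the set where [phi > t] is a half-line of positive reals, where
    the tails are compared. *)
Lemma monotone_integral_le (phi : R -> R) : {homo phi : x y / x <= y} ->
  (forall x, x <= 0 -> phi x = 0) ->
  (\int[P]_w (phi (X w))%:E <= K%:E * \int[Q]_w (phi (Z w))%:E)%E.
Proof.
move=> phind phi0.
have mphi : measurable_fun setT phi by exact: nondecreasing_measurable.
have phi_ge0 x : 0 <= phi x.
  case: (leP x 0) => [/phi0->//|/ltW x0].
  by rewrite -(phi0 0 (lexx 0)); exact: phind.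
have layer d0 (S : measurableType d0) (M : probability S R) (V : {RV M >-> R}) :
    (\int[M]_w (phi (V w))%:E =
     \int[lebesgue_measure]_(r in `[0%R, +oo[) M [set w | (r < phi (V w))%R])%E /\
    measurable_fun setT (fun r : R => M [set w | r < phi (V w)]).
  pose mm : measurable_fun setT (phi \o V) := measurableT_comp mphi (measurable_funPT V).
  pose W : {RV M >-> R} := HB.pack (phi \o V) (isMeasurableFun.Build _ _ _ _ (phi \o V) mm).
  have WE : (fun r : R => M [set w | r < phi (V w)]) = ccdf W.
    by apply/funext => r; rewrite /ccdf /distribution /pushforward set_itvoy.
  have := @ge0_expectation_ccdf _ _ _ M W (fun w => phi_ge0 _).
  rewrite expectation_def /= => ->; rewrite WE; split => //.
  exact: ccdf_measurable.
have [-> mX] := layer _ _ _ X; have [-> mZ] := layer _ _ _ Z.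
rewrite -ge0_integralZl//=; last exact: measurable_funTS.
apply: ge0_le_integral => //=.
- exact: measurable_funTS.
- by apply: measurable_funTS; exact: emeasurable_funM.
move=> t; rewrite in_itv/= andbT => t0.
pose U := [set x | t < phi x].
have Upos x : U x -> 0 < x.
  by rewrite /U/= => tx; rewrite ltNge; apply/negP => /phi0 x0; move: tx; rewrite x0 ltNge t0.
have Uup x y : U x -> x <= y -> U y.
  by rewrite /U/= => tx /phind; exact: lt_le_trans.
have [U0|/set0P[x0 Ux0]] := eqVneq U set0.
  have -> : [set w | t < phi (X w)] = set0.
    by apply/seteqP; split => w // tw; have : U (X w) by []; rewrite U0.
  by rewrite measure0 mule_ge0// lee_fin.
have lU : has_lbound U by exists 0 => x /Upos/ltW.
have iU : has_inf U by split => //; exists x0.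
pose r := inf U.
have r0 : 0 <= r by apply: lb_le_inf; [exists x0|move=> x /Upos/ltW].
(* The half-line is closed exactly when its left end [r] belongs to [U]. *)
have UE (S : Type) (V : S -> R) : [set w | t < phi (V w)] =
    if asbool (U r) then [set w | r <= V w] else [set w | r < V w].
  apply/seteqP; split => w; case: asboolP => Ur /= tw.
  - exact: ge_inf.
  - rewrite lt_neqAle ge_inf ?andbT//; apply/negP => /eqP rE.
    by apply: Ur; rewrite rE.
  - exact: Uup tw.
  - by have [y Uy yw] := inf_lt iU.1 tw; exact: Uup Uy (ltW yw).
rewrite !UE; case: asboolP => Ur; last exact: strict_tail.
by apply: tail; exact: Upos.
Qed.

End one_sided.

Lemma convex_functionR (f : R^o -> R^o) : convex_function [set: R^o] f ->
  forall x y t : R, 0 <= t <= 1 -> f (t * x + (1 - t) * y) <= t * f x + (1 - t) * f y.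
Proof.
move=> cf x y t /andP[t0 t1]; have := cf (Itv01 t0 t1) x y; rewrite !convRE /=.
by apply; rewrite inE.
Qed.

(** By convexity every slope to the left of 0 is at most every slope to the right; the supremum of
    the former is a subgradient. *)
Lemma convex_tangent0 (f : R -> R) :
  (forall x y t : R, 0 <= t <= 1 -> f (t * x + (1 - t) * y) <= t * f x + (1 - t) * f y) ->
  exists c, forall x, f 0 + c * x <= f x.
Proof.
move=> cf.
have chord x y : x < 0 -> 0 < y -> (f 0 - f x) / (- x) <= (f y - f 0) / y.
  move=> x0 y0; rewrite ler_pdivlMr// mulrAC ler_pdivrMr ?oppr_gt0//.
  have yx : 0 < y - x by lra.
  have := cf x y (y / (y - x)).
  have -> : y / (y - x) * x + (1 - y / (y - x)) * y = 0 by field; lra.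
  have -> : 0 <= y / (y - x) <= 1.
    by apply/andP; split; [rewrite divr_ge0 ?ltW | rewrite ler_pdivrMr//; lra].
  move=> /(_ isT); rewrite -(ler_pM2r yx).
  have -> : (y / (y - x) * f x + (1 - y / (y - x)) * f y) * (y - x) = y * f x - x * f y.
    by field; lra.
  by lra.
pose S := [set (f 0 - f x) / (- x) | x in [set x | x < 0]].
have S0 : S !=set0 by exists ((f 0 - f (-1)) / (- (-1))); exists (-1) => //=; lra.
have hS : has_sup S.
  split => //; exists ((f 1 - f 0) / 1) => _ [x x0 <-]; exact: chord.
exists (sup S) => x; have [x0|x0|->] := ltgtP x 0; last by rewrite mulr0 addr0.
- have : (f 0 - f x) / (- x) <= sup S by apply: sup_upper_bound => //; exists x.
  rewrite ler_pdivrMr ?oppr_gt0//; lra.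
- have : sup S <= (f x - f 0) / x by apply: sup_le_ub => // _ [y y0 <-]; exact: chord.
  rewrite ler_pdivlMr//; lra.
Qed.

Context (X : {RV P >-> R}) (Z : {RV Q >-> R}) (K : R) (K1 : 1 <= K).
Context (iX : P.-integrable setT (EFin \o X)) (iZ : Q.-integrable setT (EFin \o Z)).
Context (EX : (\int[P]_w (X w)%:E = 0)%E) (EZ : (\int[Q]_w (Z w)%:E = 0)%E).

(* Replacing X by X / K pays for the constant K in front of the tails: for a convex
   g >= 0 with g 0 = 0 one has g (x / K) <= g x / K. *)
Lemma convex_le_of_tail :
  (forall u, 0 < u ->
    (P [set w | (u <= X w)%R] <= K%:E * Q [set w | (u <= Z w)%R])%E) ->
  (forall u, 0 < u ->
    (P [set w | (u <= - X w)%R] <= K%:E * Q [set w | (u <= - Z w)%R])%E) ->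
  convex_le P (fun w => K^-1 * X w) Q Z.
Proof.
move=> tl tr f' /convex_functionR; pose f : R -> R := f'; rewrite -/f => cf.
rewrite !unlock => _ fZ.
have K0 : 0 < K by exact: lt_le_trans ltr01 K1.
have [c hc] := convex_tangent0 cf.
pose g (x : R) : R := f x - (f 0 + c * x).
have g0 x : 0 <= g x by rewrite /g subr_ge0.
have g00 : g 0 = 0 by rewrite /g mulr0 addr0 subrr.
have cg x y t : 0 <= t <= 1 -> g (t * x + (1 - t) * y) <= t * g x + (1 - t) * g y.
  by move=> t01; have := cf x y t t01; rewrite /g; lra.
have gscale t x : 0 <= t <= 1 -> g (t * x) <= t * g x.
  by move=> t01; have := cg x 0 t t01; rewrite mulr0 addr0 g00 mulr0 addr0.
have gmono (s : bool) x y : 0 <= x -> x <= y -> g ((-1) ^+ s * x) <= g ((-1) ^+ s * y).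
  move=> x0 xy; have [y0|y0] := eqVneq y 0.
    by have -> : x = y by apply/eqP; rewrite eq_le xy y0.
  have ypos : 0 < y by rewrite lt_neqAle eq_sym y0 (le_trans x0 xy).
  have xy1 : x / y <= 1 by rewrite ler_pdivrMr// mul1r.
  have xy0 : 0 <= x / y by rewrite divr_ge0// ltW.
  have -> : (-1) ^+ s * x = x / y * ((-1) ^+ s * y) by field.
  apply: (le_trans (gscale _ _ _)); first by rewrite xy0.
  by rewrite ler_piMl.
(* [h false] and [h true] are the parts of [g] on the two half-lines, each folded into a
   nondecreasing function vanishing on [x <= 0]. The one-sided comparison then applies to [X], [Z]
   and to [- X], [- Z]. *)
pose h (s : bool) (x : R) : R := g ((-1) ^+ s * Num.max x 0).
have hmono s : {homo h s : x y / x <= y}.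
  move=> x y xy; apply: gmono; first by rewrite le_max lexx orbT.
  by rewrite ge_max !le_max xy lexx !orbT.
have h0 s x : x <= 0 -> h s x = 0 by move=> x0; rewrite /h max_r// mulr0.
have h_ge0 s x : 0 <= h s x by exact: g0.
have gE x : g x = h false x + h true (- x).
  rewrite /h expr0 expr1 mul1r mulN1r; case: (boolP (0 <= x)) => [x0|].
    by rewrite max_l// max_r ?oppr_le0// oppr0 g00 addr0.
  by rewrite -ltNge => x0; rewrite max_r ?ltW// max_l ?oppr_ge0 ?ltW// opprK g00 add0r.
have mh s : measurable_fun setT (h s) by exact: nondecreasing_measurable.
have mhN s : measurable_fun setT (fun x : R => h s (- x)).
  exact: measurableT_comp (mh s) (@oppr_measurable R setT).
have mg : measurable_fun setT g.
  by rewrite (funext gE); apply: measurable_funD.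
pose NX : {RV P >-> R} := - X; pose NZ : {RV Q >-> R} := - Z.
have gXZ : (\int[P]_w (g (X w))%:E <= K%:E * \int[Q]_w (g (Z w))%:E)%E.
  have split_g d0 (S : measurableType d0) (M : probability S R) (V : {RV M >-> R}) :
      (\int[M]_w (g (V w))%:E =
       \int[M]_w (h false (V w))%:E + \int[M]_w (h true (- V w))%:E)%E.
    under eq_integral do rewrite gE EFinD.
    apply: ge0_integralD => //.
    - by move=> w _; rewrite lee_fin.
    - by apply/measurable_EFinP; apply: measurableT_comp (mh _) _.
    - by move=> w _; rewrite lee_fin.
    - by apply/measurable_EFinP; apply: (measurableT_comp (mhN true)).
  rewrite !split_g muleDr ?fin_num_adde_def//; last first.
    by apply: ge0_adde_def; rewrite inE; apply: integral_ge0 => w _; rewrite lee_fin.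
  apply: leeD.
    by apply: (@monotone_integral_le X Z) => //; [exact: ltW|exact: h0].
  by apply: (@monotone_integral_le NX NZ) => //; [exact: ltW|exact: h0].
have gXK : (\int[P]_w (g (K^-1 * X w)%R)%:E <= \int[Q]_w (g (Z w))%:E)%E.
  have mgX : measurable_fun setT (g \o X) by exact: measurableT_comp.
  apply: (@le_trans _ _ (K^-1%:E * \int[P]_w (g (X w))%:E)%E).
    have Ki0 : 0 <= K^-1 by rewrite invr_ge0 ltW.
    rewrite -ge0_integralZl//=; [|exact/measurable_EFinP|by move=> w _; rewrite lee_fin].
    apply: ge0_le_integral => //.
    - by move=> w _; rewrite lee_fin.
    - apply/measurable_EFinP; apply: (measurableT_comp mg).
      exact: measurable_funM.
    - by apply/measurable_EFinP; exact: measurable_funM.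
    - move=> w _; rewrite -EFinM lee_fin gscale// invr_ge0 (ltW K0)/=.
      by rewrite invf_le1.
  by rewrite lee_pdivrMl.
have fE x : f x = g x + (f 0 + c * x) by rewrite /g subrK.
have mf : measurable_fun setT f.
  by rewrite (funext fE); do 2!apply: measurable_funD => //; exact: measurable_funM.
have affine_int d0 (S : measurableType d0) (M : probability S R) (V : {RV M >-> R}) (k : R) :
    M.-integrable setT (EFin \o V) -> (\int[M]_w (V w)%:E = 0)%E ->
    M.-integrable setT (fun w => (f 0 + c * (k * V w))%:E) /\
    (\int[M]_w (f 0 + c * (k * V w))%:E = (f 0)%:E)%E.
  move=> iV EV.
  have ic : M.-integrable setT (EFin \o cst (f 0)) by apply: finite_measure_integrable_cst.
  have iV' : M.-integrable setT (fun w => ((c * k)%:E * (V w)%:E)%E).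
    by apply: integrableZl.
  have E1 : (fun w => (f 0 + c * (k * V w))%:E) =
      (fun w => (f 0)%:E + (c * k)%:E * (V w)%:E)%E.
    by apply/funext => w; rewrite EFinD mulrA EFinM.
  rewrite E1; split; first exact: integrableD.
  rewrite integralD// integralZl// EV mule0 adde0.
  rewrite integral_cst// -[RHS]mule1; congr (_ * _)%E.
  exact: probability_setT.
have [ihZ EhZ] := affine_int _ _ _ Z 1 iZ EZ.
have [ihX EhX] := affine_int _ _ _ X K^-1 iX EX.
have mfZ : measurable_fun setT (EFin \o (f \o Z)).
  by apply/measurable_EFinP; exact: measurableT_comp.
(* If the positive part of [f \o Z] has infinite mean, the right side is [+oo], the negative part
   having finite mean by hypothesis. Otherwise everything is integrable and the affine part
   contributes [f 0] on both sides. *)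
have [fy|fy] := eqVneq (\int[Q]_w ((EFin \o (f \o Z))^\+ w))%E +oo%E.
  rewrite [leRHS]integralE fy.
  rewrite (_ : (\int[Q]_w (EFin \o (f \o Z))^\- w)%E = (\int[Q]_w ((f \o Z)^\- w)%:E)%E).
    by rewrite addye ?leey// -ltNye lteNr/=.
  by rewrite funerneg.
have ifZ : Q.-integrable setT (EFin \o (f \o Z)).
  apply/integrableP; split => //.
  rewrite -/(abse \o (EFin \o (f \o Z))) fune_abse.
  rewrite ge0_integralD//; [|exact: measurable_funepos|exact: measurable_funeneg].
  apply: lte_add_pinfty; first by rewrite ltey.
  by rewrite funerneg.
have igZ : Q.-integrable setT (fun w => (g (Z w))%:E).
  rewrite (_ : (fun w => _) = (fun w => (f (Z w))%:E - (f 0 + c * (1 * Z w))%:E)%E).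
    exact: integrableB.
  by apply/funext => w; rewrite -EFinB mul1r.
have igX : P.-integrable setT (fun w => (g (K^-1 * X w))%:E).
  apply/integrableP; split.
    apply/measurable_EFinP; apply: (measurableT_comp mg).
    exact: measurable_funM.
  under eq_integral do rewrite gee0_abs ?lee_fin//.
  by apply: (le_lt_trans gXK); exact: integrable_lty.
rewrite /=.
under eq_integral do rewrite fE EFinD.
rewrite [leRHS](_ : _ = (\int[Q]_w ((g (Z w))%:E + (f 0 + c * (1 * Z w))%:E))%E); last first.
  by apply: eq_integral => w _; rewrite fE EFinD mul1r.
rewrite !integralD// EhX EhZ.
by apply: leeD.
Qed.

End tail_comparison.

(** * The slope expansion *)

Section measurable_limn.
Context {R : realType} {d} {T : measurableType d}.
Implicit Types S : nat -> T -> R.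

(** The Cauchy criterion with countable quantifiers. *)
Lemma measurable_cvgn_set S : (forall n, measurable_fun setT (S n)) ->
  measurable [set w | cvgn (S ^~ w)].
Proof.
move=> mS.
have -> : [set w | cvgn (S ^~ w)] = \bigcap_k \bigcup_N \bigcap_n
    ((fun w => `|S (N + n)%N w - S N w|) @^-1` `]-oo, k.+1%:R^-1[%classic).
  apply/seteqP; split => w /=.
    move=> /cvg_cauchy /cauchyP cS k _.
    have k0 : 0 < (2 * k.+1%:R)^-1 :> R by rewrite invr_gt0 mulr_gt0.
    have [x [N _ NS]] := cS _ k0.
    exists N => // n _ /=; rewrite in_itv/=.
    have := NS (N + n)%N (leq_addr _ _); have := NS N (leqnn _).
    rewrite /= /ball/= => h1 h2.
    have -> : S (N + n)%N w - S N w = (x - S N w) - (x - S (N + n)%N w) by ring.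
    apply: le_lt_trans (ler_normB _ _) _.
    have -> : k.+1%:R^-1 = (2 * k.+1%:R)^-1 + (2 * k.+1%:R)^-1 :> R.
      by rewrite invfM; field.
    exact: ltrD.
  move=> h; apply: cauchy_cvg; apply: cauchy_exP => e e0.
  have := h (Num.bound e^-1) I.
  move=> [N _ hN]; exists (S N w); exists N => // n /= Nn.
  have := hN (n - N)%N I; rewrite /= in_itv/= subnKC// => hn.
  rewrite /ball/= distrC; apply: (lt_trans hn).
  rewrite -[ltRHS]invrK ltf_pV2 ?posrE ?invr_gt0//.
  apply: lt_trans (archi_boundP _) _; first by rewrite invr_ge0 ltW.
  by rewrite ltr_nat.
apply: bigcapT_measurable => k; apply: bigcupT_measurable => N.
apply: bigcapT_measurable => n; rewrite -[_ @^-1` _]setTI.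
have mn : measurable_fun setT (fun w => `|S (N + n)%N w - S N w|).
  by apply: measurableT_comp => //; apply: measurable_funB.
exact: mn.
Qed.

(* Where the sequence diverges, [limn] is the constant [point]. *)
Lemma measurable_limn S : (forall n, measurable_fun setT (S n)) ->
  measurable_fun setT (fun w => limn (S ^~ w)).
Proof.
move=> mS; have mC := measurable_cvgn_set mS.
rewrite -(setUv [set w | cvgn (S ^~ w)]).
apply/measurable_funU => //; first exact: measurableC.
split.
  by apply: (@measurable_fun_cvg _ _ _ _ S) => [n|w]; [exact: measurable_funTS|].
apply: (eq_measurable_fun (cst point)) => //.
by move=> w; rewrite inE /= => /dvgP ->.
Qed.

(** The sigma-algebra on [T] is arbitrary: independence of the coordinates uses this lemma for the
    one generated by the variables of a single coordinate. *)
Lemma measurable_slope_expansion (N : R -> \bar R) (Xi : option nat -> T -> R) :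
  (forall k, active N k -> measurable_fun setT (Xi k)) ->
  measurable_fun setT (slope_expansion N Xi).
Proof.
move=> mXi; apply: measurable_funD; first exact: mXi.
apply: measurable_limn => n.
have -> : (fun w => \sum_(j < n | `[< active N (Some (j : nat)) >]) aj j * Xi (Some (j : nat)) w) =
    (fun w => \sum_(j < n) if `[< active N (Some (j : nat)) >]
       then aj j * Xi (Some (j : nat)) w else 0).
  by apply/funext => w; rewrite -big_mkcond.
apply: measurable_sum => j; case: asboolP => // aj0.
by apply: measurable_funM => //; exact: mXi.
Qed.

End measurable_limn.

Lemma independent_seq {R : realType} {d} {T : measurableType d}
    (P : probability T R) (I : choiceType) (D : set I) (X : I -> T -> R) :
  mutually_independent P D X ->
  forall (s : seq I) (B : I -> set R), uniq s -> (forall i, i \in s -> D i) ->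
    (forall i, measurable (B i)) ->
  P (\bigcap_(i in [set` s]) (X i @^-1` B i)) =
    (\prod_(i <- s) P (X i @^-1` B i))%E.
Proof.
move=> ind s B us sD mB; pose J := [fset x in s]%fset.
have JE : [set` J] = [set` s].
  by apply/seteqP; split => i /=; rewrite in_fset.
rewrite -JE ind//; last by rewrite JE => i /= /sD.
apply: perm_big; apply: uniq_perm => //.
by move=> i; rewrite in_fset.
Qed.

Lemma prod_expR_ge {R : realType} (s : seq nat) (f : nat -> \bar R) (t : nat -> R) :
  (forall j, j \in s -> ((expR (- t j))%:E <= f j)%E) ->
  ((expR (- \sum_(j <- s) t j))%:E <= \prod_(j <- s) f j)%E.
Proof.
elim: s => [|j s ih] h; first by rewrite !big_nil oppr0 expR0.
rewrite !big_cons opprD expRD EFinM; apply: lee_pmul.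
- by rewrite lee_fin expR_ge0.
- by rewrite lee_fin expR_ge0.
- by apply: h; rewrite mem_head.
- by apply: ih => i si; apply: h; rewrite in_cons si orbT.
Qed.

(** * Mean and tails of one expansion *)

Section expansion.
Context {R : realType} {d} {T : measurableType d} (Q : probability T R).
Context (N : R -> \bar R) (Xi : option nat -> {RV Q >-> R}).
Context (lawXi : forall k, active N k -> forall B : set R, measurable B ->
    distribution Q (Xi k) B = symexp_law (level_cap N k) B).

Local Notation H := (slope_expansion N (fun k => Xi k : T -> R)).

Definition level_term (j : nat) (w : T) : R :=
  if `[< active N (Some j) >] then aj j * Xi (Some j) w else 0.

Local Notation Z := level_term.

Lemma slope_expansionE w : H w = Xi None w + limn (series (Z ^~ w)).
Proof.
rewrite /slope_expansion.
suff -> : series (Z ^~ w) = fun n =>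
  \sum_(j < n | `[< active N (Some (j : nat)) >]) aj j * Xi (Some (j : nat)) w by [].
by apply/funext => n; rewrite /series /= big_mkord [RHS]big_mkcond.
Qed.

Lemma level_cap_ge1 k : active N k -> (1 <= level_cap N k)%E.
Proof.
case: k => [j|]//= wj; rewrite /cap.
case: (width N j) wj => [r||] //=; first by rewrite !lee_fin; lra.
by move=> _; rewrite gt0_mulye ?leey// lte_fin.
Qed.

Lemma measurable_level_term j : measurable_fun setT (Z j).
Proof.
rewrite /level_term; case: asboolP => // _.
exact: measurable_funM.
Qed.

Lemma measurable_expansion : measurable_fun setT H.
Proof. by apply: measurable_slope_expansion => k _; exact: measurable_funPT. Qed.

(** Its mean is at most the sum of the [aj j], hence at most 2. Finiteness almost surely gives
    absolute convergence of the series, and integrability makes [G] dominate the partial sums. *)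
Let G w : \bar R := (\sum_(0 <= j <oo) `|Z j w|%:E)%E.

Let G_ge0 w : (0 <= G w)%E.
Proof. by apply: nneseries_ge0 => n _ _; rewrite lee_fin. Qed.

Let mG : measurable_fun setT G.
Proof.
apply: (@ge0_emeasurable_sum _ _ _ _ (fun j w => `|Z j w|%:E) xpredT) => //.
move=> j _; apply/measurable_EFinP; apply: measurableT_comp => //.
exact: measurable_level_term.
Qed.

Let integral_term j : (\int[Q]_w `|Z j w|%:E <= (aj j)%:E)%E.
Proof.
have a0 : 0 <= aj j :> R by rewrite invr_ge0 exprn_ge0.
rewrite /level_term; case: asboolP => act; last first.
  by rewrite (eq_integral (cst 0%E)) ?integral0 ?lee_fin// => w _; rewrite normr0.
rewrite (eq_integral (fun w => (aj j)%:E * `|Xi (Some j) w|%:E)%E); last first.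
  by move=> w _; rewrite normrM (ger0_norm a0).
rewrite ge0_integralZl//=; last first.
  by apply/measurable_EFinP; exact: measurableT_comp.
rewrite -[leRHS]mule1; apply: lee_wpmul2l; first by rewrite lee_fin.
exact: (symexp_norm_le1 (level_cap_ge1 act) (lawXi act)).
Qed.

Lemma sum_aj n : \sum_(j < n) aj j = 2 - 2 / 2 ^+ n :> R.
Proof.
elim: n => [|n ih]; first by rewrite big_ord0 expr0 divr1 subrr.
rewrite big_ord_recr/= ih /aj exprS.
have : 2 ^+ n != 0 :> R by rewrite expf_neq0.
by move=> n0; field.
Qed.

Let integral_G : (\int[Q]_w G w <= 2)%E.
Proof.
rewrite integral_nneseries//; last first.
  move=> j; apply/measurable_EFinP; apply: measurableT_comp => //.
  exact: measurable_level_term.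
apply: lime_le.
  by apply: is_cvg_nneseries => n _ _; apply: integral_ge0 => w _; rewrite lee_fin.
near=> n; rewrite big_mkord.
apply: (@le_trans _ _ (\sum_(j < n) (aj j)%:E)%E).
  by apply: lee_sum => j _; exact: integral_term.
rewrite sumEFin lee_fin sum_aj lerBlDr lerDl divr_ge0// exprn_ge0//.
Unshelve. all: by end_near. Qed.

Let iG : Q.-integrable setT G.
Proof.
apply/integrableP; split => //.
under eq_integral do rewrite gee0_abs//.
exact: le_lt_trans integral_G (ltry _).
Qed.

Lemma summable_ae : {ae Q, forall w, cvgn (series (Z ^~ w))}.
Proof.
have := integrable_ae measurableT iG; apply: filterS => w /(_ I) fG.
apply: normed_cvg; apply: nnseries_is_cvg => //.
  by move=> n; exact: normr_ge0.
by move: fG; rewrite ge0_fin_numE.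
Qed.

Lemma series_le n w : (`|series (Z ^~ w) n|%:E <= G w)%E.
Proof.
apply: (@le_trans _ _ (\sum_(0 <= j < n) `|Z j w|%:E)%E).
  by rewrite sumEFin lee_fin; exact: ler_norm_sum.
by apply: nneseries_lim_ge => j _ _; rewrite lee_fin.
Qed.

Let T_ n w := Xi None w + series (Z ^~ w) n.

Let mT_ n : measurable_fun setT (T_ n).
Proof.
apply: measurable_funD => //.
by rewrite /series/=; apply: measurable_sum => j; exact: measurable_level_term.
Qed.

Let cvgT : {ae Q, forall w, (T_ n w)%:E @[n --> \oo] --> (H w)%:E}.
Proof.
have := summable_ae; apply: filterS => w cw.
apply: cvg_EFin; first by apply: nearW.
rewrite slope_expansionE; apply: cvgD => //; exact: cvg_cst.
Qed.

Let act0 : active N None. Proof. by []. Qed.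

Let iXi0 : Q.-integrable setT (EFin \o Xi None) :=
  symexp_integrable (level_cap_ge1 act0) (lawXi act0).

Let idom : Q.-integrable setT (fun w => (`|Xi None w|%:E + G w)%E).
Proof.
apply: integrableD => //.
by have := integrable_abse iXi0; apply: eq_integrable.
Qed.

Let domT w n : (`|(T_ n w)%:E| <= `|Xi None w|%:E + G w)%E.
Proof.
apply: (@le_trans _ _ (`|Xi None w|%:E + `|series (Z ^~ w) n|%:E)%E).
  by rewrite -EFinD lee_fin ler_normD.
by apply: leeD => //; exact: series_le.
Qed.

Let term_integral j : Q.-integrable setT (EFin \o Z j) /\ (\int[Q]_w (Z j w)%:E = 0)%E.
Proof.
rewrite /level_term; case: asboolP => act; last first.
  split; first by apply: finite_measure_integrable_cst.
  by rewrite integral0.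
have iX := symexp_integrable (level_cap_ge1 act) (lawXi act).
have eX := symmetric_mean0 (symexp_sym (lawXi act)) iX.
have -> : (EFin \o (fun w => aj j * Xi (Some j) w)) =
  (fun w => (aj j)%:E * (Xi (Some j) w)%:E)%E by apply/funext => w; rewrite /= EFinM.
split; first exact: integrableZl.
under eq_integral do rewrite EFinM.
by rewrite integralZl// eX mule0.
Qed.

Let ET n : (\int[Q]_w (T_ n w)%:E = 0)%E.
Proof.
have eX := symmetric_mean0 (symexp_sym (lawXi act0)) iXi0.
suff [iS eS] : Q.-integrable setT (fun w => (series (Z ^~ w) n)%:E) /\
    (\int[Q]_w (series (Z ^~ w) n)%:E = 0)%E.
  under eq_integral do rewrite EFinD.
  by rewrite integralD// eX eS adde0.
elim: n => [|n [iS eS]].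
  have E0 w : (series (Z ^~ w) 0)%:E = 0%E by rewrite seriesEord/= big_ord0.
  rewrite (funext E0); split; first by apply: finite_measure_integrable_cst.
  by rewrite integral0.
have [iz ez] := term_integral n.
have E w : (series (Z ^~ w) n.+1)%:E = ((series (Z ^~ w) n)%:E + (Z n w)%:E)%E.
  by rewrite seriesEnat/= big_nat_recr//= EFinD.
rewrite (funext E); split; first exact: integrableD.
by rewrite integralD// ez eS adde0.
Qed.

Lemma expansion_integrable : Q.-integrable setT (EFin \o H).
Proof.
have [] := dominated_convergence measurableT
  (fun n => (measurable_EFinP _ _).2 (mT_ n)) ((measurable_EFinP _ _).2 measurable_expansion)
  _ idom _ => //.
- by apply: filterS cvgT => w h _.
- by apply: nearW => w n _; exact: domT.
Qed.

Lemma expansion_mean0 : (\int[Q]_w (H w)%:E = 0)%E.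
Proof.
have [] := dominated_convergence measurableT
  (fun n => (measurable_EFinP _ _).2 (mT_ n)) ((measurable_EFinP _ _).2 measurable_expansion)
  _ idom _.
- by apply: filterS cvgT => w h _.
- by apply: nearW => w n _; exact: domT.
move=> _ _ h; apply/esym; rewrite -(cvg_lim _ h)//.
under eq_fun do rewrite /= ET.
by rewrite lim_cst.
Qed.

Local Notation ell j := (lebesgue_measure (slope_set N j)).

Let mnormr_lt (c : R) (V : T -> R) : measurable_fun setT V ->
  measurable [set w | c < `|V w|].
Proof.
move=> mV; have mN : measurable_fun setT (fun w => `|V w|).
  exact: measurableT_comp.
have := mN measurableT `]c, +oo[%classic (measurable_itv _).
by rewrite setTI set_itvoy.
Qed.

Let measurable_terms_cvg : measurable [set w | cvgn (series (Z ^~ w))].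
Proof.
apply: measurable_cvgn_set => n.
by rewrite /series/=; apply: measurable_sum => j; exact: measurable_level_term.
Qed.

Let null_diverge : Q (~` [set w | cvgn (series (Z ^~ w))]) = 0%E.
Proof.
apply/negligibleP; first exact: measurableC.
exact: summable_ae.
Qed.

(** A union bound. Off the events [E j] the series is at most [ys] in absolute value; the summand 1
    is the cap of the starred variable, and the divergence set is null. *)
Lemma tail_of_bad_events (E : nat -> set T) (q y : nat -> R) (qs ys : R) :
  (forall j, measurable (E j)) -> (forall j, (Q (E j) <= (q j)%:E)%E) ->
  (forall j w, ~ E j w -> `|Z j w| <= y j) ->
  (forall n, \sum_(j < n) q j <= qs) -> (forall n, \sum_(j < n) y j <= ys) ->
  (Q [set w | (1 + ys < `|H w|)%R] <= qs%:E)%E.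
Proof.
move=> mE QE Zy sq sy.
pose A0 := [set w | 1 < `|Xi None w|].
pose D := ~` [set w | cvgn (series (Z ^~ w))].
have mA0 : measurable A0 by exact: mnormr_lt.
have mD : measurable D by exact: measurableC.
have mU : measurable (\bigcup_j E j) by exact: bigcupT_measurable.
have QA0 : Q A0 = 0%E by exact: (symexp_cap (level_cap_ge1 act0) (lawXi act0)).
apply: (@le_trans _ _ (Q ((A0 `|` D) `|` \bigcup_j E j))).
  apply: le_measure; rewrite ?inE.
  - by apply: mnormr_lt; exact: measurable_expansion.
  - by do 2 apply: measurableU => //.
  move=> w /= Hw; apply: contrapT => /not_orP[/not_orP[nA nD] nE].
  have {}nD : cvgn (series (Z ^~ w)) by apply: contrapT.
  have Sn n : `|series (Z ^~ w) n| <= ys.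
    rewrite /series/= big_mkord; apply: le_trans (ler_norm_sum _ _ _) _.
    apply: le_trans (sy n); apply: ler_sum => j _; apply: Zy => Ej.
    by apply: nE; exists (j : nat).
  move: Hw; rewrite slope_expansionE ltNge => /negP; apply.
  apply: le_trans (ler_normD _ _) _; apply: lerD.
    by rewrite leNgt; apply/negP.
  rewrite ler_norml; apply/andP; split.
    by apply: limr_ge => //; apply: nearW => n; move: (Sn n); rewrite ler_norml => /andP[].
  by apply: limr_le => //; apply: nearW => n; move: (Sn n); rewrite ler_norml => /andP[].
apply: (@le_trans _ _ (Q (A0 `|` D) + Q (\bigcup_j E j))%E).
  by apply: measureU2 => //; exact: measurableU.
have -> : Q (A0 `|` D) = 0%E.
  apply/eqP; rewrite eq_le measure_ge0 andbT.
  by rewrite -(adde0 0%E) -{1}QA0 -null_diverge; exact: measureU2.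
rewrite add0e; apply: le_trans (measure_sigma_subadditive _ _ _ (subset_refl _)) _ => //.
apply: lime_le; first exact: is_cvg_nneseries.
near=> n; rewrite big_mkord; apply: (@le_trans _ _ (\sum_(j < n) (q j)%:E)%E).
  by apply: lee_sum => j _; exact: QE.
by rewrite sumEFin lee_fin.
Unshelve. all: by end_near. Qed.

(** The cap [(w + 1) / 2] is at most the width [w] because an active level has [w >= 1]; and
    [aj j * sj j = 2]. *)
Let null_cap j : Q [set w | (2%:E * ell j < `|Z j w|%:E)%E] = 0%E.
Proof.
have [act|nact] := pselect (active N (Some j)); last first.
  rewrite (_ : [set w | _] = set0) ?measure0//.
  apply/seteqP; split => w //=; rewrite /level_term; case: asboolP => // _.
  by rewrite normr0 ltNge mule_ge0.
apply/eqP; rewrite eq_le measure_ge0 andbT.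
rewrite -(symexp_cap (level_cap_ge1 act) (lawXi act)).
have mS : measurable [set w | (level_cap N (Some j) < `|Xi (Some j) w|%:E)%E].
  case: (level_cap N (Some j)) (level_cap_ge1 act) => [r||]// _.
  - by under eq_set do rewrite lte_fin; exact: mnormr_lt.
  - by rewrite (_ : [set w | _] = set0)//; apply/seteqP; split.
have mS' : measurable [set w | (2%:E * ell j < `|Z j w|%:E)%E].
  case: (2%:E * ell j)%E => [r||].
  - by under eq_set do rewrite lte_fin; apply: mnormr_lt; exact: measurable_level_term.
  - by rewrite (_ : [set w | _] = set0)//; apply/seteqP; split.
  - by rewrite (_ : [set w | _] = setT)//; apply/seteqP; split => w //= _; rewrite ltNye.
apply: le_measure; rewrite ?inE// => w /= Zw; rewrite ltNge; apply/negP => Xw.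
move: Zw; rewrite /level_term; case: asboolP => // _; rewrite ltNge => /negP; apply.
have a0 : 0 < aj j :> R by rewrite invr_gt0 exprn_gt0.
rewrite normrM (gtr0_norm a0) EFinM.
have -> : (2%:E * ell j = (aj j)%:E * width N j)%E.
  rewrite /width muleA -EFinM; congr (_%:E * _)%E.
  by rewrite /aj /sj exprS mulrCA mulVf ?mulr1// expf_neq0.
apply: lee_wpmul2l; first by rewrite lee_fin ltW.
apply: (le_trans Xw); move: act; rewrite /= /cap.
case: (width N j) => [r||]//=; last by move=> _; rewrite leey.
by rewrite !lee_fin; lra.
Qed.

Lemma sum_fine (l : nat -> \bar R) m (L : R) : (forall j, (0 <= l j)%E) ->
  (\sum_(j < m) l j <= L%:E)%E ->
  (forall j, (j < m)%N -> l j \is a fin_num) /\ \sum_(j < m) fine (l j) <= L.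
Proof.
move=> l0 lL; have lfin j : (j < m)%N -> l j \is a fin_num.
  move=> jm; rewrite ge0_fin_numE//; apply: le_lt_trans (ltry L).
  apply: le_trans lL; rewrite (bigD1 (Ordinal jm))//= leeDl//.
  exact: sume_ge0.
split => //; rewrite -lee_fin -sumEFin; apply: le_trans lL.
by apply: lee_sum => j _; rewrite fineK// lfin.
Qed.

(** Levels below [j0] are controlled by their caps. At level [j0 + k] the threshold
    [aj (j0 + k) * (s + k)] is exceeded with probability at most [exp (- s - k)]: the extra [k]
    makes the union bound summable, while the weights keep the sum of the thresholds below
    [2 ^- j0 * (2 * s + 2)]. *)
Lemma tail_upper j0 (L s : R) : 0 <= s -> (\sum_(j < j0) ell j <= L%:E)%E ->
  (Q [set w | (1 + (2 * L + 2 ^- j0 * (2 * s + 2)) < `|H w|)%R] <= (2 * expR (- s))%:E)%E.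
Proof.
move=> s0 h; have [//|lfin lL] := @sum_fine (fun j => ell j) _ _ _ h; clear h.
pose E j := if (j < j0)%N then [set w | (2%:E * ell j < `|Z j w|%:E)%E]
  else [set w | aj j * (s + (j - j0)%:R) < `|Z j w|].
pose y j := if (j < j0)%N then 2 * fine (ell j) else aj j * (s + (j - j0)%:R).
pose q j := if (j < j0)%N then 0 else expR (- s) / 2 ^+ (j - j0) : R.
have a0 j : 0 < aj j :> R by rewrite invr_gt0 exprn_gt0.
have y0 j : 0 <= y j.
  rewrite /y; case: ifP => _; first by rewrite mulr_ge0// fine_ge0.
  by rewrite mulr_ge0 ?(ltW (a0 j))// addr_ge0.
have q0 j : 0 <= q j.
  by rewrite /q; case: ifP => _ //; rewrite divr_ge0 ?expR_ge0// exprn_ge0.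
have EE j : E j = [set w | y j < `|Z j w|].
  rewrite /E /y; case: ifP => // jj0; apply/seteqP; split => w /=;
  by rewrite -[ell j]fineK ?lfin// -EFinM lte_fin.
have shift (u : nat -> R) n : (forall j, 0 <= u j) ->
    \sum_(j < n) u j <= \sum_(j < j0) u j + \sum_(i < n) u (j0 + i)%N.
  move=> u0; rewrite [leRHS](_ : _ = \sum_(j < n + j0) u j).
    by rewrite big_split_ord/= lerDl; exact: sumr_ge0.
  by rewrite addnC big_split_ord.
apply: (@tail_of_bad_events E q y).
- by move=> j; rewrite EE; apply: mnormr_lt; exact: measurable_level_term.
- move=> j; rewrite /E /q; case: ifP => jj0; first by rewrite null_cap.
  set k := (j - j0)%N.
  apply: (@le_trans _ _ (expR (- (s + k%:R)))%:E); last first.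
    rewrite lee_fin opprD expRD ler_wpM2l ?expR_ge0//.
    rewrite expRN lef_pV2 ?posrE ?expR_gt0 ?exprn_gt0//.
    rewrite -[k%:R]mulr1 expRM_natl; apply: lerXn2r; rewrite ?nnegrE ?expR_ge0//.
    by have := @expR_ge1Dx R 1; lra.
  have [act|nact] := pselect (active N (Some j)); last first.
    rewrite (_ : [set w | _] = set0) ?measure0 ?lee_fin ?expR_ge0//.
    apply/seteqP; split => w //=; rewrite /level_term; case: asboolP => // _.
    by rewrite normr0 ltNge mulr_ge0 ?(ltW (a0 j))// addr_ge0.
  rewrite (_ : [set w | _] = [set w | s + k%:R < `|Xi (Some j) w|]).
    exact: (symexp_tail (level_cap_ge1 act) (lawXi act) (addr_ge0 s0 (ler0n _ _))).
  apply/seteqP; split => w /=; rewrite /level_term; case: asboolP => // _;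
    by rewrite normrM (gtr0_norm (a0 j)) ltr_pM2l.
- by move=> j w; rewrite EE /= => /negP; rewrite -leNgt.
- move=> n; apply: (le_trans (shift _ _ q0)).
  rewrite big1 ?add0r; last by move=> j _; rewrite /q ltn_ord.
  rewrite (eq_bigr (fun i : 'I_n => expR (- s) * aj i)); last first.
    by move=> i _; rewrite /q ltnNge leq_addr/= addKn.
  rewrite -mulr_sumr sum_aj mulrC ler_wpM2r ?expR_ge0// lerBlDr lerDl.
  by rewrite divr_ge0// exprn_ge0.
- move=> n; apply: (le_trans (shift _ _ y0)); apply: lerD.
    rewrite (eq_bigr (fun j : 'I_j0 => 2 * fine (ell j))); last first.
      by move=> j _; rewrite /y ltn_ord.
    by rewrite -mulr_sumr ler_pM2l.
  rewrite (eq_bigr (fun i : 'I_n => 2 ^- j0 * (aj i * (s + i%:R)))); last first.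
    move=> i _; rewrite /y ltnNge leq_addr/= addKn /aj exprD invfM.
    by rewrite !mulrA.
  rewrite -mulr_sumr ler_pM2l ?invr_gt0 ?exprn_gt0//.
  have -> : \sum_(i < n) aj i * (s + i%:R) = 2 * s + 2 - 2 * (s + n%:R + 1) / 2 ^+ n.
    elim: n => [|n ih]; first by rewrite big_ord0 expr0 divr1; ring.
    rewrite big_ord_recr/= ih /aj exprS -natr1.
    have : 2 ^+ n != 0 :> R by rewrite expf_neq0.
    by move=> n0; field.
  rewrite lerBlDr lerDl divr_ge0 ?exprn_ge0// mulr_ge0// !addr_ge0//.
Qed.

(** With finite total length the caps alone bound [H]; this serves the points at or beyond the
    endpoint. *)
Lemma tail_bounded (L : R) : (forall m, (\sum_(j < m) ell j <= L%:E)%E) ->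
  Q [set w | 1 + 2 * L < `|H w|] = 0%E.
Proof.
move=> sL; have fin j : ell j \is a fin_num.
  by have [//|f _] := @sum_fine (fun j => ell j) _ _ _ (sL j.+1); apply: f.
pose E j := [set w | (2%:E * ell j < `|Z j w|%:E)%E].
have EE j : E j = [set w | 2 * fine (ell j) < `|Z j w|].
  by apply/seteqP; split => w; rewrite /E/= -[ell j]fineK// -EFinM lte_fin.
apply/eqP; rewrite eq_le measure_ge0 andbT.
apply: (@tail_of_bad_events E (fun=> 0) (fun j => 2 * fine (ell j))).
- by move=> j; rewrite EE; apply: mnormr_lt; exact: measurable_level_term.
- by move=> j; rewrite null_cap.
- by move=> j w; rewrite EE /= => /negP; rewrite -leNgt.
- by move=> n; rewrite big1.
- move=> n; rewrite -mulr_sumr ler_pM2l//.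
  by have [//|_] := @sum_fine (fun j => ell j) _ _ _ (sL n).
Qed.

Context (ind : mutually_independent Q [set k | active N k] (fun k => Xi k : T -> R)).

(** A forced level asks for [t / 4] only; the factor 1/2 for the sign is paid by the remaining
    [3 / 4 * t], large enough once [t >= 2]. *)
Let expR_half t : 2 <= t -> expR (- t) <= 2^-1 * expR (- (t / 4)) :> R.
Proof.
move=> t2; have -> : - t = - (3 / 4 * t) + - (t / 4) :> R by lra.
rewrite expRD ler_wpM2r ?expR_ge0// expRN lef_pV2 ?posrE ?expR_gt0//.
by apply: le_trans (expR_ge1Dx _); lra.
Qed.

(** Applied to [t = expR (- y)], it puts the probability [1 - 2^-1 * expR (- y)] into exponential
    form, so that a product over the levels is controlled by a sum. *)
Let expR_small t : 0 <= t <= 1 -> expR (- t) <= 1 - 2^-1 * t :> R.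
Proof.
move=> /andP[t0 t1]; rewrite expRN.
have h : 1 + t <= expR t by exact: expR_ge1Dx.
rewrite -div1r ler_pdivrMr ?expR_gt0//.
apply: (@le_trans _ _ ((1 - 2^-1 * t) * (1 + t))); first by nra.
by rewrite ler_wpM2l//; lra.
Qed.

Let sum_geo n : \sum_(j < n) (8 / 9) ^+ j <= 9 :> R.
Proof.
have -> : \sum_(j < n) (8 / 9) ^+ j = 9 - 9 * (8 / 9) ^+ n :> R.
  elim: n => [|n ih]; first by rewrite big_ord0 expr0; ring.
  by rewrite big_ord_recr/= ih exprS; field.
by rewrite lerBlDr lerDl mulr_ge0// exprn_ge0//; lra.
Qed.

Let sum_aj_id n : \sum_(j < n) aj j * j%:R <= 2 :> R.
Proof.
have -> : \sum_(j < n) aj j * j%:R = 2 - 2 * (n%:R + 1) / 2 ^+ n :> R.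
  elim: n => [|n ih]; first by rewrite big_ord0 expr0 divr1; ring.
  rewrite big_ord_recr/= ih /aj exprS -natr1.
  have : 2 ^+ n != 0 :> R by rewrite expf_neq0.
  by move=> n0; field.
by rewrite lerBlDr lerDl divr_ge0 ?exprn_ge0// mulr_ge0// addr_ge0.
Qed.

(** Levels with [2 ^+ j * x j < 2] are not forced; they lose less than [2 * aj j] of length each, in
    total [4 - 4 / 2 ^+ m]. The lower bounds [- j / 8] cost at most 1/4 after weighting by [aj j],
    which leaves 3/4 of the contribution of the starred variable. *)
Lemma tail_lower (c : bool) (x : nat -> R) m : (forall j, 0 <= x j) ->
  (forall j, ((x j)%:E <= ell j)%E) ->
  ((2^-1 * expR (- 10) * expR (- \sum_(j < m) 2 ^+ j * x j))%:E <=
   Q [set w | (3 / 4 + (\sum_(j < m) x j - (4 - 4 / 2 ^+ m)) / 4 <= (-1) ^+ c * H w)%R])%E.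
Proof.
move=> x0 xell.
(* The event considered is Xi_* >= 1, Xi_j >= 2^j x_j / 4 on the big levels and
   Xi_j >= - j / 8 on the others, whose total contribution is then bounded below. *)
pose big j := (j < m)%N && (2 <= 2 ^+ j * x j).
pose z k := match k with
  | None => 1
  | Some j => if big j then 2 ^+ j * x j / 4 else - (j%:R / 8) end.
have a0 j : 0 < aj j :> R by rewrite invr_gt0 exprn_gt0.
have p0 j : 0 < 2 ^+ j :> R by rewrite exprn_gt0.
have width_ge j : ((2 * (2 ^+ j * x j))%:E <= width N j)%E.
  by rewrite mulrA -exprS EFinM /width; apply: lee_wpmul2l.
have big_act j : big j -> active N (Some j).
  move=> /andP[_ b]; apply: le_trans (width_ge j); rewrite lee_fin; lra.
have big_cap j : big j -> ((2 ^+ j * x j / 4)%:E <= cap N j)%E.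
  move=> bj; move: (width_ge j) (big_act _ bj); rewrite /= /cap.
  case: (width N j) => [r||]//=; last by move=> _ _; rewrite gt0_mulye ?leey ?lte_fin.
  rewrite !lee_fin; lra.
pose B k : set R := [set r | z k <= (-1) ^+ c * r].
have mB k : measurable (B k).
  rewrite /B; case: (c) => /=.
    rewrite (_ : [set r | _] = `]-oo, - z k]%classic) ?measurable_itv//.
    by apply/seteqP; split => r /=; rewrite in_itv/= expr1 mulN1r lerNr.
  rewrite (_ : [set r | _] = `[z k, +oo[%classic) ?measurable_itv//.
  by apply/seteqP; split => r /=; rewrite in_itv/= expr0 mul1r andbT.
pose ks n : seq (option nat) :=
  None :: [seq Some j | j <- iota 0 n & `[< active N (Some j) >]].
(* [expR (- t j)] bounds the probability of the condition on level [j] from below. The ratio 8/9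
   dominates [exp (- 1 / 8)], since [exp (1 / 8) >= 9 / 8]; its geometric sum 9 and the exponent 1
   of the starred variable make up the 10. *)
pose t j := (if (j < m)%N then 2 ^+ j * x j else 0) + (8 / 9) ^+ j.
have t_ge0 j : 0 <= t j.
  apply: addr_ge0; last by rewrite exprn_ge0//; lra.
  by case: ifP => // _; rewrite mulr_ge0// ltW.
pose p : R := 2^-1 * expR (- 10) * expR (- \sum_(j < m) 2 ^+ j * x j).
pose F n := \bigcap_(k in [set` ks n]) (Xi k @^-1` B k).
have mF n : measurable (F n).
  apply: fin_bigcap_measurable => // k _; exact: measurable_funPTI.
have QF n : (p%:E <= Q (F n))%E.
  rewrite (independent_seq ind)//; last 2 first.
  - rewrite /ks /= map_inj_uniq ?filter_uniq ?iota_uniq ?andbT//;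
    by [apply/negP => /mapP[]|move=> i j []].
  - move=> k; rewrite in_cons => /predU1P[->//|/mapP[j]].
    by rewrite mem_filter => /andP[/asboolP act _ ->].
  rewrite big_cons big_map.
  apply: (@le_trans _ _ ((2^-1 * expR (- 1))%:E *
      (expR (- \sum_(j <- [seq j <- iota 0 n | `[< active N (Some j) >]]) t j))%:E)%E).
    rewrite -EFinM lee_fin /p big_filter -!mulrA ler_wpM2l// -!expRD ler_expR.
    have : \sum_(j <- iota 0 n | `[< active N (Some j) >]) t j <=
        \sum_(j < n) t j.
      rewrite big_mkcond/= -[X in iota 0 X]subn0 -/(index_iota 0 n) big_mkord.
      by apply: ler_sum => j _; case: asboolP.
    have : \sum_(j < n) t j <= \sum_(j < m) 2 ^+ j * x j + 9.
      rewrite /t big_split/=; apply: lerD; last exact: sum_geo.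
      pose g j := if (j < m)%N then 2 ^+ j * x j else 0.
      have g0 j : 0 <= g j by rewrite /g; case: ifP => // _; rewrite mulr_ge0// ltW.
      apply: (@le_trans _ _ (\sum_(j < n + m) g j)).
        by rewrite big_split_ord/= lerDl; exact: sumr_ge0.
      rewrite addnC big_split_ord/= [X in _ + X]big1 ?addr0; last first.
        by move=> i _; rewrite /g ltnNge leq_addr.
      by apply: ler_sum => j _; rewrite /g ltn_ord.
    lra.
  apply: lee_pmul; rewrite ?lee_fin ?expR_ge0 ?mulr_ge0 ?expR_ge0//.
    exact: (symexp_ge (level_cap_ge1 act0) (lawXi act0) c ltr01 (lexx _)).
  apply: prod_expR_ge => j.
  rewrite mem_filter => /andP[/asboolP act _].
  have cap1 := level_cap_ge1 act; have law := lawXi act.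
  have g0 : 0 <= (8 / 9) ^+ j :> R by rewrite exprn_ge0//; lra.
  rewrite /t; have [bj|nbj] := boolP (big j).
    apply: le_trans (_ : _ <= (2^-1 * expR (- z (Some j)))%:E)%E _.
      rewrite lee_fin /z bj; move/andP: bj => [-> b2].
      apply: le_trans (expR_half b2); rewrite ler_expR; lra.
    apply: (symexp_ge cap1 law); first by rewrite /z bj; move/andP: bj => [_]; lra.
    by rewrite /z bj; exact: big_cap.
  have zE : z (Some j) = - (j%:R / 8) by rewrite /z (negbTE nbj).
  apply: le_trans (_ : _ <= (1 - 2^-1 * expR (- (j%:R / 8)))%:E)%E _; last first.
    rewrite -[B _]/([set r | z (Some j) <= (-1) ^+ c * r]) zE.
    by apply: (symexp_geN cap1 law c); rewrite divr_ge0.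
  rewrite lee_fin; apply: le_trans (expR_small _); last first.
    rewrite expR_ge0/= -expR0 ler_expR oppr_le0 divr_ge0//.
  rewrite ler_expR lerN2.
  apply: (@le_trans _ _ ((8 / 9) ^+ j)); last first.
    by rewrite lerDr; case: ifP => // _; rewrite mulr_ge0// ltW.
  rewrite -mulrN expRM_natl; apply: lerXn2r; rewrite ?nnegrE ?expR_ge0//; try lra.
  have h := @expR_ge1Dx R 8^-1.
  by rewrite expRN -[leLHS]div1r ler_pdivrMr ?expR_gt0//; lra.
(* Independence handles finitely many levels at a time. The bound does not depend on [n] and the
   events decrease, so continuity from above extends it to all levels. *)
have QF_inf : (p%:E <= Q (\bigcap_n F n))%E.
  have cF : Q (F n) @[n --> \oo] --> Q (\bigcap_n F n).
    apply: nonincreasing_cvg_mu => //.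
    - by rewrite ltey_eq fin_num_measure.
    - exact: bigcapT_measurable.
    - move=> n n' nn'; apply/subsetPset => w Fw k /= kn; apply: Fw => /=.
      move: kn; rewrite !in_cons => /predU1P[->//|/mapP[j]].
      rewrite mem_filter => /andP[act]; rewrite mem_iota add0n => jn ->.
      apply/orP; right; apply/mapP; exists j => //.
      by rewrite mem_filter act mem_iota add0n /= (leq_trans jn).
  rewrite -(cvg_lim _ cF)//; apply: lime_ge; first by apply/cvg_ex; eexists; exact: cF.
  exact: nearW.
pose C := [set w | cvgn (series (Z ^~ w))].
pose U := [set w | 3 / 4 + (\sum_(j < m) x j - (4 - 4 / 2 ^+ m)) / 4 <= (-1) ^+ c * H w].
have mU : measurable U.
  have mH : measurable_fun setT (fun w => (-1) ^+ c * H w).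
    by apply: measurable_funM => //; exact: measurable_expansion.
  have := mH measurableT `[3 / 4 + (\sum_(j < m) x j - (4 - 4 / 2 ^+ m)) / 4, +oo[%classic
    (measurable_itv _).
  by rewrite setTI set_itvcy.
have mC : measurable C by exact: measurable_terms_cvg.
apply: (le_trans QF_inf); apply: (@le_trans _ _ (Q (U `|` ~` C))); last first.
  rewrite -[leRHS]adde0 -null_diverge; apply: measureU2 => //.
  exact: measurableC.
apply: le_measure; rewrite ?inE//; first exact: bigcapT_measurable.
  by apply: measurableU => //; exact: measurableC.
move=> w Fw; have [Cw|nC] := pselect (C w); [left|by right].
have X0 : 1 <= (-1) ^+ c * Xi None w by apply: (Fw 0%N I None); rewrite /= mem_head.
have Xj j : active N (Some j) -> z (Some j) <= (-1) ^+ c * Xi (Some j) w.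
  move=> act; apply: (Fw j.+1 I (Some j)); rewrite /= in_cons; apply/orP; right.
  apply/mapP; exists j => //; rewrite mem_filter mem_iota leq0n add0n ltnSn !andbT.
  exact/asboolP.
(* One formula for forced and other levels: on the latter [x j <= 2 * aj j], so the first term is
   nonpositive. *)
pose lo j := (if (j < m)%N then (x j - 2 * aj j) / 4 else 0) - aj j * j%:R / 8.
have Zlo j : lo j <= (-1) ^+ c * Z j w.
  have aE : aj j * 2 ^+ j = 1 :> R by rewrite mulVf// expf_neq0.
  have aj0 : 0 <= aj j * j%:R / 8 :> R by rewrite divr_ge0// mulr_ge0// ltW.
  have small : ~~ big j -> lo j <= - (aj j * j%:R / 8).
    rewrite /big /lo; case: ifP => //= _ ; last by rewrite add0r.
    rewrite -ltNge => h; have : x j <= 2 * aj j.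
      rewrite -(ler_pM2l (p0 j)) mulrCA [_ * aj j]mulrC aE; lra.
    lra.
  rewrite /level_term; case: asboolP => act; last first.
    rewrite mulr0; apply: le_trans (small _) _; last by rewrite oppr_le0.
    by apply/negP => /big_act.
  rewrite mulrCA; apply: le_trans (_ : _ <= aj j * z (Some j)) _; last first.
    by rewrite ler_pM2l//; exact: Xj.
  rewrite /z; case: ifPn => [bj|/small h].
    have -> : aj j * (2 ^+ j * x j / 4) = x j / 4 by rewrite !mulrA aE mul1r.
    rewrite /lo; move/andP: bj => [-> _]; have := a0 j; lra.
  by move: h; rewrite mulrN mulrA.
rewrite /U/= slope_expansionE mulrDr.
have -> : (-1) ^+ c * limn (series (Z ^~ w)) = limn (fun n => (-1) ^+ c * series (Z ^~ w) n).
  by apply/esym/cvg_lim => //; apply: cvgMr.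
suff : - (1 / 4) + (\sum_(j < m) x j - (4 - 4 / 2 ^+ m)) / 4 <=
    limn (fun n => (-1) ^+ c * series (Z ^~ w) n) by lra.
apply: limr_ge; first by apply: is_cvgMr.
near=> n; have mn : (m <= n)%N by near: n; exact: nbhs_infty_ge.
rewrite seriesEord/= mulr_sumr; apply: (@le_trans _ _ (\sum_(j < n) lo j)); last first.
  by apply: ler_sum => j _; exact: Zlo.
rewrite /lo big_split/= sumrN -mulr_suml.
have -> : \sum_(j < n) (if (j < m)%N then (x j - 2 * aj j) / 4 else 0) =
    \sum_(j < m) (x j - 2 * aj j) / 4.
  rewrite -(subnKC mn) big_split_ord/= [X in _ + X]big1 ?addr0; last first.
    by move=> i _; rewrite ltnNge leq_addr.
  by apply: eq_bigr => j _; rewrite ltn_ord.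
rewrite -mulr_suml big_split/= sumrN -mulr_sumr sum_aj.
have := sum_aj_id n; lra.
Unshelve. all: by end_near. Qed.

End expansion.

(** * Comparison of one coordinate *)

Lemma convex_le_scale {R : realType} {d} {T : measurableType d} {d'} {T' : measurableType d'}
    (P : probability T R) (A : T -> R) (Q : probability T' R) (B : T' -> R) (k : R) :
  convex_le P A Q B -> convex_le P (fun w => k * A w) Q (fun w => k * B w).
Proof.
move=> AB f cf fA fB; apply: (AB (fun x => f (k * x))) => //.
move=> t x y xD yD; have := cf t (k * x) (k * y); rewrite !inE => /(_ I I).
congr (f _ <= _).
have ring_id (s x' y' : R) : s * (k * x') + (1 - s) * (k * y') = k * (s * x' + (1 - s) * y').
  by ring.
exact: ring_id.
Qed.

Section coordinate.
Context {R : realType} {d} {T : measurableType d} (P : probability T R)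
  (Y : {RV P >-> R}) {d'} {T' : measurableType d'} (Q : probability T' R)
  (Xi : option nat -> {RV Q >-> R}).
Local Notation N := (tail_exponent P Y).
Local Notation H := (slope_expansion N (fun k => Xi k : T' -> R)).
Context (symY : symmetric_rv P Y) (N_cvx : convex_efun N)
  (N_nd : nondecreasing_efun N) (N0 : N 0 = 0%E) (qN1 : qinv N 1 = 1%E).
Context (ind : mutually_independent Q [set k | active N k] (fun k => Xi k : T' -> R)).
Context (lawXi : forall k, active N k -> forall B : set R, measurable B ->
    distribution Q (Xi k) B = symexp_law (level_cap N k) B).

Let mabs u : measurable [set w | u <= `|Y w|].
Proof.
have mN : measurable_fun setT (fun w => `|Y w|) by exact: measurableT_comp.
have := mN measurableT `[u, +oo[%classic (measurable_itv _).
by rewrite setTI set_itvcy.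
Qed.

Let msgn (c : bool) u : measurable [set w | u <= (-1) ^+ c * Y w].
Proof.
have mN : measurable_fun setT (fun w => (-1) ^+ c * Y w) by exact: measurable_funM.
have := mN measurableT `[u, +oo[%classic (measurable_itv _).
by rewrite setTI set_itvcy.
Qed.

Lemma tail_exponent_ge0 u : (0 <= N u)%E.
Proof. by rewrite /tail_exponent oppe_ge0 lne_le0; exact: probability_le1. Qed.

Let N_ge0 := tail_exponent_ge0.

Lemma tail_probE u : P [set w | u <= `|Y w|] = expeR (- N u)%E.
Proof. by rewrite /tail_exponent oppeK lneK// in_itv/= measure_ge0 leey. Qed.

Let tail_fin u : N u \is a fin_num ->
  P [set w | u <= `|Y w|] = (expR (- fine (N u)))%:E.
Proof. by move=> f; rewrite tail_probE -{1}(fineK f). Qed.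

Let half_tail (c : bool) u : 0 < u ->
  (P [set w | (u <= `|Y w|)%R] <= 2%:E * P [set w | (u <= (-1) ^+ c * Y w)%R])%E.
Proof.
move=> u0; have PE (c' : bool) : P [set w | u <= (-1) ^+ c' * Y w] = P [set w | u <= Y w].
  case: c'; last by under eq_set do rewrite mul1r.
  have := symY (measurable_itv `[u, +oo[); rewrite /preimage set_itvcy/= => ->.
  by under eq_set do rewrite mulN1r.
apply: (@le_trans _ _ (P ([set w | u <= (-1) ^+ false * Y w] `|`
    [set w | u <= (-1) ^+ true * Y w]))).
  apply: le_measure; rewrite ?inE//; first exact: measurableU.
  move=> w /=; rewrite expr0 expr1 mul1r mulN1r.
  by case: (ger0P (Y w)) => _; [left|right].
apply: (@le_trans _ _ (P [set w | (u <= (-1) ^+ false * Y w)%R] +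
    P [set w | (u <= (-1) ^+ true * Y w)%R])%E); first exact: measureU2.
by rewrite !PE -[2%R]/(1 + 1 : R) EFinD ge0_muleDl// mul1e.
Qed.

(** [K^-1] is the probability constant of [tail_lower]. In the other direction the 2 passes from a
    two-sided to a one-sided tail of [Y]. *)
Let K : R := 2 * expR 10.

Let K1 : 1 <= K.
Proof. by rewrite /K; have := @expR_ge1Dx R 10; lra. Qed.

Let K0 : 0 < K. Proof. exact: lt_le_trans K1. Qed.

(** Put [v = u / 8]. For [v < 1] the tail of [Y] at [v] is at least [exp (- 1)]. If the endpoint is
    at most [v], then [|H| <= 2 * v - 1] almost surely. Otherwise the bound of [tail_upper] on [H]
    is at most [6 * v + 1], below [u]. *)
Let tail_H_le (c : bool) u : 0 < u ->
  (Q [set w | (u <= (-1) ^+ c * H w)%R] <=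
   K%:E * P [set w | (u <= (-1) ^+ c * (14 * Y w))%R])%E.
Proof.
move=> u0; pose v := u / 8; have v0 : 0 < v by rewrite divr_gt0.
have mH := measurable_expansion N Xi.
have mHc : measurable [set w | u <= (-1) ^+ c * H w].
  have mN : measurable_fun setT (fun w => (-1) ^+ c * H w) by exact: measurable_funM.
  have := mN measurableT `[u, +oo[%classic (measurable_itv _).
  by rewrite setTI set_itvcy.
have mHabs r : measurable [set w | r < `|H w|].
  have mN : measurable_fun setT (fun w => `|H w|) by exact: measurableT_comp.
  have := mN measurableT `]r, +oo[%classic (measurable_itv _).
  by rewrite setTI set_itvoy.
have HH r : r < u -> [set w | u <= (-1) ^+ c * H w] `<=` [set w | r < `|H w|].
  move=> ru w /= uH; apply: (lt_le_trans ru); apply: (le_trans uH).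
  by apply: le_trans (ler_norm _) _; rewrite normrM normrX normrN1 expr1n mul1r.
have PP : (P [set w | (v <= (-1) ^+ c * Y w)%R] <=
           P [set w | (u <= (-1) ^+ c * (14 * Y w))%R])%E.
  apply: le_measure; rewrite ?inE//.
    rewrite (_ : [set w | _] = [set w | u / 14 <= (-1) ^+ c * Y w])//.
    by apply/seteqP; split => w /=; rewrite ler_pdivrMr//; lra.
  by move=> w /=; rewrite /v; lra.
suff E : (Q [set w | (u <= (-1) ^+ c * H w)%R] <=
    (expR 10)%:E * P [set w | (v <= `|Y w|)%R])%E.
  apply: (le_trans E); rewrite /K mulrC EFinM -muleA.
  apply: lee_wpmul2l; first by rewrite lee_fin expR_ge0.
  apply: le_trans (half_tail c v0) _.
  by apply: lee_wpmul2l PP; rewrite lee_fin.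
have [v1|v1] := ltP v 1.
  apply: le_trans (probability_le1 _ mHc) _.
  have Nv := le1_of_lt1 N_nd qN1 (ltW v0) v1.
  have fv : N v \is a fin_num by rewrite ge0_fin_numE//; apply: le_lt_trans Nv (ltry _).
  rewrite tail_fin// -EFinM lee_fin -expRD -[leLHS]expR0 ler_expR.
  by move: Nv; rewrite -(fineK fv) lee_fin; lra.
have [bv|vb] := leP (endpoint N) v%:E.
  have tb := tail_bounded lawXi (fun m => slope_set_sum_endpoint N_ge0 N_cvx N_nd qN1 m v1 bv).
  apply: (@le_trans _ _ 0%E); last by rewrite mule_ge0// lee_fin expR_ge0.
  rewrite -tb; apply: le_measure; rewrite ?inE//.
  by apply: HH; rewrite /v; move: v1; rewrite /v; lra.
have [j0 [Nv lv]] := slope_level N_ge0 N_cvx N_nd N0 qN1 v1 vb.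
have fv := fin_num_lt_endpoint N_ge0 N_nd (ltW v0) vb.
have s0 : 0 <= sj j0 * v by rewrite mulr_ge0 ?(ltW v0)// exprn_ge0.
apply: le_trans (_ : _ <= (2 * expR (- (sj j0 * v)))%:E)%E _.
  apply: le_trans (tail_upper lawXi s0 lv); apply: le_measure; rewrite ?inE//.
  apply: HH; rewrite /sj exprS.
  have p2 : 2 ^+ j0 != 0 :> R by rewrite expf_neq0.
  have -> : 2 ^- j0 * (2 * (2 * 2 ^+ j0 * v) + 2) = 4 * v + 2 * 2 ^- j0 by field.
  have : 2 ^- j0 <= 1 :> R by rewrite invf_le1 ?exprn_gt0// exprn_ege1// ler1n.
  have : u = 8 * v by rewrite /v; field.
  lra.
rewrite tail_fin// -EFinM lee_fin -expRD.
apply: (@le_trans _ _ (expR 9 * expR (1 - fine (N v)))); last first.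
  by rewrite -expRD ler_expR; lra.
apply: ler_pM; rewrite ?expR_ge0//; first by have := @expR_ge1Dx R 9; lra.
by rewrite ler_expR; move: Nv; rewrite /=; lra.
Qed.

(** The dilation 14 fits two regimes. For [u <= 10] only [H >= 3 / 4] is used, and
    [14 * 3 / 4 > 10]. For larger [u], [tail_lower] at [u / 2] gives at least [u / 8 - 1 / 2], which
    exceeds [u / 14]. *)
Let tail_Y_le (c : bool) u : 0 < u ->
  (P [set w | (u <= (-1) ^+ c * Y w)%R] <=
   K%:E * Q [set w | (u <= (-1) ^+ c * (14 * H w))%R])%E.
Proof.
move=> u0; have mH := measurable_expansion N Xi.
have mHc r : measurable [set w | r <= (-1) ^+ c * H w].
  have mN : measurable_fun setT (fun w => (-1) ^+ c * H w) by exact: measurable_funM.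
  have := mN measurableT `[r, +oo[%classic (measurable_itv _).
  by rewrite setTI set_itvcy.
have QE : [set w | u <= (-1) ^+ c * (14 * H w)] = [set w | u / 14 <= (-1) ^+ c * H w].
  by apply/seteqP; split => w /=; rewrite ler_pdivrMr//; lra.
have KE : 2^-1 * expR (- 10) = K^-1 :> R by rewrite /K invfM expRN.
rewrite QE -lee_pdivrMl//.
have [uinf|ufin] := eqVneq (N u) +oo%E.
  apply: (@le_trans _ _ 0%E) => //.
  rewrite (_ : P _ = 0%E) ?mule0//; apply/eqP; rewrite eq_le measure_ge0 andbT.
  have <- : P [set w | u <= `|Y w|] = 0%E by rewrite tail_probE uinf.
  apply: le_measure; rewrite ?inE// => w /=; move/le_trans; apply.
  by apply: le_trans (ler_norm _) _; rewrite normrM normrX normrN1 expr1n mul1r.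
have [u10|u10] := leP u 10.
  apply: (@le_trans _ _ (K^-1)%:E).
    rewrite -[leRHS]mule1; apply: lee_wpmul2l; last exact: probability_le1.
    by rewrite lee_fin invr_ge0 ltW.
  have := tail_lower lawXi ind c 0 (x := fun=> 0) (fun=> lexx _) (fun=> measure_ge0 _ _).
  rewrite !big_ord0 oppr0 expR0 mulr1 KE expr0 divr1 => /le_trans; apply.
  apply: le_measure; rewrite ?inE// => w /=; lra.
(* Finiteness of [N u] gives only [u <= endpoint N]; halving moves strictly below the endpoint,
   where slopes exist. *)
pose v := u / 2; have v1 : 1 <= v by rewrite /v; lra.
have vb : (v%:E < endpoint N)%E.
  apply: (@lt_le_trans _ _ u%:E); first by rewrite lte_fin /v; lra.
  by apply: le_endpoint => //; [exact: ltW|rewrite ltey].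
have fv := fin_num_lt_endpoint N_ge0 N_nd (le_trans ler01 v1) vb.
have [x [m [x0 xl sx sNx]]] := slope_steps N_ge0 N_cvx N_nd N0 qN1 v1 vb.
apply: (@le_trans _ _ (K^-1%:E * P [set w | (v <= `|Y w|)%R])%E).
  apply: lee_wpmul2l; first by rewrite lee_fin invr_ge0 ltW.
  apply: le_measure; rewrite ?inE// => w /= uY.
  apply: (@le_trans _ _ u); first by rewrite /v; lra.
  apply: (le_trans uY).
  by apply: le_trans (ler_norm _) _; rewrite normrM normrX normrN1 expr1n mul1r.
rewrite tail_fin// -EFinM.
apply: le_trans (_ : _ <= (K^-1 * expR (- \sum_(j < m) 2 ^+ j * x j))%:E)%E _.
  by rewrite lee_fin ler_pM2l ?invr_gt0// ler_expR lerN2.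
rewrite -KE; apply: le_trans (tail_lower lawXi ind c m x0 xl) _.
apply: le_measure; rewrite ?inE// => w /=; rewrite sx; apply: le_trans.
have : 0 <= 4 / 2 ^+ m :> R by rewrite divr_ge0// exprn_ge0.
by rewrite /v; lra.
Qed.

Let HRV : {RV Q >-> R} :=
  HB.pack H (isMeasurableFun.Build _ _ _ _ H (measurable_expansion N Xi)).

Let intH : Q.-integrable setT (EFin \o H) := expansion_integrable lawXi.
Let meanH : (\int[Q]_w (H w)%:E = 0)%E := expansion_mean0 lawXi.

Let integrableM d0 (S : measurableType d0) (M : probability S R) (V : S -> R) (k : R) :
  M.-integrable setT (EFin \o V) -> M.-integrable setT (EFin \o (fun w => k * V w)).
Proof.
move=> iV; have -> : EFin \o (fun w => k * V w) = (fun w => k%:E * (V w)%:E)%E.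
  by apply/funext => w; rewrite /= EFinM.
exact: integrableZl.
Qed.

Let meanM d0 (S : measurableType d0) (M : probability S R) (V : S -> R) (k : R) :
  M.-integrable setT (EFin \o V) -> (\int[M]_w (V w)%:E = 0)%E ->
  (\int[M]_w (k * V w)%:E = 0)%E.
Proof.
move=> iV mV; under eq_integral do rewrite EFinM.
by rewrite integralZl// mV mule0.
Qed.

Let scaleRV d0 (S : measurableType d0) (M : probability S R) (k : R) (V : {RV M >-> R}) :
    {RV M >-> R} :=
  HB.pack (fun w => k * V w)
    (isMeasurableFun.Build _ _ _ _ (fun w => k * V w)
      (measurable_funM (measurable_cst k) (measurable_funPT V))).

(** Integrability is transferred from [H] by the tail comparison, applied to the positive parts of
    [Y] and of [- Y]. *)
Lemma coordinate_integrable : P.-integrable setT (EFin \o Y).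
Proof.
pose pos (x : R) := Num.max x 0.
have posmono : {homo pos : x y / x <= y}.
  by move=> x y xy; rewrite /pos ge_max !le_max xy lexx orbT.
have pos0 x : x <= 0 -> pos x = 0 by move=> ?; rewrite /pos max_r.
have mpos : measurable_fun setT pos by exact: nondecreasing_measurable.
have sgnE (V : R) (c : bool) : (-1) ^+ c * V = if c then - V else V.
  by case: c; rewrite ?mulN1r ?mul1r.
have fin (c : bool) : (\int[P]_w (pos ((-1) ^+ c * Y w))%:E < +oo)%E.
  apply: le_lt_trans (@monotone_integral_le _ _ _ P _ _ Q (scaleRV ((-1) ^+ c) Y)
    (scaleRV ((-1) ^+ c * 14) HRV) K (ltW K0) _ pos posmono pos0) _.
    by move=> u u0; have := tail_Y_le c u0; rewrite /=;
      under [X in (_ <= _ * Q X)%E -> _]eq_set do rewrite mulrA.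
  rewrite lte_mul_pinfty//; first by rewrite lee_fin ltW.
  have := integrable_abse (integrableM ((-1) ^+ c * 14) intH).
  move=> /(integrable_lty measurableT); apply: le_lt_trans.
  apply: ge0_le_integral => //.
  - by move=> w _; rewrite lee_fin /pos le_max lexx orbT.
  - apply/measurable_EFinP; apply: (measurableT_comp mpos).
    exact: (measurable_funPT (scaleRV ((-1) ^+ c * 14) HRV)).
  - apply: measurableT_comp => //; apply/measurable_EFinP.
    exact: (measurable_funPT (scaleRV ((-1) ^+ c * 14) HRV)).
  - by move=> w _; rewrite /= lee_fin /pos ge_max ler_norm normr_ge0.
apply/integrableP; split; first exact/measurable_EFinP.
rewrite (eq_integral (fun w => (pos ((-1) ^+ false * Y w))%:E + (pos ((-1) ^+ true * Y w))%:E)%E).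
  rewrite ge0_integralD//.
  - exact: lte_add_pinfty.
  - by move=> w _; rewrite lee_fin /pos le_max lexx orbT.
  - by apply/measurable_EFinP; apply: (measurableT_comp mpos); exact: measurable_funM.
  - by move=> w _; rewrite lee_fin /pos le_max lexx orbT.
  - by apply/measurable_EFinP; apply: (measurableT_comp mpos); exact: measurable_funM.
move=> w _; rewrite -EFinD !sgnE /pos/=; congr EFin.
have [Yw|] := boolP (0 <= Y w).
  by rewrite ger0_norm// max_l// max_r ?oppr_le0// addr0.
rewrite -ltNge => Yw; rewrite ltr0_norm// max_r ?(ltW Yw)// max_l ?add0r//.
by rewrite oppr_ge0 ltW.
Qed.

(** The constant is [14 * K]: the dilation between the tails times the factor that convexity turns
    into a second dilation. *)
Lemma coordinate_convex_le :
  convex_le P (fun w => (28 * expR 10)^-1 * Y w) Q H /\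
  convex_le Q H P (fun w => 28 * expR 10 * Y w).
Proof.
have iY := coordinate_integrable; have mY := symmetric_mean0 symY iY.
have CE : 28 * expR 10 = 14 * K by rewrite /K; ring.
have K_neq0 : K != 0 by rewrite gt_eqF.
have lower := @convex_le_of_tail _ _ _ P _ _ Q Y (scaleRV 14 HRV) K K1 iY
  (integrableM 14 intH) mY (meanM 14 intH meanH).
have upper := @convex_le_of_tail _ _ _ Q _ _ P HRV (scaleRV 14 Y) K K1 intH
  (integrableM 14 iY) meanH (meanM 14 iY mY).
have sgn0 (S : Type) (V : S -> R) u :
    [set w | u <= (-1) ^+ false * V w] = [set w | u <= V w].
  by under eq_set do rewrite mul1r.
have sgn1 (S : Type) (V : S -> R) u :
    [set w | u <= (-1) ^+ true * V w] = [set w | u <= - V w].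
  by under eq_set do rewrite mulN1r.
rewrite CE; split.
- have low : convex_le P (fun w => K^-1 * Y w) Q (fun w => 14 * H w).
    apply: lower => u u0.
    + by have := tail_Y_le false u0; rewrite (sgn0 _ Y) (sgn0 _ (fun w => 14 * H w)).
    + by have := tail_Y_le true u0; rewrite (sgn1 _ Y) (sgn1 _ (fun w => 14 * H w)).
  have := @convex_le_scale _ _ _ _ _ _ _ _ _ 14^-1 low.
  rewrite (_ : (fun w => 14^-1 * (K^-1 * Y w)) = (fun w => (14 * K)^-1 * Y w)); last first.
    by apply/funext => w; rewrite mulrA -invfM.
  by rewrite (_ : (fun w => 14^-1 * (14 * H w)) = H)//; apply/funext => w /=; field.
- have up : convex_le Q (fun w => K^-1 * H w) P (fun w => 14 * Y w).
    apply: upper => u u0.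
    + by have := tail_H_le false u0; rewrite (sgn0 _ H) (sgn0 _ (fun w => 14 * Y w)).
    + by have := tail_H_le true u0; rewrite (sgn1 _ H) (sgn1 _ (fun w => 14 * Y w)).
  have := @convex_le_scale _ _ _ _ _ _ _ _ _ K up.
  rewrite (_ : (fun w => K * (K^-1 * H w)) = H); last first.
    by apply/funext => w /=; rewrite mulVKf.
  rewrite (_ : (fun w => K * (14 * Y w)) = (fun w => 14 * K * Y w))//.
  by apply/funext => w /=; ring.
Qed.

End coordinate.

(** * Independence of the expansions *)

Section independence.
Context {R : realType} {d} {T : measurableType d} (Q : probability T R).

(** The classes are enlarged to their generated sigma-algebras one index at a time. With the other
    events fixed, both sides are finite measures in the event of index [k] that agree on the
    intersection-stable class [C k]. *)
Lemma independent_sigma n (C : 'I_n -> set (set T)) :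
  (forall i, setI_closed (C i)) -> (forall i, C i `<=` measurable) ->
  (forall i, C i setT) ->
  (forall A : 'I_n -> set T, (forall i, C i (A i)) ->
    Q (\bigcap_i A i) = (\prod_(i < n) Q (A i))%E) ->
  forall A : 'I_n -> set T, (forall i, <<s C i >> (A i)) ->
    Q (\bigcap_i A i) = (\prod_(i < n) Q (A i))%E.
Proof.
move=> CI Cm CT CQ.
have sm i A : <<s C i >> A -> measurable A.
  by apply: smallest_sub; [exact: sigma_algebra_measurable|exact: Cm].
suff H m : (m <= n)%N -> forall A : 'I_n -> set T,
    (forall i : 'I_n, if (i < m)%N then <<s C i >> (A i) else C i (A i)) ->
    Q (\bigcap_i A i) = (\prod_(i < n) Q (A i))%E.
  by move=> A sA; apply: (H n) => // i; rewrite ltn_ord.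
elim: m => [|m ih] mn A hA; first by apply: CQ => i; exact: hA.
pose k := Ordinal mn.
have mA i : measurable (A i).
  by move: (hA i); case: ifP => _; [exact: sm|exact: Cm].
pose A' S i := if i == k then S else A i.
pose E := \bigcap_(i in [set i | i != k]) A i.
have mE : measurable E.
  by apply: fin_bigcap_measurable => //; exact: finite_finset.
pose r : \bar R := (\prod_(i < n | i != k) Q (A i))%E.
have r0 : (0 <= r)%E by apply: prode_ge0.
have rfin : r \is a fin_num by apply: prode_fin_num => i _; exact: fin_num_measure.
have capE S : \bigcap_i A' S i = S `&` E.
  apply/seteqP; split => w.
    move=> h; split; first by have := h k I; rewrite /A' eqxx.
    by move=> i /= ik; have := h i I; rewrite /A' (negbTE ik).
  move=> [Sw Ew] i _; rewrite /A'; case: eqVneq => // ik.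
  exact: Ew.
have prodE S : (\prod_(i < n) Q (A' S i) = r * Q S)%E.
  rewrite (bigD1 k)//= {1}/A' eqxx muleC; congr (_ * _)%E.
  by apply: eq_bigr => i ik; rewrite /A' (negbTE ik).
have AE : A' (A k) = A.
  by apply/funext => i; rewrite /A'; case: eqVneq => // ->.
have r0' : 0 <= fine r by exact: fine_ge0.
rewrite -AE capE prodE.
have m1m2 S : C k S -> mrestr Q mE S = mscale (NngNum r0') Q S.
  move=> CS; rewrite /mrestr /mscale /= -capE fineK// -prodE.
  apply: ih; first exact: ltnW.
  move=> i; rewrite /A'; case: eqVneq => [->|ik]; first by rewrite ltnn.
  move: (hA i); rewrite ltnS leq_eqVlt.
  by rewrite (_ : (nat_of_ord i == m) = false)//; apply/negbTE.
have : mrestr Q mE (A k) = mscale (NngNum r0') Q (A k).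
  apply: (g_sigma_algebra_measure_unique (C k) (Cm k) (fun=> setT) (fun=> CT k)).
  - by rewrite bigcup_const//; exists 0%N.
  - exact: CI.
  - exact: m1m2.
  - by move=> _; rewrite /= /mrestr ltey_eq fin_num_measure// setTI.
  - by have := hA k; rewrite /= ltnSn.
by rewrite /mrestr /mscale /= fineK.
Qed.

End independence.

Section expansions_independent.
Context {R : realType} {d} {T : measurableType d} (Q : probability T R)
  {n : nat} (N : 'I_n -> R -> \bar R) (Xi : 'I_n -> option nat -> {RV Q >-> R}).
Context (ind : mutually_independent Q
  [set ik : 'I_n * option nat | active (N ik.1) ik.2]
  (fun ik => Xi ik.1 ik.2 : T -> R)).

Local Notation H := (fun i : 'I_n => slope_expansion (N i) (fun k => Xi i k : T -> R)).

Let block_prod i (s : seq (option nat)) (B : option nat -> set R) : uniq s ->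
  (forall k, k \in s -> active (N i) k) -> (forall k, measurable (B k)) ->
  Q (\bigcap_(k in [set` s]) (Xi i k @^-1` B k)) =
    (\prod_(k <- s) Q (Xi i k @^-1` B k))%E.
Proof.
move=> us sa mB.
have := independent_seq ind (s := [seq (i, k) | k <- s]) (B := fun ik => B ik.2).
rewrite big_map /= => <-.
- congr (Q _); apply/seteqP; split => w h.
    by move=> [i' k'] /= /mapP[k ks [-> ->]]; exact: h.
  by move=> k /= ks; apply: (h (i, k)); apply: map_f.
- by rewrite map_inj_uniq// => k k' [].
- by move=> _ /mapP[k ks ->]; exact: sa.
- by move=> ik; exact: mB.
Qed.

Lemma block_independent i :
  mutually_independent Q [set k | active (N i) k] (fun k => Xi i k : T -> R).
Proof.
move=> J B JD mB; apply: block_prod => //; exact: fset_uniq.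
Qed.

(** Cylinders over finitely many active variables of one coordinate form an intersection-stable
    class, and [H i] is measurable for the sigma-algebra it generates. *)
Lemma expansions_independent (D : 'I_n -> set R) : (forall i, measurable (D i)) ->
  Q (\bigcap_i (H i @^-1` D i)) = (\prod_(i < n) Q (H i @^-1` D i))%E.
Proof.
move=> mD.
pose cyl i (s : seq (option nat)) (B : option nat -> set R) :=
  \bigcap_(k in [set` s]) (Xi i k @^-1` B k).
pose ok i (s : seq (option nat)) (B : option nat -> set R) :=
  [/\ uniq s, forall k, k \in s -> active (N i) k & forall k, measurable (B k)].
pose C i := [set A | exists s, exists2 B, ok i s B & A = cyl i s B].
apply: (@independent_sigma _ _ _ Q n C).
- move=> i _ _ [s [B [us sa mB] ->]] [s' [B' [us' sa' mB'] ->]].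
  (* The two index lists are merged; an index missing from one of them carries [setT] there. *)
  exists (undup (s ++ s')), (fun k => (if k \in s then B k else setT) `&`
                                      (if k \in s' then B' k else setT)).
    split; first exact: undup_uniq.
      by move=> k; rewrite mem_undup mem_cat => /orP[/sa|/sa'].
    by move=> k; apply: measurableI; case: ifP.
  apply/seteqP; split => w.
    move=> [h h'] k /= _; split; case: ifP => // ks; [exact: h|exact: h'].
  move=> h; split => k /= ks.
    by have := h k; rewrite /= mem_undup mem_cat ks => /(_ isT)[].
  by have := h k; rewrite /= mem_undup mem_cat ks orbT => /(_ isT)[].
- move=> i _ [s [B [us sa mB] ->]].
  apply: fin_bigcap_measurable => // k _; exact: measurable_funPTI.
- move=> i; exists [::], (fun=> setT); first by split.
  by rewrite /cyl set_nil bigcap_set0.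
- move=> A hA.
  have /choice[s hs] := hA.
  have /choice[B hB] : forall i, exists B, ok i (s i) B /\ A i = cyl i (s i) B.
    by move=> i; have [B okB AE] := hs i; exists B.
  pose ps := [seq (i, k) | i <- enum 'I_n, k <- s i].
  have := independent_seq ind (s := ps) (B := fun ik => B ik.1 ik.2).
  rewrite (_ : \bigcap_(ik in [set` ps]) _ = \bigcap_i A i); last first.
    apply/seteqP; split => w h.
      move=> i _; rewrite (hB i).2 => k /= ks; apply: (h (i, k)) => /=.
      by apply/allpairsPdep; exists i, k; rewrite mem_enum.
    move=> [i k] /= /allpairsPdep[i' [k' [_ ks [-> ->]]]].
    by have := h i' I; rewrite (hB i').2; exact.
  move=> ->.
  + rewrite big_allpairs_dep big_enum; apply: eq_bigr => i _.
    rewrite (hB i).2; have [[us sa mB] _] := hB i.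
    by rewrite /cyl block_prod.
  + apply: allpairs_uniq_dep; first exact: enum_uniq.
      by move=> i _; have [[]] := hB i.
    by move=> [i k] [i' k'] _ _ /= [-> ->].
  + move=> _ /allpairsPdep[i [k [_ ks ->]]] /=.
    by have [[_ sa _] _] := hB i; exact: sa.
  + by move=> [i k]; have [[_ _ mB] _] := hB i; exact: mB.
- move=> i.
  have mXi k : active (N i) k ->
      @measurable_fun _ _ (g_sigma_algebraType (C i)) _ setT (Xi i k : T -> R).
    move=> act _ B mB; rewrite setTI; apply: sub_sigma_algebra.
    exists [:: k], (fun=> B); first by split => // k'; rewrite inE => /eqP ->.
    rewrite /cyl; apply/seteqP; split => w.
      by move=> h k' /=; rewrite inE => /eqP ->.
    by move=> /(_ k); apply; rewrite /= inE.
  have := @measurable_slope_expansion R _ (g_sigma_algebraType (C i)) (N i)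
    (fun k => Xi i k) mXi measurableT _ (mD i).
  by rewrite setTI.
Qed.

End expansions_independent.

(** * Tensorization of convex order *)

Section joint_law.
Context {R : realType} {d1 d2 d3} {S : measurableType d1} (P : probability S R)
  {E1 : measurableType d2} {E2 : measurableType d3}
  (V : {RV P >-> E1}) (W : {RV P >-> E2}).
Context (indVW : forall A B, measurable A -> measurable B ->
  P (V @^-1` A `&` W @^-1` B) = (P (V @^-1` A) * P (W @^-1` B))%E).

(** Independence makes the joint law the product of the marginals, so Fubini applies. *)
Lemma integral_joint_law (h : E1 * E2 -> \bar R) : measurable_fun setT h ->
  P.-integrable setT (fun w => h (V w, W w)) ->
  (distribution P V).-integrable setT
    (fun v => \int[distribution P W]_r h (v, r))%E /\
  (\int[P]_w h (V w, W w) =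
   \int[distribution P V]_v \int[distribution P W]_r h (v, r))%E.
Proof.
move=> mh ih.
have mVW : measurable_fun setT (fun w => (V w, W w)) by exact: measurable_fun_pair.
pose VW : {RV P >-> (E1 * E2)%type} :=
  HB.pack (fun w => (V w, W w)) (isMeasurableFun.Build _ _ _ _ (fun w => (V w, W w)) mVW).
have lawE A : measurable A ->
    (distribution P V \x distribution P W)%E A = distribution P VW A.
  apply: product_measure_unique => {}A B mA mB.
  by rewrite /distribution/pushforward/= -indVW.
have ih' : (distribution P V \x distribution P W)%E.-integrable setT h.
  apply/integrableP; split => //.
  rewrite (@eq_measure_integral _ _ _ _ (distribution P VW)); last first.
    by move=> A mA _; exact: lawE.
  rewrite ge0_integral_distribution//; last exact: measurableT_comp.
  by have /integrableP[] := ih.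
have /= := @integral_distribution _ _ _ _ _ P VW h mh ih.
rewrite -(@eq_measure_integral _ _ _ _ (distribution P VW)
  (distribution P V \x distribution P W)%E); last first.
  by move=> A mA _; exact: lawE.
rewrite -(integral12_prod_meas1 ih') => <-; split => //.
exact: (integrable_fubini_F ih').
Qed.

End joint_law.

(** * Tuples, boxes and independence *)

Section tuples.
Context {R : realType} {n : nat}.

Definition upd (v : n.-tuple R) (k : 'I_n) (r : R) : n.-tuple R :=
  [tuple if i == k then r else tnth v i | i < n].

Lemma measurable_mktuple {d} {T : measurableType d} (f : 'I_n -> T -> R) :
  (forall i, measurable_fun setT (f i)) ->
  measurable_fun setT (fun w => [tuple f i w | i < n]).
Proof.
move=> mf; apply/measurable_fun_tnthP => i.
by rewrite (_ : _ \o _ = f i)//; apply/funext => w /=; rewrite tnth_mktuple.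
Qed.

Lemma measurable_upd k : measurable_fun setT (fun z : n.-tuple R * R => upd z.1 k z.2).
Proof.
apply/measurable_fun_tnthP => i.
have [->|ik] := eqVneq i k.
  rewrite (_ : _ \o _ = snd); first exact: measurable_snd.
  by apply/funext => z /=; rewrite tnth_mktuple eqxx.
rewrite (_ : _ \o _ = (fun v : n.-tuple R => tnth v i) \o fst).
  by apply: measurableT_comp; [exact: measurable_tnth|exact: measurable_fst].
by apply/funext => z /=; rewrite tnth_mktuple (negbTE ik).
Qed.

Definition box (D : 'I_n -> set R) : set (n.-tuple R) :=
  [set v | forall i, D i (tnth v i)].

Lemma boxE D : box D = \bigcap_i ((fun v => tnth v i) @^-1` D i).
Proof. by apply/seteqP; split => v h i => [_|]; exact: h. Qed.

Lemma measurable_box D : (forall i, measurable (D i)) -> measurable (box D).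
Proof.
move=> mD; rewrite boxE; apply: fin_bigcap_measurable; first exact: finite_finset.
move=> i _; rewrite -[_ @^-1` _]setTI; exact: measurable_tnth.
Qed.

Lemma measurable_boxes : (measurable : set (set (n.-tuple R))) =
  <<s [set box D | D in [set D | forall i, measurable (D i)]] >>.
Proof.
apply/seteqP; split; last first.
  apply: smallest_sub; first exact: sigma_algebra_measurable.
  by move=> _ [D mD <-]; exact: measurable_box.
apply: smallest_sub; first exact: smallest_sigma_algebra.
move=> B; rewrite -bigcup_seq => -[i _ [D mD <-]]; apply: sub_sigma_algebra.
exists (fun j => if j == i then D else setT); first by move=> j /=; case: ifP.
apply/seteqP; split => v /=.
  by move=> h; split => //; have := h i; rewrite eqxx.
by move=> [_ Dv] j; case: eqVneq => [->|].
Qed.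

End tuples.

(** The full index set is enough: taking [setT] for some indices recovers every subfamily. *)
Definition box_independent {R : realType} {d} {T : measurableType d}
    (P : probability T R) {n} (Z : 'I_n -> T -> R) :=
  forall D : 'I_n -> set R, (forall i, measurable (D i)) ->
    P (\bigcap_i (Z i @^-1` D i)) = (\prod_(i < n) P (Z i @^-1` D i))%E.

Section one_coordinate.
Context {R : realType} {d} {T : measurableType d} (P : probability T R) {n : nat}
  (Z : 'I_n -> {RV P >-> R}) (k : 'I_n).
Context (indZ : box_independent P (fun i => Z i : T -> R)).

(** The entry [k] is zeroed rather than removed, so that the others still form an [n]-tuple and
    [upd] restores the full one. *)
Definition rest (w : T) : n.-tuple R := [tuple if i == k then 0 else Z i w | i < n].

Lemma measurable_rest : measurable_fun setT rest.
Proof.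
apply: (measurable_mktuple (f := fun i w => if i == k then 0 else Z i w)) => i.
by case: (i == k).
Qed.

Definition restRV : {RV P >-> (n.-tuple R)} :=
  HB.pack rest (isMeasurableFun.Build _ _ _ _ rest measurable_rest).

Lemma upd_rest w : upd (rest w) k (Z k w) = [tuple Z i w | i < n].
Proof.
apply: eq_from_tnth => i; rewrite !tnth_mktuple.
by case: eqVneq => [->|].
Qed.

Lemma rest_independent A B : measurable A -> measurable B ->
  P (restRV @^-1` A `&` Z k @^-1` B) = (P (restRV @^-1` A) * P (Z k @^-1` B))%E.
Proof.
move=> mA mB.
have mZB : measurable (Z k @^-1` B) by exact: measurable_funPTI.
have r0 : 0 <= fine (P (Z k @^-1` B)) by exact: fine_ge0.
pose m1 := pushforward (mrestr P mZB) restRV.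
pose m2 := mscale (NngNum r0) (distribution P restRV).
suff : m1 A = m2 A.
  by rewrite /m1 /m2 /pushforward /mrestr /mscale /= fineK ?fin_num_measure// muleC.
apply: (measure_unique _ (fun=> setT) measurable_boxes) => //.
- move=> _ _ [D mD <-] [D' mD' <-]; exists (fun i => D i `&` D' i).
    by move=> i /=; apply: measurableI.
  apply/seteqP; split => v /=; first by move=> h; split => i; have [] := h i.
  by move=> [h h'] i; split.
- by move=> _; exists (fun=> setT) => //; apply/seteqP; split.
- by rewrite bigcup_const//; exists 0%N.
- move=> _ [D mD <-].
  change (P (restRV @^-1` box D `&` Z k @^-1` B) =
    (fine (P (Z k @^-1` B)))%:E * P (restRV @^-1` box D))%E.
  rewrite fineK ?fin_num_measure// muleC.
  (* The entry [k] of [rest] is constantly 0, so [D k] either imposes nothing or empties the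
     event. *)
  have [Dk|nDk] := pselect (D k 0); last first.
    have -> : restRV @^-1` box D = set0.
      apply/seteqP; split => w //= /(_ k); rewrite tnth_mktuple eqxx.
      by move/nDk.
    by rewrite set0I measure0 mul0e.
  pose D' i := if i == k then setT else D i.
  pose D'' i := if i == k then B else D i.
  have mD' i : measurable (D' i) by rewrite /D'; case: ifP.
  have mD'' i : measurable (D'' i) by rewrite /D''; case: ifP.
  have -> : restRV @^-1` box D = \bigcap_i (Z i @^-1` D' i).
    apply/seteqP; split => w /=.
      move=> h i _; have := h i; rewrite tnth_mktuple /D' /=.
      by case: eqVneq.
    move=> h i; rewrite tnth_mktuple; have := h i I; rewrite /D' /=.
    by case: eqVneq => // ->.
  have -> : \bigcap_i (Z i @^-1` D' i) `&` Z k @^-1` B = \bigcap_i (Z i @^-1` D'' i).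
    apply/seteqP; split => w.
      move=> [h Bw] i _; have := h i I; rewrite /D' /D'' /=.
      by case: eqVneq => // ->.
    move=> h; split; last by have := h k I; rewrite /D'' /= eqxx.
    move=> i _; have := h i I; rewrite /D' /D'' /=.
    by case: eqVneq.
  rewrite !indZ// (bigD1 k)//= [X in _ = (X * _)%E](bigD1 k)//= {1}/D'' {1}/D' !eqxx.
  rewrite preimage_setT probability_setT mul1e muleC; congr (_ * _)%E.
  by apply: eq_bigr => i ik; rewrite /D' /D'' (negbTE ik).
- by move=> _; rewrite /m1 /= /pushforward /mrestr ltey_eq fin_num_measure// preimage_setT setTI.
Qed.

End one_coordinate.

Lemma eq_measure_integrable {R : realType} {d} {T : measurableType d}
    (m1 m2 : {measure set T -> \bar R}) (f : T -> \bar R) :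
  (forall A, measurable A -> m1 A = m2 A) ->
  m1.-integrable setT f -> m2.-integrable setT f.
Proof.
move=> m12 /integrableP[mf f1]; apply/integrableP; split => //.
suff <- : (\int[m1]_x `|f x| = \int[m2]_x `|f x|)%E by [].
by apply: eq_measure_integral => A mA _; exact: m12.
Qed.

Section same_law.
Context {R : realType} {d1 d2} {S1 : measurableType d1} {S2 : measurableType d2}
  (P1 : probability S1 R) (P2 : probability S2 R)
  (X1 : {RV P1 >-> R}) (X2 : {RV P2 >-> R}).
Context (law : forall D, measurable D -> P1 (X1 @^-1` D) = P2 (X2 @^-1` D)).

Let dist_law D : measurable D -> distribution P1 X1 D = distribution P2 X2 D.
Proof. exact: law. Qed.

Lemma same_law_integrable (g : R -> \bar R) : measurable_fun setT g ->
  P1.-integrable setT (g \o X1) -> P2.-integrable setT (g \o X2).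
Proof.
move=> mg /integrableP[_ i1]; apply/integrableP; split; first exact: measurableT_comp.
have ma : measurable_fun setT (fun x => `|g x|)%E by exact: measurableT_comp.
have := @ge0_integral_distribution _ _ _ _ _ P2 X2 _ ma (fun _ => abse_ge0 _).
rewrite /= => <-; rewrite -(@eq_measure_integral _ _ _ _ _ (distribution P1 X1)); last first.
  by move=> D mD _; exact: dist_law.
by have := @ge0_integral_distribution _ _ _ _ _ P1 X1 _ ma (fun _ => abse_ge0 _); rewrite /= => ->.
Qed.

Lemma same_law_integral (g : R -> \bar R) : measurable_fun setT g ->
  P2.-integrable setT (g \o X2) ->
  (\int[distribution P1 X1]_r g r = \int[P2]_w g (X2 w))%E.
Proof.
move=> mg i2; rewrite -(integral_distribution mg i2).
by apply: eq_measure_integral => D mD _; exact: dist_law.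
Qed.

End same_law.

(** * Exchanging coordinates one at a time *)

Section tensorization.
Context {R : realType} {d} {T : measurableType d} (P : probability T R)
  {d'} {T' : measurableType d'} (Q : probability T' R) {n : nat}
  (A : 'I_n -> {RV P >-> R}) (B : 'I_n -> {RV Q >-> R}).
Context (indA : box_independent P (fun i => A i : T -> R))
  (indB : box_independent Q (fun i => B i : T' -> R)).
Context (iA : forall i, P.-integrable setT (EFin \o A i))
  (iB : forall i, Q.-integrable setT (EFin \o B i)).
Context (cxAB : forall i, convex_le P (A i) Q (B i)).
Context (M : n.-tuple R -> R) (c : R) (mM : measurable_fun setT M)
  (cvxM : forall k v, convex_function [set: R^o] (fun r : R^o => M (upd v k r) : R^o))
  (growM : forall a, `|M a| <= c + c * \sum_(i < n) `|tnth a i|).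

Let S : probability (T * T')%type R := (P \x Q)%E.

Let prodE X Y : measurable X -> measurable Y -> S (X `*` Y) = (P X * Q Y)%E.
Proof. exact: product_measure1E. Qed.

(** Coordinates below [m] come from [A], the others from [B]; the product space makes the two
    families independent of each other. *)
Let hyb (m : nat) (i : 'I_n) (w : T * T') : R := if (i < m)%N then A i w.1 else B i w.2.

Let mhyb m i : measurable_fun setT (hyb m i).
Proof.
rewrite /hyb; case: (i < m)%N.
  by apply: (measurableT_comp (measurable_funPT (A i))); exact: measurable_fst.
by apply: (measurableT_comp (measurable_funPT (B i))); exact: measurable_snd.
Qed.

Let Z m i : {RV S >-> R} :=
  HB.pack (hyb m i) (isMeasurableFun.Build _ _ _ _ (hyb m i) (mhyb m i)).

Let lawZ m i D : measurable D ->
  S (Z m i @^-1` D) = if (i < m)%N then P (A i @^-1` D) else Q (B i @^-1` D).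
Proof.
move=> mD; rewrite /= /hyb; case: ifP => _.
  rewrite (_ : _ @^-1` _ = (A i @^-1` D) `*` setT); last first.
    by apply/seteqP; split => w //= [].
  rewrite prodE//; last exact: measurable_funPTI.
  by rewrite -[RHS]mule1; congr (_ * _)%E; exact: probability_setT.
rewrite (_ : _ @^-1` _ = setT `*` (B i @^-1` D)); last first.
  by apply/seteqP; split => w //= [].
rewrite prodE//; last exact: measurable_funPTI.
by rewrite -[RHS]mul1e; congr (_ * _)%E; exact: probability_setT.
Qed.

Let indZ m : box_independent S (fun i => Z m i : T * T' -> R).
Proof.
move=> D mD.
pose DA (i : 'I_n) := if (i < m)%N then D i else setT.
pose DB (i : 'I_n) := if (i < m)%N then setT else D i.
have mDA i : measurable (DA i) by rewrite /DA; case: ifP.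
have mDB i : measurable (DB i) by rewrite /DB; case: ifP.
have -> : \bigcap_i (Z m i @^-1` D i) =
    (\bigcap_i (A i @^-1` DA i)) `*` (\bigcap_i (B i @^-1` DB i)).
  apply/seteqP; split => w.
    move=> h; split => i _; have := h i I; rewrite /= /hyb /DA /DB /=; by case: ifP.
  move=> [hA hB] i _; have := hA i I; have := hB i I.
  by rewrite /= /hyb /DA /DB /=; case: ifP.
have mcap d0 (T0 : measurableType d0) (P0 : probability T0 R) (F : 'I_n -> {RV P0 >-> R})
    (E : 'I_n -> set R) : (forall i, measurable (E i)) -> measurable (\bigcap_i (F i @^-1` E i)).
  move=> mE; apply: fin_bigcap_measurable; first exact: finite_finset.
  by move=> i _; exact: measurable_funPTI.
rewrite prodE; [|exact: mcap|exact: mcap].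
rewrite indA// indB// -big_split/=; apply: eq_bigr => i _.
rewrite lawZ// /DA /DB; case: ifP => _; rewrite preimage_setT.
  by rewrite -[RHS]mule1; congr (_ * _)%E; exact: probability_setT.
by rewrite -[RHS]mul1e; congr (_ * _)%E; exact: probability_setT.
Qed.

Let iZ m i : S.-integrable setT (EFin \o Z m i).
Proof.
have mE : measurable_fun [set: R] (@EFin R) by exact/measurable_EFinP.
case im : (i < m)%N.
  apply: (@same_law_integrable _ _ _ _ _ P S (A i) (Z m i)) => //.
  by move=> D mD; rewrite lawZ// im.
apply: (@same_law_integrable _ _ _ _ _ Q S (B i) (Z m i)) => //.
by move=> D mD; rewrite lawZ// im.
Qed.

Let iM d0 (T0 : measurableType d0) (P0 : probability T0 R) (F : 'I_n -> {RV P0 >-> R}) :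
  (forall i, P0.-integrable setT (EFin \o F i)) ->
  P0.-integrable setT (fun w => (M [tuple F i w | i < n])%:E).
Proof.
move=> iF.
have mF : measurable_fun setT (fun w => [tuple F i w | i < n]).
  by apply: (measurable_mktuple (f := fun i => F i : T0 -> R)).
apply: (@le_integrable _ _ _ _ _ measurableT _
  (fun w => c%:E + c%:E * \sum_(i < n) `|(F i w)%:E|)%E).
- by apply/measurable_EFinP; exact: measurableT_comp mF.
- move=> w _; rewrite sumEFin -EFinM -EFinD lee_fin; apply: le_trans (growM _) _.
  under eq_bigr do rewrite tnth_mktuple.
  exact: ler_norm.
- apply: integrableD => //; first exact: finite_measure_integrable_cst.
  apply: integrableZl => //; apply: integrable_sum => //.
  by move=> i _; exact: integrable_abse (iF i).
Qed.

Let section_integrable d0 (T0 : measurableType d0) (P0 : probability T0 R)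
  (F : {RV P0 >-> R}) k v : P0.-integrable setT (EFin \o F) ->
  measurable_fun setT (fun r : R => M (upd v k r)) /\
  P0.-integrable setT (fun w => (M (upd v k (F w)))%:E).
Proof.
move=> iF.
have mf : measurable_fun setT (fun r : R => M (upd v k r)).
  apply: (measurableT_comp mM).
  apply: (measurableT_comp (measurable_upd k) (pair1_measurable v)).
split=> //.
pose s := \sum_(i < n) `|tnth v i|.
have c0 : 0 <= c.
  have := growM [tuple 0 | i < n]; under eq_bigr do rewrite tnth_mktuple normr0.
  by rewrite big1// mulr0 addr0; apply: le_trans.
apply: (@le_integrable _ _ _ _ _ measurableT _ (fun w => (c + c * s)%:E + c%:E * `|(F w)%:E|)%E).
- by apply/measurable_EFinP; exact: (measurableT_comp mf).
- move=> w _; rewrite -EFinM -EFinD lee_fin; apply: le_trans (growM _) _.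
  apply: le_trans (ler_norm _); rewrite -addrA lerD2l -mulrDr ler_wpM2l//.
  rewrite (bigD1 k)//= tnth_mktuple eqxx addrC lerD2r.
  rewrite /s [leRHS](bigD1 k)//=; apply: le_trans (_ : _ <= \sum_(i < n | i != k) `|tnth v i|) _.
    by apply: ler_sum => i ik; rewrite tnth_mktuple (negbTE ik).
  by rewrite lerDr.
- apply: integrableD => //; first exact: finite_measure_integrable_cst.
  by apply: integrableZl => //; exact: integrable_abse.
Qed.

(** The hybrids [k] and [k.+1] share all coordinates but [k]. Fixing these leaves a convex function
    of one variable, to which the order between [A k] and [B k] applies; linear growth makes the
    expectations finite. *)
Let step (k : 'I_n) :
  (\int[S]_w (M [tuple Z k.+1 i w | i < n])%:E <= \int[S]_w (M [tuple Z k i w | i < n])%:E)%E.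
Proof.
have rE : rest (Z k.+1) k = rest (Z k) k.
  apply/funext => w; apply: eq_from_tnth => i; rewrite !tnth_mktuple.
  case: (eqVneq i k) => // ik; rewrite /= /hyb ltnS leq_eqVlt.
  by rewrite (_ : (nat_of_ord i == nat_of_ord k) = false)//; apply/negbTE.
pose h (z : n.-tuple R * R) : \bar R := (M (upd z.1 k z.2))%:E.
have mh : measurable_fun setT h.
  by apply/measurable_EFinP; exact: (measurableT_comp mM (measurable_upd k)).
have joint m : (distribution S (restRV (Z m) k)).-integrable setT
      (fun v => \int[distribution S (Z m k)]_r h (v, r))%E /\
    (\int[S]_w (M [tuple Z m i w | i < n])%:E =
     \int[distribution S (restRV (Z m) k)]_v \int[distribution S (Z m k)]_r h (v, r))%E.
  have [|i1 i2] := @integral_joint_law _ _ _ _ _ S _ _ (restRV (Z m) k) (Z m k)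
    (@rest_independent _ _ _ _ _ (Z m) k (indZ m)) h mh.
    have := iM (iZ m); apply: eq_integrable => // w _.
    by rewrite /h /= (upd_rest (Z m) k w).
  split => //; rewrite -i2; apply: eq_integral => w _.
  by rewrite /h /= (upd_rest (Z m) k w).
have [i1 ->] := joint k.+1; have [i0 ->] := joint k.
have dE D : distribution S (restRV (Z k.+1) k) D = distribution S (restRV (Z k) k) D.
  by rewrite /distribution /pushforward /= rE.
rewrite (@eq_measure_integral _ _ _ _ (distribution S (restRV (Z k) k))); last first.
  by move=> D mD _; exact: dE.
have i1' : (distribution S (restRV (Z k) k)).-integrable setT
    (fun v => \int[distribution S (Z k.+1 k)]_r h (v, r))%E.
  by apply: eq_measure_integrable i1 => D _; exact: dE.
apply: (le_integral measurableT i1' i0) => v _.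
have [mf fA] := section_integrable k v (iA k).
have [_ fB] := section_integrable k v (iB k).
have mfE : measurable_fun setT (fun r => h (v, r)) by exact/measurable_EFinP.
rewrite (@same_law_integral _ _ _ _ _ S P (Z k.+1 k) (A k) _ _ mfE fA); last first.
  by move=> D mD; rewrite lawZ// ltnSn.
rewrite (@same_law_integral _ _ _ _ _ S Q (Z k k) (B k) _ _ mfE fB); last first.
  by move=> D mD; rewrite lawZ// ltnn.
have fin d0 (T0 : measurableType d0) (P0 : probability T0 R) (F : T0 -> R) :
    P0.-integrable setT (EFin \o F) -> ('E_P0[F^\-] < +oo)%E.
  move=> iF; rewrite unlock; apply: integrable_lty => //.
  exact: integrable_funrneg.
have := cxAB (i := k) (cvxM k v) (fin _ _ _ _ fA) (fin _ _ _ _ fB).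
by rewrite !unlock.
Qed.

Theorem tensor_convex_le :
  (\int[P]_w (M [tuple A i w | i < n])%:E <= \int[Q]_w (M [tuple B i w | i < n])%:E)%E.
Proof.
have down m : (m <= n)%N ->
    (\int[S]_w (M [tuple Z m i w | i < n])%:E <= \int[S]_w (M [tuple Z 0 i w | i < n])%:E)%E.
  elim: m => [|m ih] mn; first exact: lexx.
  exact: le_trans (step (Ordinal mn)) (ih (ltnW mn)).
have := down n (leqnn n).
have -> : (\int[S]_w (M [tuple Z n i w | i < n])%:E = \int[P]_w (M [tuple A i w | i < n])%:E)%E.
  have iZn := iM (iZ n).
  rewrite -(integral12_prod_meas1 iZn); apply: eq_integral => w _.
  rewrite /fubini_F /= (eq_integral (cst (M [tuple A i w | i < n])%:E)); last first.
    move=> w' _; congr ((M _)%:E); apply: eq_from_tnth => i; rewrite !tnth_mktuple.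
    by rewrite /hyb ltn_ord.
  rewrite integral_cst// -[RHS]mule1; congr (_ * _)%E; exact: probability_setT.
have -> : (\int[S]_w (M [tuple Z 0 i w | i < n])%:E = \int[Q]_w (M [tuple B i w | i < n])%:E)%E.
  have iZn := iM (iZ 0%N).
  rewrite -(integral12_prod_meas1 iZn).
  rewrite (eq_integral (cst (\int[Q]_w (M [tuple B i w | i < n])%:E)%E)); last first.
    move=> w _; rewrite /fubini_F /=; apply: eq_integral => w' _.
    by congr ((M _)%:E); apply: eq_from_tnth => i; rewrite !tnth_mktuple.
  rewrite integral_cst// -[RHS]mule1; congr (_ * _)%E; exact: probability_setT.
by [].
Qed.

End tensorization.

(** * Soft-max couplings *)

Section integrable_real.
Context {R : realType} {d} {T : measurableType d} (Q : probability T R).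
Local Notation int f := (Q.-integrable setT (EFin \o f)).

Lemma integrableR_cst (r : R) : int (fun=> r).
Proof. exact: finite_measure_integrable_cst. Qed.

Lemma integrableRD (f g : T -> R) : int f -> int g -> int (fun w => f w + g w).
Proof.
move=> fi gi; have := integrableD measurableT fi gi.
by apply: eq_integrable => // w _; rewrite /= EFinD.
Qed.

Lemma integrableRB (f g : T -> R) : int f -> int g -> int (fun w => f w - g w).
Proof.
move=> fi gi; have := integrableB measurableT fi gi.
by apply: eq_integrable => // w _; rewrite /= EFinB.
Qed.

Lemma integrableRZ (r : R) (f : T -> R) : int f -> int (fun w => r * f w).
Proof.
move=> fi; have := integrableZl measurableT r fi.
by apply: eq_integrable => // w _; rewrite /= EFinM.
Qed.

Lemma integrableR_norm (f : T -> R) : int f -> int (fun w => `|f w|).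
Proof. by move=> fi; have := integrable_abse fi; apply: eq_integrable. Qed.

Lemma RintegralT_cst (r : R) : \int[Q]_w r = r.
Proof.
rewrite Rintegral_cst// (_ : fine _ = 1) ?mulr1//.
have h : Q setT = 1%E by exact: probability_setT.
exact: (congr1 fine h).
Qed.

Lemma RintegralT_sum (I : Type) (r : seq I) (f : I -> T -> R) : (forall i, int (f i)) ->
  int (fun w => \sum_(i <- r) f i w) /\
  \int[Q]_w (\sum_(i <- r) f i w) = \sum_(i <- r) \int[Q]_w f i w.
Proof.
move=> fi; elim: r => [|i r [ih1 ih2]].
  rewrite big_nil; split.
    by apply: eq_integrable (integrableR_cst 0) => // w _; rewrite /= big_nil.
  by under eq_Rintegral do rewrite big_nil; rewrite RintegralT_cst.
rewrite big_cons -ih2 -RintegralD//; split.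
  by have := integrableRD (fi i) ih1; apply: eq_integrable => // w _; rewrite /= big_cons.
by apply: eq_Rintegral => w _; rewrite big_cons.
Qed.

End integrable_real.

(** * Log-sum-exp and its gradient *)

Section softmax.
Context {R : realType} {m : nat}.
Implicit Types u v : 'I_m.+1 -> R.

Definition lse u : R := ln (\sum_k expR (u k)).

Definition softmax u k : R := expR (u k - lse u).

Let sum_gt0 u : 0 < \sum_k expR (u k).
Proof.
rewrite (bigD1 ord0)//= ltr_pwDl ?expR_gt0// sumr_ge0//.
Qed.

Lemma expR_lse u : expR (lse u) = \sum_k expR (u k).
Proof. by rewrite /lse lnK// posrE. Qed.

Lemma softmax_ge0 u k : 0 <= softmax u k.
Proof. exact: expR_ge0. Qed.

Lemma softmax_sum u : \sum_k softmax u k = 1.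
Proof.
rewrite /softmax; under eq_bigr do rewrite expRD.
by rewrite -mulr_suml -expR_lse -expRD subrr expR0.
Qed.

Lemma softmax_le1 u k : softmax u k <= 1.
Proof.
rewrite -(softmax_sum u) (bigD1 k)//= lerDl sumr_ge0// => i _.
exact: softmax_ge0.
Qed.

Lemma lse_ge u k : u k <= lse u.
Proof. by have := softmax_le1 u k; rewrite -[leRHS]expR0 ler_expR subr_le0. Qed.

(* t e^t >= -1, applied to t = u k - lse u. *)
Lemma lse_le u : lse u <= \sum_k softmax u k * u k + m.+1%:R.
Proof.
have h k : softmax u k * lse u <= softmax u k * u k + 1.
  pose t := u k - lse u.
  have : 0 < expR t by exact: expR_gt0.
  have e1 : expR t * expR (- t) = 1 by rewrite -expRD subrr expR0.
  have : 1 - t <= expR (- t) by exact: expR_ge1Dx.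
  move=> h1 h2; have : expR t * (1 - t) <= 1 by rewrite -[leRHS]e1 ler_pM2l.
  rewrite /softmax -/t (_ : lse u = u k - t); last by rewrite /t; ring.
  lra.
have := ler_sum (index_enum 'I_m.+1) (P := xpredT) (fun k _ => h k).
by rewrite -mulr_suml softmax_sum mul1r big_split/= sumr_const card_ord.
Qed.

(** The soft-max is the gradient of [lse], and this is the supporting-plane inequality. It follows
    from [exp y >= 1 + y] taken around the mean increment [t], where the linear terms cancel. *)
Lemma lse_gradient u v : lse u + \sum_k softmax u k * (v k - u k) <= lse v.
Proof.
pose t := \sum_k softmax u k * (v k - u k).
rewrite -ler_expR expRD !expR_lse -/t.
have E k : expR (v k) = expR (lse u) * (softmax u k * expR (v k - u k)).
  by rewrite /softmax -!expRD; congr expR; ring.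
under [leRHS]eq_bigr do rewrite E.
rewrite -mulr_sumr -expR_lse ler_pM2l ?expR_gt0//.
have h k : softmax u k * (expR t * (1 + (v k - u k - t))) <= softmax u k * expR (v k - u k).
  rewrite ler_wpM2l ?softmax_ge0//.
  have -> : v k - u k = t + (v k - u k - t) by ring.
  rewrite [leRHS]expRD ler_wpM2l ?expR_ge0//.
  have -> : t + (v k - u k - t) - t = v k - u k - t by ring.
  exact: expR_ge1Dx.
apply: le_trans (ler_sum (index_enum 'I_m.+1) (P := xpredT) (fun k _ => h k)).
have -> : \sum_k softmax u k * (expR t * (1 + (v k - u k - t))) =
    expR t * ((1 - t) * \sum_k softmax u k + t).
  rewrite {3}/t mulr_sumr -big_split/= mulr_sumr; apply: eq_bigr => k _.
  by ring.
by rewrite softmax_sum mulr1 subrK mulr1.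
Qed.

Lemma lse_shift u (c : R) : lse (fun k => u k + c) = lse u + c.
Proof.
rewrite /lse; under eq_bigr do rewrite expRD.
by rewrite -mulr_suml lnM ?posrE ?expR_gt0// expRK.
Qed.

Lemma lse_lip u v (e : R) : (forall k, `|u k - v k| <= e) -> `|lse u - lse v| <= e.
Proof.
have one u' v' : (forall k, `|u' k - v' k| <= e) -> lse u' - lse v' <= e.
  move=> h; have := lse_gradient u' v'.
  suff : - e <= \sum_k softmax u' k * (v' k - u' k) by lra.
  rewrite -[leLHS]mul1r -(softmax_sum u') mulr_suml; apply: ler_sum => k _.
  rewrite ler_wpM2l ?softmax_ge0//.
  by have := h k; rewrite ler_norml; lra.
move=> h; rewrite ler_norml; apply/andP; split; last exact: one.
by have := one v u (fun k => eq_ind _ (fun x => x <= e) (h k) _ (distrC _ _)); lra.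
Qed.

(** Lowering one score can only lower [lse]. In the choice of the potential this explicit estimate
    replaces differentiation under the integral. *)
Lemma softmax_shift_le u k (h : R) : 0 <= h ->
  softmax u k <= expR h * softmax (fun j => u j - if j == k then h else 0) k.
Proof.
move=> h0; rewrite /softmax -expRD ler_expR eqxx.
suff : lse (fun j => u j - if j == k then h else 0) <= lse u by lra.
rewrite -ler_expR !expR_lse; apply: ler_sum => j _; rewrite ler_expR.
by case: ifP => _; lra.
Qed.

Lemma lse_norm u : `|lse u| <= \sum_k `|u k| + m.+1%:R.
Proof.
have m0 : 0 <= m.+1%:R :> R by [].
have s0 : 0 <= \sum_(k < m.+1 | k != ord0) `|u k| by exact: sumr_ge0.
rewrite ler_norml; apply/andP; split.
  apply: le_trans (lse_ge u ord0); rewrite (bigD1 ord0)//=.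
  by have := lerNnormlW (lexx `|u ord0|); lra.
apply: le_trans (lse_le u) _; rewrite lerD2r; apply: ler_sum => k _.
apply: le_trans (ler_norm _) _; rewrite normrM ger0_norm ?softmax_ge0//.
by rewrite ler_piMl// softmax_le1.
Qed.

Lemma lse_convex (t : R) u v : 0 <= t <= 1 ->
  lse (fun k => t * u k + (1 - t) * v k) <= t * lse u + (1 - t) * lse v.
Proof.
move=> /andP[t0 t1]; pose z k := t * u k + (1 - t) * v k.
have hu := ler_wpM2l t0 (lse_gradient z u).
have t1' : 0 <= 1 - t by lra.
have hv := ler_wpM2l t1' (lse_gradient z v).
have : t * \sum_k softmax z k * (u k - z k) +
    (1 - t) * \sum_k softmax z k * (v k - z k) = 0.
  rewrite !mulr_sumr -big_split/= big1// => k _; rewrite /z; ring.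
rewrite -/z; lra.
Qed.

Lemma measurable_lse {d} {T : measurableType d} (u : 'I_m.+1 -> T -> R) :
  (forall k, measurable_fun setT (u k)) ->
  measurable_fun setT (fun w => lse (u ^~ w)).
Proof.
move=> mu; apply: (measurableT_comp (@measurable_ln R)).
by apply: measurable_sum => k; apply: measurableT_comp.
Qed.

Lemma measurable_softmax {d} {T : measurableType d} (u : 'I_m.+1 -> T -> R) k :
  (forall k, measurable_fun setT (u k)) ->
  measurable_fun setT (fun w => softmax (u ^~ w) k).
Proof.
move=> mu; apply: measurableT_comp => //; apply: measurable_funB => //.
exact: measurable_lse.
Qed.

End softmax.

(** * Potentials with prescribed mean weights *)

Section potential.
Context {R : realType} {d} {T : measurableType d} (Q : probability T R) {m : nat}
  (c : 'I_m.+1 -> T -> R) (p : 'I_m.+1 -> R).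
Context (mc : forall k, measurable_fun setT (c k))
  (ic : forall k, Q.-integrable setT (EFin \o c k)).
Context (p_gt0 : forall k, 0 < p k) (p_sum : \sum_k p k = 1).

Definition gain (phi : 'I_m.+1 -> R) (w : T) (k : 'I_m.+1) : R := c k w - phi k.

Let mgain phi k : measurable_fun setT (fun w => gain phi w k).
Proof. by apply: measurable_funB. Qed.

Let igain phi k : Q.-integrable setT (EFin \o (fun w => gain phi w k)).
Proof.
by apply: integrableRB => //; exact: integrableR_cst.
Qed.

Lemma measurable_lse_gain phi : measurable_fun setT (fun w => lse (gain phi w)).
Proof. by apply: (measurable_lse (u := fun k w => gain phi w k)). Qed.

Lemma integrable_lse_gain phi : Q.-integrable setT (EFin \o (fun w => lse (gain phi w))).
Proof.
apply: (@le_integrable _ _ _ _ _ measurableT _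
  (fun w => \sum_(k < m.+1) `|(gain phi w k)%:E| + (m.+1%:R)%:E)%E).
- by apply/measurable_EFinP; exact: measurable_lse_gain.
- move=> w _; rewrite sumEFin -EFinD lee_fin; apply: le_trans (lse_norm _) _.
  exact: ler_norm.
- apply: integrableD => //; last exact: finite_measure_integrable_cst.
  apply: integrable_sum => // k _; exact: integrable_abse (igain phi k).
Qed.

Lemma measurable_softmax_gain phi k :
  measurable_fun setT (fun w => softmax (gain phi w) k).
Proof. by apply: (measurable_softmax (u := fun k w => gain phi w k)). Qed.

Lemma integrable_softmax_gain phi k :
  Q.-integrable setT (EFin \o (fun w => softmax (gain phi w) k)).
Proof.
apply: (@le_integrable _ _ _ _ _ measurableT _ (cst 1%E)).
- by apply/measurable_EFinP; exact: measurable_softmax_gain.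
- by move=> w _; rewrite lee_fin normr1 ger0_norm ?softmax_ge0// softmax_le1.
- exact: finite_measure_integrable_cst.
Qed.

(** The dual functional; its stationarity in [phi k] says that the mean weight of [k] is [p k]. *)
Let F phi : R := \int[Q]_w (lse (gain phi w)) + \sum_k p k * phi k.

Let F_shift phi (r : R) : F (fun k => phi k - r) = F phi.
Proof.
rewrite /F; have -> : \int[Q]_w lse (gain (fun k => phi k - r) w) = \int[Q]_w lse (gain phi w) + r.
  rewrite -[X in _ = _ + X](RintegralT_cst Q) -RintegralD//;
    [|exact: integrable_lse_gain|exact: integrableR_cst].
  apply: eq_Rintegral => w _; rewrite -lse_shift; congr lse.
  by apply/funext => k; rewrite /gain; ring.
have -> : \sum_k p k * (phi k - r) = \sum_k p k * phi k - r.
  by under eq_bigr do rewrite mulrBr; rewrite sumrB -mulr_suml p_sum mul1r.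
ring.
Qed.

Let F_ge phi k : \sum_j p j * phi j - phi k + \int[Q]_w c k w <= F phi.
Proof.
rewrite /F; suff : \int[Q]_w c k w - phi k <= \int[Q]_w lse (gain phi w) by lra.
rewrite -[X in _ - X](RintegralT_cst Q) -RintegralB//; last exact: integrableR_cst.
apply: le_Rintegral => //.
- exact: igain.
- exact: integrable_lse_gain.
- by move=> w _; exact: lse_ge.
Qed.

Let F_lip phi psi (e : R) : (forall k, `|phi k - psi k| <= e) -> `|F phi - F psi| <= 2 * e.
Proof.
move=> h; rewrite /F.
have -> : \int[Q]_w lse (gain phi w) + \sum_k p k * phi k -
    (\int[Q]_w lse (gain psi w) + \sum_k p k * psi k) =
  (\int[Q]_w lse (gain phi w) - \int[Q]_w lse (gain psi w)) +
  \sum_k p k * (phi k - psi k).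
  under [in RHS]eq_bigr do rewrite mulrBr.
  by rewrite sumrB opprD addrACA.
apply: le_trans (ler_normD _ _) _; rewrite mulr_natl mulr2n; apply: lerD.
  rewrite -RintegralB//; [|exact: integrable_lse_gain..].
  have il : Q.-integrable setT (EFin \o (fun w => lse (gain phi w) - lse (gain psi w))).
    by apply: integrableRB; exact: integrable_lse_gain.
  apply: le_trans (le_normr_Rintegral measurableT il) _.
  rewrite -[leRHS](RintegralT_cst Q); apply: le_Rintegral => //.
  - exact: integrableR_norm.
  - exact: integrableR_cst.
  move=> w _; apply: lse_lip => k; rewrite /gain.
  by rewrite (_ : _ - _ - _ = - (phi k - psi k)) ?normrN//; ring.
apply: le_trans (ler_norm_sum _ _ _) _; rewrite -[leRHS]mul1r -p_sum mulr_suml.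
by apply: ler_sum => k _; rewrite normrM gtr0_norm// ler_pM2l.
Qed.

(** [F] is invariant under adding a constant to the potential, so the least entry can be taken to be
    0. Then [F] is at least its value at 0 as soon as some entry exceeds [L], and on the cube with
    side [[0, L]] continuity and compactness give a minimum. *)
Let F_min : exists phi, forall psi, F phi <= F psi.
Proof.
pose c1 := \sum_k `|\int[Q]_w c k w|.
pose F0 := F (fun=> 0).
(* Summing over [k] gives one [L] with [F0 + c1 <= p k * L] for every [k]. *)
pose L := \sum_k (`|F0| + c1) / p k.
have c1_ge0 : 0 <= c1 by exact: sumr_ge0.
have q0 k : 0 <= (`|F0| + c1) / p k.
  by rewrite divr_ge0 ?(ltW (p_gt0 k))// addr_ge0.
have L0 : 0 <= L by exact: sumr_ge0.
have Lk k : F0 + c1 <= p k * L.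
  rewrite mulrC -ler_pdivrMr// /L (bigD1 k)//=.
  apply: le_trans (_ : (`|F0| + c1) / p k <= _); last by rewrite lerDl sumr_ge0.
  by rewrite ler_pM2r ?invr_gt0// lerD2r ler_norm.
pose G (v : 'rV[R]_m.+1) := F (v ord0).
pose K := [set v : 'rV[R]_m.+1 | forall i, `[0, L]%classic (v ord0 i)].
have cK : compact K.
  by apply: (@rV_compact _ _ (fun=> `[0, L]%classic)) => i; exact: segment_compact.
have K0 : K (\row_i 0) by move=> i; rewrite mxE /= in_itv/= lexx.
have cG : continuous G.
  move=> v; have FF : ProperFilter (nbhs v) := nbhs_pfilter v.
  apply/(@cvgrPdist_le _ R^o _ (nbhs v) FF) => e e0.
  have e2 : 0 < e / 2 by rewrite divr_gt0.
  apply: (@filterS _ (nbhs v) FF _ _ _ (nbhsx_ballx v _ e2)) => w [_ vw].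
   have -> : e = 2 * (e / 2) by field.
  apply: F_lip => k; have := vw ord0 k.
  by rewrite /ball/= => /ltW.
have [v vK vmin] := @EVT_min_rV R _ G K (ex_intro _ _ K0) cK (continuous_subspaceT cG).
exists (v ord0) => psi.
have [k0 _ k0min] := @arg_minP _ _ _ ord0 xpredT psi isT.
pose psi' k := psi k - psi k0.
have -> : F psi = F psi' by rewrite F_shift.
have psi'0 k : 0 <= psi' k by rewrite subr_ge0; exact: k0min.
have [inK|/existsNP[j]] := pselect (forall k, psi' k <= L).
  have := vmin (\row_k psi' k); rewrite inE => h.
  have : G v <= G (\row_k psi' k).
    by apply: h => k; rewrite mxE /= in_itv/= psi'0 inK.
  rewrite /G (_ : (\row_k psi' k) ord0 = psi')//; apply/funext => k.
  by rewrite mxE.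
move=> /negP; rewrite -ltNge => Lj.
have h0 : F (v ord0) <= F0.
  have := vmin (\row_i 0); rewrite inE => /(_ K0).
  by rewrite /G (_ : (\row__ 0) ord0 = fun=> 0)//; apply/funext => k; rewrite mxE.
apply: (le_trans h0); have := F_ge psi' k0.
have -> : psi' k0 = 0 by rewrite /psi' subrr.
have : p j * L <= \sum_i p i * psi' i.
  rewrite (bigD1 j)//=; apply: le_trans (_ : p j * psi' j <= _).
    by rewrite ler_pM2l// ltW.
  by rewrite lerDl sumr_ge0// => i _; rewrite mulr_ge0// ltW.
have : - c1 <= \int[Q]_w c k0 w.
  rewrite lerNl; apply: le_trans (ler_norm _) _; rewrite normrN /c1 (bigD1 k0)//=.
  by rewrite lerDl sumr_ge0.
have := Lk j; lra.
Qed.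

(* At a minimum of F every one-sided derivative is nonnegative, which bounds each
   expected weight by p k; both families sum to 1. *)
Lemma exists_potential : exists phi, forall k, \int[Q]_w softmax (gain phi w) k = p k.
Proof.
have [phi min] := F_min; exists phi.
pose s k := \int[Q]_w softmax (gain phi w) k.
have sp k : s k <= p k.
  apply/ler_addgt0Pr => e e0.
  have e1 : 0 < 1 + e / p k by rewrite ltr_wpDr// ltW// divr_gt0.
  (* With this [h], [expR h * p k = p k + e]. The gradient inequality is used at the moved point
     [psi], where minimality of [phi] gives [s' <= p k] with no error; returning to [phi] costs the
     factor [expR h]. *)
  pose h := ln (1 + e / p k).
  have h0 : 0 < h by rewrite ln_gt0// ltrDl divr_gt0.
  have eh : expR h = 1 + e / p k by rewrite lnK// posrE.
  pose psi j := phi j + if j == k then h else 0.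
  have shiftE w : gain psi w = fun j => gain phi w j - if j == k then h else 0.
    by apply/funext => j; rewrite /gain /psi; ring.
  pose s' := \int[Q]_w softmax (gain psi w) k.
  have s'p : s' <= p k.
    have := min psi; rewrite /F.
    have -> : \sum_j p j * psi j = \sum_j p j * phi j + p k * h.
      under eq_bigr do rewrite mulrDr; rewrite big_split/=; congr (_ + _).
      by rewrite (bigD1 k)//= eqxx big1 ?addr0// => j jk; rewrite (negbTE jk) mulr0.
    have : \int[Q]_w lse (gain psi w) + h * s' <= \int[Q]_w lse (gain phi w).
      rewrite -RintegralZl//; last exact: integrable_softmax_gain.
      have iz : Q.-integrable setT (EFin \o (fun w => h * softmax (gain psi w) k)).
        by apply: integrableRZ; exact: integrable_softmax_gain.
      rewrite -RintegralD//; last exact: integrable_lse_gain.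
      apply: le_Rintegral => //.
      - by apply: integrableRD => //; exact: integrable_lse_gain.
      - exact: integrable_lse_gain.
      - move=> w _; apply: le_trans (lse_gradient (gain psi w) (gain phi w)).
        rewrite lerD2l (bigD1 k)//= big1 ?addr0.
          by rewrite /gain /psi eqxx (_ : _ - _ = h) 1?mulrC//; ring.
        move=> j jk; rewrite /gain /psi (negbTE jk); ring.
    have cancel (a b x r q : R) : a + x <= b -> b + r <= a + (r + q) -> x <= q by lra.
    by move=> h1 h2; rewrite -(ler_pM2l h0) [leRHS]mulrC; exact: cancel h1 (h2).
  have : s k <= expR h * s'.
    rewrite /s /s' -RintegralZl//; last exact: integrable_softmax_gain.
    apply: le_Rintegral => //.
    - exact: integrable_softmax_gain.
    - by apply: integrableRZ; exact: integrable_softmax_gain.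
    - move=> w _; rewrite shiftE; apply: softmax_shift_le; exact: ltW.
  move=> /le_trans; apply; rewrite eh.
  have -> : p k + e = (1 + e / p k) * p k by field; rewrite gt_eqF.
  by rewrite ler_pM2l.
have ssum : \sum_k s k = 1.
  rewrite /s -[RHS](RintegralT_cst Q).
  rewrite -(RintegralT_sum _ (integrable_softmax_gain phi)).2.
  by apply: eq_Rintegral => w _; exact: softmax_sum.
move=> k; apply/eqP; rewrite eq_le sp/=.
have : \sum_(j < m.+1 | j != k) s j <= \sum_(j < m.+1 | j != k) p j.
  by apply: ler_sum => j _; exact: sp.
move: ssum p_sum; rewrite (bigD1 k)//= [X in _ -> X = _ -> _](bigD1 k)//= /s; lra.
Qed.

End potential.

(** * Measures with a density, and mixtures *)

Section density.
Context {R : realType} {d} {T : measurableType d} (Q : {measure set T -> \bar R})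
  (s : T -> R) (ms : measurable_fun setT s) (s_ge0 : forall w, 0 <= s w).
Local Open Scope ereal_scope.

(** The two proofs are arguments so that the measure structure can be inferred from the term. *)
Definition density of measurable_fun setT s & (forall w, 0 <= s w)%R := fun D : set T =>
  \int[Q]_(w in D) (s w)%:E.

Local Notation nu := (density ms s_ge0).

Let ms' : measurable_fun setT (EFin \o s). Proof. exact/measurable_EFinP. Qed.

Let nu0 : nu set0 = 0. Proof. exact: integral_set0. Qed.

Let nu_ge0 A : 0 <= nu A. Proof. by apply: integral_ge0 => w _; rewrite lee_fin. Qed.

Let nu_additive : semi_sigma_additive nu.
Proof. by apply: (@semi_sigma_additive_nng_induced _ _ _ Q (EFin \o s)). Qed.

HB.instance Definition _ := isMeasure.Build _ _ _ nu nu0 nu_ge0 nu_additive.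

Import HBNNSimple.

Let integral_density_indic (A : set T) : measurable A ->
  \int[nu]_w (\1_A w)%:E = \int[Q]_w ((\1_A w)%:E * (s w)%:E).
Proof.
move=> mA; rewrite integral_indic// setIT [LHS]integral_mkcond.
apply: eq_integral => w _; rewrite patchE indicE.
by case: (w \in A); rewrite ?mul1e ?mul0e.
Qed.

Let ge0_integral_density_nnsfun (f : {nnsfun T >-> R}) :
  \int[nu]_w (f w)%:E = \int[Q]_w ((f w)%:E * (s w)%:E).
Proof.
under [LHS]eq_integral do rewrite fimfunE -fsumEFin//.
rewrite ge0_integral_fsum//; last 2 first.
  - by move=> r; apply/measurable_EFinP; apply: measurable_funM.
  - by move=> r t _; rewrite EFinM nnfun_muleindic_ge0.
under [RHS]eq_integral.
  move=> w _; rewrite fimfunE -fsumEFin// ge0_mule_fsuml; last first.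
    by move=> r; rewrite EFinM nnfun_muleindic_ge0.
  over.
rewrite ge0_integral_fsum//; last 2 first.
  - by move=> r; apply: emeasurable_funM => //; apply/measurable_EFinP; apply: measurable_funM.
  - by move=> r t _; apply: mule_ge0; rewrite ?lee_fin// -lee_fin EFinM nnfun_muleindic_ge0.
apply: eq_fsbigr => r _.
have mr : measurable (f @^-1` [set r]) by exact: measurable_funPTI.
have [r0|r0] := ltP r 0%R.
  by rewrite preimage_nnfun0// indic0 !integral0_eq// => w _; rewrite mulr0 ?mul0e.
under [LHS]eq_integral do rewrite EFinM.
rewrite ge0_integralZl//; last exact/measurable_EFinP.
rewrite integral_density_indic//.
under [RHS]eq_integral do rewrite EFinM -muleA.
rewrite ge0_integralZl//.
- by apply: emeasurable_funM => //; exact/measurable_EFinP.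
- by move=> w _; apply: mule_ge0; rewrite lee_fin.
Qed.

Lemma ge0_integral_density (f : T -> \bar R) : measurable_fun setT f ->
  (forall w, 0 <= f w) -> \int[nu]_w f w = \int[Q]_w (f w * (s w)%:E).
Proof.
move=> mf f0; pose g := nnsfun_approx measurableT mf.
have mg n : measurable_fun setT (EFin \o g n) by exact/measurable_EFinP.
have nd w : {homo (fun n => (g n w)%:E) : a b / (a <= b)%N >-> a <= b}.
  by move=> a b ab; rewrite lee_fin; exact/lefP/nd_nnsfun_approx.
have lim w : (g n w)%:E @[n --> \oo] --> f w by exact: cvg_nnsfun_approx.
transitivity (limn (fun n => \int[nu]_w (g n w)%:E)).
  rewrite -monotone_convergence//; last by move=> n w _; rewrite lee_fin.
  by apply: eq_integral => w _; exact/esym/cvg_lim.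
under eq_fun do rewrite ge0_integral_density_nnsfun.
rewrite -monotone_convergence//.
- apply: eq_integral => w _; apply/cvg_lim => //.
  by apply: cvgeZr.
- by move=> n; apply: emeasurable_funM; [exact: mg|exact: ms'].
- by move=> n w _; apply: mule_ge0; rewrite lee_fin.
- by move=> w _ a b ab; rewrite lee_wpmul2r ?lee_fin// -lee_fin; exact: nd.
Qed.

End density.

(** The law of [z k w] when [w] has law [Q] and [k] is then drawn with probability [s k w].
    Integrals of nonnegative functions determine it, and marginals and means are read off from
    them. *)
Lemma exists_mixture {R : realType} {d} {T : measurableType d} (Q : probability T R)
    {d'} {Z : measurableType d'} {m : nat} (s : 'I_m.+1 -> T -> R)
    (z : 'I_m.+1 -> {mfun T >-> Z}) :
  (forall k, measurable_fun setT (s k)) -> (forall k w, 0 <= s k w) ->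
  (forall w, \sum_k s k w = 1) ->
  exists pi : probability Z R, forall f : Z -> \bar R, measurable_fun setT f ->
    (forall x, 0 <= f x)%E ->
    (\int[pi]_x f x = \sum_k \int[Q]_w (f (z k w) * (s k w)%:E))%E.
Proof.
move=> ms s0 s1.
(* [msum] is indexed by natural numbers, hence [inord]; only indices below [m.+1] are summed. *)
have @part (k : nat) : {measure set Z -> \bar R}.
  refine (pushforward (density Q (ms (inord k)) (s0 (inord k))) (z (inord k))).
  exact: measurable_funPT.
pose pi : {measure set Z -> \bar R} := msum part m.+1.
have intE (f : Z -> \bar R) : measurable_fun setT f -> (forall x, 0 <= f x)%E ->
    (\int[pi]_x f x = \sum_k \int[Q]_w (f (z k w) * (s k w)%:E))%E.
  move=> mf f0; rewrite ge0_integral_measure_sum//; apply: eq_bigr => k _.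
  rewrite ge0_integral_pushforward// preimage_setT ge0_integral_density//.
  - by rewrite inord_val.
  - exact: measurableT_comp.
  - by move=> w; exact: f0.
have pi1 : pi setT = 1%E.
  have := intE (cst 1%E) (@measurable_cst _ _ _ _ _ _) (fun=> lee01).
  rewrite integral_cst// mul1e => ->.
  rewrite -ge0_integral_sum//.
  - rewrite (eq_integral (cst 1%E)) => [|w _].
      by rewrite integral_cst// mul1e; exact: probability_setT.
    by under eq_bigr do rewrite mul1e; rewrite sumEFin s1.
  - by move=> k; apply: emeasurable_funM => //; exact/measurable_EFinP.
  - by move=> k w _; rewrite mul1e lee_fin.
pose p : probability Z R := HB.pack (Measure.sort pi) (Measure.class pi)
  (Measure_isProbability.Build _ _ _ pi pi1).
by exists p.
Qed.

Lemma mixture_integral {R : realType} {d} {T : measurableType d} (Q : probability T R)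
    {d'} {Z : measurableType d'} {m : nat} (s : 'I_m.+1 -> T -> R)
    (z : 'I_m.+1 -> {mfun T >-> Z}) (pi : probability Z R) (f : Z -> R) :
  (forall k, measurable_fun setT (s k)) -> (forall k w, 0 <= s k w <= 1) ->
  (forall g : Z -> \bar R, measurable_fun setT g -> (forall x, 0 <= g x)%E ->
    (\int[pi]_x g x = \sum_k \int[Q]_w (g (z k w) * (s k w)%:E))%E) ->
  measurable_fun setT f ->
  (forall k, Q.-integrable setT (EFin \o (fun w => f (z k w)))) ->
  (\int[pi]_x (f x)%:E = (\int[Q]_w \sum_k (s k w * f (z k w)))%:E)%E.
Proof.
move=> ms s01 piE mf fi.
have int01 (h : T -> R) k : measurable_fun setT h ->
    (forall w, `|h w| <= `|f (z k w)|) -> Q.-integrable setT (EFin \o (fun w => s k w * h w)).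
  move=> mh hf; apply: le_integrable (fi k) => //.
    by apply/measurable_EFinP; exact: measurable_funM.
  move=> w _; rewrite lee_fin /= normrM.
  have /andP[s0 s1] := s01 k w.
  by apply: le_trans (hf w); rewrite ger0_norm// ler_piMl.
pose fp x := Num.max (f x) 0; pose fn x := Num.max (- f x) 0.
have mfp : measurable_fun setT fp by exact: measurable_maxr.
have mfn : measurable_fun setT fn by apply: measurable_maxr => //; exact: measurable_funN.
have part (g : Z -> R) : measurable_fun setT g -> (forall x, 0 <= g x) ->
    (forall x, `|g x| <= `|f x|) ->
    (\int[pi]_x (g x)%:E = (\int[Q]_w \sum_k (s k w * g (z k w)))%:E)%E.
  move=> mg g0 gf.
  have ig k : Q.-integrable setT (EFin \o (fun w => s k w * g (z k w))).
    by apply: (int01 (fun w => g (z k w))) => //; exact: measurableT_comp.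
  rewrite piE//; last exact/measurable_EFinP.
  rewrite (RintegralT_sum _ ig).2 -sumEFin; apply: eq_bigr => k _.
  rewrite /Rintegral fineK; last exact: (integrable_fin_num measurableT (ig k)).
  by apply: eq_integral => w _; rewrite -EFinM mulrC.
have fpf x : `|fp x| <= `|f x| by rewrite /fp; case: (leP (f x) 0) => _; rewrite ?normr0.
have fnf x : `|fn x| <= `|f x| by rewrite /fn; case: (leP (- f x) 0) => _; rewrite ?normr0 ?normrN.
have posE x : ((EFin \o f)^\+ x = (fp x)%:E)%E by rewrite funeposE EFin_max.
have negE x : ((EFin \o f)^\- x = (fn x)%:E)%E by rewrite funenegE EFin_max.
rewrite integralE (eq_integral (EFin \o fp)) => [|x _]; last exact: posE.
rewrite [X in (_ - X)%E](eq_integral (EFin \o fn)) => [|x _]; last exact: negE.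
rewrite /comp part//; last by move=> x; rewrite /fp le_max lexx orbT.
rewrite part//; last by move=> x; rewrite /fn le_max lexx orbT.
rewrite -EFinB; congr EFin.
have im (g : Z -> R) : measurable_fun setT g -> (forall x, `|g x| <= `|f x|) ->
  Q.-integrable setT (EFin \o (fun w => \sum_k s k w * g (z k w))).
  move=> mg gf; apply: (RintegralT_sum _ _).1 => k.
  by apply: (int01 (fun w => g (z k w))) => //; exact: measurableT_comp.
rewrite -RintegralB//; [|exact: im..].
apply: eq_Rintegral => w _; rewrite -sumrB; apply: eq_bigr => k _.
rewrite -mulrBr; congr (_ * _); rewrite /fp /fn.
by case: (leP (f _) 0) => h1; case: (leP (- f _) 0) => h2; lra.
Qed.

(** Integrate [lse_le]: since the mean weights are [p], the potential terms cancel, leaving the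
    value of the coupling and the error [m + 1]. *)
Lemma softmax_gain_value {R : realType} {d} {T : measurableType d} (Q : probability T R)
    {m : nat} (c : 'I_m.+1 -> T -> R) (p phi : 'I_m.+1 -> R) :
  (forall k, measurable_fun setT (c k)) -> (forall k, Q.-integrable setT (EFin \o c k)) ->
  (forall k, \int[Q]_w softmax (gain c phi w) k = p k) ->
  \int[Q]_w lse (gain c phi w) + \sum_k p k * phi k <=
  \int[Q]_w \sum_k softmax (gain c phi w) k * c k w + m.+1%:R.
Proof.
move=> mc ic pE; pose s k w := softmax (gain c phi w) k.
have is_ k : Q.-integrable setT (EFin \o s k) by exact: integrable_softmax_gain.
have isphi k : Q.-integrable setT (EFin \o (fun w => phi k * s k w)).
  exact: integrableRZ.
have isc k : Q.-integrable setT (EFin \o (fun w => s k w * c k w)).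
  apply: le_integrable (ic k) => //.
    by apply/measurable_EFinP; apply: measurable_funM => //; exact: measurable_softmax_gain.
  move=> w _; rewrite lee_fin /= normrM ler_piMl// ger0_norm ?softmax_ge0//.
  exact: softmax_le1.
have -> : \sum_k p k * phi k = \int[Q]_w \sum_k phi k * s k w.
  rewrite (RintegralT_sum _ isphi).2; apply: eq_bigr => k _.
  by rewrite RintegralZl// [in RHS]/s pE mulrC.
have isum := (RintegralT_sum _ isphi).1.
have iscum := (RintegralT_sum _ isc).1.
rewrite -(RintegralT_cst Q m.+1%:R).
rewrite -RintegralD//; last exact: integrable_lse_gain.
rewrite -RintegralD//; last exact: integrableR_cst.
apply: le_Rintegral => //.
- by apply: integrableRD => //; exact: integrable_lse_gain.
- by apply: integrableRD => //; exact: integrableR_cst.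
- move=> w _; have := lse_le (gain c phi w).
  under eq_bigr do rewrite /gain mulrBr [X in _ - X]mulrC.
  by rewrite sumrB -/(gain c phi w) /s; lra.
Qed.

(** * Laws with finite support *)

Section finite_support.
Context {R : realType} {n : nat} (mu : probability (n.-tuple R) R).

Lemma measurable_tuple1 (x : n.-tuple R) : measurable [set x].
Proof.
rewrite (_ : [set x] = box (fun i => [set tnth x i])); first exact: measurable_box.
by apply/seteqP; split => [_ -> i//|v vx]; apply: eq_from_tnth => i; exact: vx.
Qed.

Lemma finitely_supported_atoms : finitely_supported mu ->
  exists m (x : 'I_m.+1 -> n.-tuple R), [/\ injective x,
    forall k, 0 < fine (mu [set x k]) & \sum_k fine (mu [set x k]) = 1].
Proof.
move=> [F /finite_fsetP[X ->] muX].
pose p x := fine (mu [set x]).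
have pE x : mu [set x] = (p x)%:E.
  by rewrite fineK// fin_num_measure//; exact: measurable_tuple1.
have p0 x : 0 <= p x by exact: fine_ge0.
have sumX : \sum_(x <- X) p x = 1.
  apply: EFin_inj; rewrite -muX -sumEFin -[X in mu X]image_id -bigcup_imset1.
  rewrite measure_fin_bigcup//=.
  - by rewrite fsbig_finite//= set_fsetK; apply: eq_bigr => x _; rewrite pE.
  - by move=> x y _ _ [_ [->]].
  - by move=> x _; exact: measurable_tuple1.
pose l := [seq x <- X | 0 < p x].
have lsum : \sum_(x <- l) p x = 1.
  rewrite -sumX big_filter [RHS](bigID (fun x => 0 < p x))/= [X in _ = _ + X]big1 ?addr0//.
  by move=> x; rewrite -leNgt => px; apply/eqP; rewrite eq_le px p0.
have lpos x : x \in l -> 0 < p x by rewrite mem_filter => /andP[].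
have lu : uniq l by apply: filter_uniq; exact: fset_uniq.
case: l lu lsum lpos => [|x0 l] lu lsum lpos.
  by move: lsum; rewrite big_nil => /eqP; rewrite eq_sym oner_eq0.
exists (size l), (tnth (in_tuple (x0 :: l))); split.
- move=> i j /eqP; rewrite !(tnth_nth x0) nth_uniq//= => /eqP; exact: val_inj.
- by move=> k; apply: lpos; exact: mem_tnth.
- by rewrite -[RHS]lsum [in RHS]big_tnth.
Qed.

Lemma atomic_law m (x : 'I_m.+1 -> n.-tuple R) : injective x ->
  \sum_k fine (mu [set x k]) = 1 -> forall D, measurable D ->
  mu D = (\sum_k fine (mu [set x k]) * (x k \in D)%:R)%:E.
Proof.
move=> xi x1 D mD.
have m1 := measurable_tuple1.
pose U := \big[setU/set0]_(k < m.+1) [set x k].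
have mU : measurable U by apply: bigsetU_measurable => k _; exact: m1.
have sumU E : measurable E -> mu (E `&` U) = (\sum_k mu (E `&` [set x k]))%E.
  move=> mE; rewrite /U big_distrr/= measure_semi_additive_ord//.
  - by move=> k; apply: measurableI => //; exact: m1.
  - by move=> j k _ _ [_ [[_ ->] [_ /xi]]].
  - by apply: bigsetU_measurable => k _; apply: measurableI => //; exact: m1.
have U1 : mu U = 1%E.
  rewrite -(setTI U) sumU// -x1 -sumEFin; apply: eq_bigr => k _.
  by rewrite setTI fineK// fin_num_measure//; exact: m1.
have C0 : mu (~` U) = 0%E.
  by rewrite probability_setC// U1 subee.
have -> : mu D = mu (D `&` U).
  rewrite -[in LHS](setUIDK D U) measureU//; [|exact: measurableI|exact: measurableD|].
    rewrite [X in (_ + X)%E](_ : _ = 0%E) ?adde0//; apply/eqP.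
    rewrite eq_le measure_ge0 andbT -C0; apply: le_measure; rewrite ?inE//.
    - exact: measurableD.
    - by apply: measurableC.
  by apply/seteqP; split => // w [[_ ?] []].
rewrite sumU// -sumEFin; apply: eq_bigr => k _.
case: (boolP (x k \in D)) => [/[!inE] xD|xD].
  have xfin : mu [set x k] \is a fin_num by apply: fin_num_measure; exact: m1.
  rewrite mulr1 fineK//; congr (mu _).
  by apply/seteqP; split => [w []|w ->].
rewrite mulr0 (_ : D `&` _ = set0) ?measure0//; apply/seteqP; split => // w [Dw wk].
by move: xD; rewrite -wk notin_setE.
Qed.

End finite_support.

(** * Comparison of the pairings *)

(** Under an arbitrary coupling the dot product is not known to be integrable, so positive and
    negative parts are compared separately. *)
Lemma ae_le_integral {R : realType} {d} {T : measurableType d}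
    (mu : {measure set T -> \bar R}) (f g : T -> \bar R) :
  measurable_fun setT f -> measurable_fun setT g ->
  {ae mu, forall x, (f x <= g x)%E} -> (\int[mu]_x f x <= \int[mu]_x g x)%E.
Proof.
move=> mf mg fg; rewrite integralE [leRHS]integralE; apply: leeB.
- apply: ae_ge0_le_integral => //; [exact: measurable_funepos..|].
  apply: filterS fg => x fgx _; rewrite !funeposE ge_max le_max.
  by rewrite le_max fgx lexx orbT.
- apply: ae_ge0_le_integral => //; [exact: measurable_funeneg..|].
  apply: filterS fg => x fgx _; rewrite !funenegE ge_max le_max.
  by rewrite le_max leeN2 fgx lexx orbT.
Qed.

Section dot_product.
Context {R : realType} {n : nat}.
Implicit Types x a v : n.-tuple R.

Lemma measurable_dotp : measurable_fun setT (fun z : n.-tuple R * n.-tuple R => dotp z.1 z.2).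
Proof.
apply: measurable_sum => i; apply: measurable_funM.
  exact: (measurableT_comp (measurable_tnth i) measurable_fst).
exact: (measurableT_comp (measurable_tnth i) measurable_snd).
Qed.

Lemma measurable_dotpr x : measurable_fun setT (dotp x).
Proof.
by apply: measurable_sum => i; apply: measurable_funM => //; exact: measurable_tnth.
Qed.

Lemma dotp_upd x v k (t r r' : R) :
  dotp x (upd v k (t * r + (1 - t) * r')) =
  t * dotp x (upd v k r) + (1 - t) * dotp x (upd v k r').
Proof.
rewrite /dotp !mulr_sumr -big_split/=; apply: eq_bigr => i _.
by rewrite !tnth_mktuple; case: ifP => _; ring.
Qed.

Lemma dotp_norm x a :
  `|dotp x a| <= (\sum_i `|tnth x i|) * \sum_i `|tnth a i|.
Proof.
rewrite mulr_suml; apply: le_trans (ler_norm_sum _ _ _) _; apply: ler_sum => i _.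
rewrite normrM ler_wpM2l// (bigD1 i)//= lerDl; exact: sumr_ge0.
Qed.

Context {m : nat} (x : 'I_m.+1 -> n.-tuple R) (lam : R) (phi : 'I_m.+1 -> R).

(** The maximum over [k] of [lam * dotp (x k) a - phi k], smoothed; [lam] scales the scores against
    the fixed error of the smoothing. *)
Definition soft_dual a : R := lse (fun k => lam * dotp (x k) a - phi k).

Lemma measurable_soft_dual : measurable_fun setT soft_dual.
Proof.
apply: (measurable_lse (u := fun k a => lam * dotp (x k) a - phi k)) => k.
by apply: measurable_funB => //; apply: measurable_funM => //; exact: measurable_dotpr.
Qed.

Lemma soft_dual_convex k v :
  convex_function [set: R^o] (fun r : R^o => soft_dual (upd v k r) : R^o).
Proof.
move=> t r r' _ _.
have t01 : 0 <= t%:num <= 1 by apply/andP; split.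
have := lse_convex (fun j => lam * dotp (x j) (upd v k r) - phi j)
  (fun j => lam * dotp (x j) (upd v k r') - phi j) t01.
congr (lse _ <= _); apply/funext => j; rewrite dotp_upd; ring.
Qed.

Lemma soft_dual_growth : exists K, 0 <= K /\
  forall a, `|soft_dual a| <= K + K * \sum_i `|tnth a i|.
Proof.
pose e k := `|lam| * (\sum_i `|tnth (x k) i|) + `|phi k|.
have e0 k : 0 <= e k by rewrite addr_ge0// mulr_ge0// sumr_ge0.
exists (\sum_k e k + m.+1%:R); split; first by rewrite addr_ge0// sumr_ge0.
move=> a; pose S := \sum_i `|tnth a i|; have S0 : 0 <= S by exact: sumr_ge0.
rewrite -/S; apply: le_trans (lse_norm _) _.
have h : \sum_k `|lam * dotp (x k) a - phi k| <= (\sum_k e k) * (1 + S).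
  rewrite mulr_suml; apply: ler_sum => k _.
  apply: le_trans (ler_normB _ _) _; rewrite normrM.
  have := ler_wpM2l (normr_ge0 lam) (dotp_norm (x k) a); rewrite -/S /e => h.
  have h1 : 0 <= `|lam| * (\sum_i `|tnth (x k) i|) by rewrite mulr_ge0// sumr_ge0.
  have h2 : 0 <= `|phi k| * S by rewrite mulr_ge0.
  lra.
have : 0 <= m.+1%:R * S by rewrite mulr_ge0.
by move: h; lra.
Qed.

End dot_product.

Lemma integrable_soft_dual {R : realType} {d} {T : measurableType d} (P : probability T R)
    {n m : nat} (A : 'I_n -> {RV P >-> R}) (x : 'I_m.+1 -> n.-tuple R) (lam : R)
    (phi : 'I_m.+1 -> R) :
  (forall i, P.-integrable setT (EFin \o A i)) ->
  P.-integrable setT (EFin \o (fun w => soft_dual x lam phi [tuple A i w | i < n])).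
Proof.
move=> iA; have [K [K0 growth]] := soft_dual_growth x lam phi.
have bound : P.-integrable setT (EFin \o (fun w => K + K * \sum_i `|A i w|)).
  apply: integrableRD; first exact: integrableR_cst.
  apply: integrableRZ; apply: (RintegralT_sum _ _).1 => i; exact: integrableR_norm.
apply: le_integrable bound => //.
  apply/measurable_EFinP; apply: measurableT_comp; first exact: measurable_soft_dual.
  by apply: (measurable_mktuple (f := fun i w => A i w)).
move=> w _; rewrite lee_fin /= [leRHS]ger0_norm.
  apply: le_trans (growth _) _; rewrite lerD2l ler_wpM2l//.
  by apply: ler_sum => i _; rewrite tnth_mktuple.
by rewrite addr_ge0// mulr_ge0// sumr_ge0.
Qed.

(** Weak duality: on the atom [x k] the score of [k] is at most the soft dual. The potential sees
    only the first marginal of the coupling, the soft dual only the second. *)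
Lemma coupling_le_soft_dual {R : realType} {d} {T : measurableType d} (P : probability T R)
    {n m : nat} (A : 'I_n -> {RV P >-> R}) (mu : probability (n.-tuple R) R)
    (pi : probability (n.-tuple R * n.-tuple R)%type R)
    (x : 'I_m.+1 -> n.-tuple R) (lam : R) (phi : 'I_m.+1 -> R) :
  (forall i, P.-integrable setT (EFin \o A i)) ->
  coupling mu (vector_law P (fun i => A i : T -> R)) pi ->
  injective x -> \sum_k fine (mu [set x k]) = 1 -> 0 < lam ->
  ('E_pi[fun z => dotp z.1 z.2] <=
   (lam^-1 * (\sum_k fine (mu [set x k]) * phi k +
      \int[P]_w soft_dual x lam phi [tuple A i w | i < n]))%:E)%E.
Proof.
move=> iA [pi1 pi2] xi x1 lam0.
pose L := soft_dual x lam phi; pose vA w := [tuple A i w | i < n].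
have mL : measurable_fun setT L by exact: measurable_soft_dual.
have mvA : measurable_fun setT vA by apply: (measurable_mktuple (f := fun i w => A i w)).
have iLA : P.-integrable setT (EFin \o (L \o vA)) by exact: integrable_soft_dual.
have mLs : measurable_fun setT (fun z : n.-tuple R * n.-tuple R => L z.2).
  exact: (measurableT_comp mL measurable_snd).
pose X1 : {RV pi >-> R} := HB.pack (fun z : n.-tuple R * n.-tuple R => L z.2)
  (isMeasurableFun.Build _ _ _ _ _ mLs).
pose X2 : {RV P >-> R} := HB.pack (L \o vA)
  (isMeasurableFun.Build _ _ _ _ _ (measurableT_comp mL mvA)).
have law D : measurable D -> P (X2 @^-1` D) = pi (X1 @^-1` D).
  move=> mD; have := pi2 (L @^-1` D); rewrite -[L @^-1` D]setTI => /(_ (mL measurableT _ mD)).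
  by rewrite setTI => ->.
have mE : measurable_fun setT (@EFin R) by apply/measurable_EFinP; exact: measurable_id.
have iX1 : pi.-integrable setT (EFin \o X1).
  exact: (same_law_integrable law mE).
have L1 : \int[pi]_z L z.2 = \int[P]_w L (vA w).
  congr fine; rewrite -[RHS](integral_distribution (X := X2))//.
  by rewrite (same_law_integral law).
pose ind k (z : n.-tuple R * n.-tuple R) : R := \1_[set x k] z.1.
have m1 k : measurable [set x k] by exact: measurable_tuple1.
have mfst D : measurable D -> measurable (fst @^-1` D : set (n.-tuple R * n.-tuple R)).
  by move=> mD; rewrite -[_ @^-1` _]setTI; exact: measurable_fst.
have iind k : pi.-integrable setT (EFin \o ind k).
  apply: le_integrable (integrableR_cst pi 1) => //.
    apply/measurable_EFinP; apply: (measurableT_comp _ measurable_fst).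
    exact: measurable_indic.
  by move=> z _; rewrite lee_fin /ind /= indicE normr1; case: (_ \in _); rewrite ?normr1 ?normr0.
have indE k : \int[pi]_z ind k z = fine (mu [set x k]).
  congr fine; rewrite -(pi1 _ (m1 k)) -(setIT (fst @^-1` _)).
  rewrite -integral_indic//; last exact: mfst.
have isum := RintegralT_sum (index_enum 'I_m.+1) (fun k => integrableRZ (phi k) (iind k)).
pose g z := lam^-1 * (\sum_k phi k * ind k z + L z.2).
have ig : pi.-integrable setT (EFin \o g).
  by apply: integrableRZ; apply: integrableRD => //; exact: isum.1.
have -> : lam^-1 * (\sum_k fine (mu [set x k]) * phi k + \int[P]_w L (vA w)) =
    \int[pi]_z g z.
  rewrite RintegralZl//; last by apply: integrableRD => //; exact: isum.1.
  rewrite RintegralD//; last exact: isum.1.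
  rewrite isum.2 L1; congr (_ * (_ + _)); apply: eq_bigr => k _.
  by rewrite RintegralZl// indE mulrC.
rewrite /Rintegral fineK; last exact: (integrable_fin_num measurableT ig).
rewrite unlock; apply: ae_le_integral.
- by apply/measurable_EFinP; exact: measurable_dotp.
- by case/integrableP: ig.
(* The pointwise bound is claimed only on the atoms; their complement is null by the first
   marginal. *)
have mU : measurable (\bigcup_k [set x k]) by apply: fin_bigcup_measurable => // k _.
exists (fst @^-1` (~` \bigcup_k [set x k])); split.
- by apply: mfst; exact: measurableC.
- apply: etrans (pi1 _ (measurableC mU)) _.
  rewrite (atomic_law xi x1 (measurableC mU)) big1// => k _; rewrite (_ : _ \in _ = false) ?mulr0//.
  by apply/negbTE; rewrite notin_setE => h; apply: h; exists k.
move=> z /= nle [k _ zk]; apply: nle; rewrite lee_fin /g.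
have -> : \sum_j phi j * ind j z = phi k.
  rewrite (bigD1 k)//= big1 ?addr0 => [|j jk]; rewrite /ind indicE zk.
    by rewrite mem_set// mulr1.
  rewrite memNset ?mulr0// => /= /xi kj; by rewrite kj eqxx in jk.
rewrite mulrC ler_pdivlMr// mulrC zk.
have := lse_ge (fun k => lam * dotp (x k) z.2 - phi k) k.
by rewrite -/(soft_dual x lam phi z.2) -/L; lra.
Qed.

Lemma integrable_dotp {R : realType} {d} {T : measurableType d} (Q : probability T R)
    {n : nat} (B : 'I_n -> T -> R) (x : n.-tuple R) :
  (forall i, Q.-integrable setT (EFin \o B i)) ->
  Q.-integrable setT (EFin \o (fun w => dotp x [tuple B i w | i < n])).
Proof.
move=> iB; have := (RintegralT_sum (index_enum 'I_n)
  (fun i => integrableRZ (tnth x i) (iB i))).1.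
apply: eq_integrable => // w _; congr EFin; apply: eq_bigr => i _.
by rewrite tnth_mktuple.
Qed.

(** Given [w], the first component is [x k] with probability [s k w] and the second is the value of
    [B]. The means of the weights give the first marginal, and their sum 1 gives the second. *)
Lemma exists_coupling {R : realType} {d} {T : measurableType d} (Q : probability T R)
    {n m : nat} (B : 'I_n -> {RV Q >-> R}) (mu : probability (n.-tuple R) R)
    (x : 'I_m.+1 -> n.-tuple R) (s : 'I_m.+1 -> T -> R) :
  (forall i, Q.-integrable setT (EFin \o B i)) ->
  injective x -> \sum_k fine (mu [set x k]) = 1 ->
  (forall k, measurable_fun setT (s k)) -> (forall k w, 0 <= s k w) ->
  (forall w, \sum_k s k w = 1) -> (forall k, \int[Q]_w s k w = fine (mu [set x k])) ->
  exists2 pi : probability (n.-tuple R * n.-tuple R)%type R,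
    coupling mu (vector_law Q (fun i => B i : T -> R)) pi &
    ('E_pi[fun z => dotp z.1 z.2] =
      (\int[Q]_w \sum_k (s k w * dotp (x k) [tuple B i w | i < n]))%:E)%E.
Proof.
move=> iB xi x1 ms s0 s1 sp.
pose vB w := [tuple B i w | i < n].
have mvB : measurable_fun setT vB by apply: (measurable_mktuple (f := fun i w => B i w)).
have mz k : measurable_fun setT (fun w => (x k, vB w)) by apply: measurable_fun_pair.
pose z k : {mfun T >-> (n.-tuple R * n.-tuple R)%type} :=
  HB.pack (fun w => (x k, vB w)) (isMeasurableFun.Build _ _ _ _ _ (mz k)).
have s01 k w : 0 <= s k w <= 1.
  by rewrite s0/= -(s1 w) (bigD1 k)//= lerDl sumr_ge0.
have [pi piE] := exists_mixture Q z ms s0 s1.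
have is_ k : Q.-integrable setT (EFin \o s k).
  apply: le_integrable (integrableR_cst Q 1) => //; first exact/measurable_EFinP.
  by move=> w _; rewrite lee_fin /= normr1 ger0_norm//; have /andP[] := s01 k w.
have lawE D : measurable D ->
    pi D = (\int[Q]_w \sum_k s k w * \1_D (z k w))%:E.
  move=> mD; rewrite -(mixture_integral ms s01 piE (f := \1_D)).
  - by rewrite integral_indic// setIT.
  - exact: measurable_indic.
  - move=> k; apply: le_integrable (integrableR_cst Q 1) => //.
      apply/measurable_EFinP; apply: measurableT_comp; first exact: measurable_indic.
      exact: mz.
    by move=> w _; rewrite lee_fin /= indicE normr1; case: (_ \in _); rewrite ?normr1 ?normr0.
exists pi; last first.
  rewrite unlock; apply: (mixture_integral (f := fun z => dotp z.1 z.2) ms s01 piE).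
    exact: measurable_dotp.
  by move=> k; exact: integrable_dotp.
split => D mD.
  have mfst : measurable (fst @^-1` D : set (n.-tuple R * n.-tuple R)).
    by rewrite -[_ @^-1` _]setTI; exact: measurable_fst.
  rewrite lawE// (atomic_law xi x1 mD); congr EFin.
  transitivity (\int[Q]_w \sum_k (x k \in D)%:R * s k w).
    by apply: eq_Rintegral => w _; apply: eq_bigr => k _; rewrite mulrC indicE.
  rewrite (RintegralT_sum _ (fun k => integrableRZ (x k \in D)%:R (is_ k))).2.
  by apply: eq_bigr => k _; rewrite RintegralZl// sp mulrC.
have msnd : measurable (snd @^-1` D : set (n.-tuple R * n.-tuple R)).
  by rewrite -[_ @^-1` _]setTI; exact: measurable_snd.
have mvD : measurable (vB @^-1` D) by rewrite -[_ @^-1` _]setTI; exact: mvB.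
rewrite lawE//.
transitivity (\int[Q]_w (\1_(vB @^-1` D) w)%:E)%E; last first.
  by rewrite integral_indic// setIT.
rewrite -[RHS]fineK; last first.
  rewrite integral_indic// setIT; exact: fin_num_measure.
congr EFin; apply: eq_Rintegral => w _.
by rewrite -[RHS]mul1r -[X in X * _](s1 w) mulr_suml; apply: eq_bigr => k _; rewrite !indicE.
Qed.

(** * From convex order to the inequality of pairings *)

Section pairing_le.
Context {R : realType} {d} {T : measurableType d} (P : probability T R)
  {d'} {T' : measurableType d'} (Q : probability T' R) {n : nat}
  (A : 'I_n -> {RV P >-> R}) (B : 'I_n -> {RV Q >-> R}) (c : R).
Context (indA : box_independent P (fun i => A i : T -> R))
  (indB : box_independent Q (fun i => B i : T' -> R)).
Context (iA : forall i, P.-integrable setT (EFin \o A i))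
  (iB : forall i, Q.-integrable setT (EFin \o B i)).
Context (c_gt0 : 0 < c)
  (cxAB : forall i, convex_le P (A i) Q (fun w => c * B i w)).

Let cB i : {RV Q >-> R} := HB.pack (fun w => c * B i w)
  (isMeasurableFun.Build _ _ _ _ (fun w => c * B i w)
    (measurable_funM (measurable_cst c) (measurable_funPT (B i)))).

Let mscale (D : set R) : measurable D -> measurable [set r : R | D (c * r)].
Proof.
move=> mD; rewrite -[X in measurable X]setTI.
exact: (measurable_funM (measurable_cst c) (@measurable_id _ _ _)).
Qed.

Let ind_cB : box_independent Q (fun i => cB i : T' -> R).
Proof. by move=> D mD; apply: (indB (D := fun i => [set r | D i (c * r)])) => i; exact: mscale. Qed.

Let i_cB i : Q.-integrable setT (EFin \o cB i).
Proof. exact: (integrableRZ c (iB i)). Qed.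

(* With the potential phi, the soft-max of the gains splits the law of B so that its first
   marginal is mu; it loses at most m + 1 against the optimum, and this loss is made
   negligible by multiplying the gains by a large factor. *)
Lemma pairing_le (mu : probability (n.-tuple R) R) : finitely_supported mu ->
  (pairing (vector_law P (fun i => A i : T -> R)) mu <=
   c%:E * pairing (vector_law Q (fun i => B i : T' -> R)) mu)%E.
Proof.
move=> /finitely_supported_atoms[m [x [xi p0 p1]]].
apply: ge_ereal_sup => _ [pi cpl <-]; apply/lee_addgt0Pr => e e0.
(* The loss [m + 1] divided by [lam] is exactly [e]. *)
pose lam := m.+1%:R / e; have lam0 : 0 < lam by exact: divr_gt0.
pose vB w := [tuple B i w | i < n]; pose vcB w := [tuple cB i w | i < n].
pose h k w := lam * dotp (x k) (vcB w).
have ih k : Q.-integrable setT (EFin \o h k) by apply: integrableRZ; exact: integrable_dotp.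
have mh k : measurable_fun setT (h k) by have /integrableP[/measurable_EFinP] := ih k.
(* The potential is adapted to [c * B]; weak duality for [A] holds with any potential, hence with
   this one. *)
have [phi phiE] := exists_potential mh ih p0 p1.
pose s k w := softmax (gain h phi w) k.
have ms k : measurable_fun setT (s k) by exact: measurable_softmax_gain.
have [pi' cpl' pi'E] := exists_coupling iB xi p1 ms (fun k w => softmax_ge0 _ _)
  (fun w => softmax_sum _) phiE.
set V := \int[Q]_w \sum_k (s k w * dotp (x k) (vB w)) in pi'E.
have Vle : (V%:E <= pairing (vector_law Q (fun i => B i : T' -> R)) mu)%E.
  by rewrite -pi'E; apply: ereal_sup_ubound; exists pi'.
apply: (@le_trans _ _ (c * V + e)%:E); last first.
  by rewrite EFinD EFinM leeD2r// lee_pmul2l.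
apply: le_trans (coupling_le_soft_dual phi iA cpl xi p1 lam0) _.
rewrite lee_fin ler_pdivrMl//.
have [K [K0 growth]] := soft_dual_growth x lam phi.
have tensor := tensor_convex_le indA ind_cB iA i_cB cxAB
  (measurable_soft_dual x lam phi) (soft_dual_convex x lam phi) growth.
have dualle : \int[P]_w soft_dual x lam phi [tuple A i w | i < n] <=
    \int[Q]_w lse (gain h phi w).
  apply: fine_le => //; apply: (integrable_fin_num measurableT).
    exact: integrable_soft_dual.
  exact: integrable_lse_gain.
have value := softmax_gain_value mh ih phiE.
have isd k : Q.-integrable setT (EFin \o (fun w => s k w * dotp (x k) (vB w))).
  apply: le_integrable (integrable_dotp (x k) iB) => //.
    apply/measurable_EFinP; apply: measurable_funM => //.
    by have /integrableP[/measurable_EFinP] := integrable_dotp (x k) iB.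
  move=> w _; rewrite lee_fin /= normrM ler_piMl// ger0_norm ?softmax_ge0//.
  exact: softmax_le1.
have VE : \int[Q]_w \sum_k softmax (gain h phi w) k * h k w = lam * c * V.
  rewrite -RintegralZl//; last exact: (RintegralT_sum _ isd).1.
  apply: eq_Rintegral => w _; rewrite mulr_sumr; apply: eq_bigr => k _.
  rewrite /h /s /dotp !mulr_sumr; apply: eq_bigr => i _.
  by rewrite !tnth_mktuple /=; ring.
have lamE : lam * e = m.+1%:R by rewrite /lam divfK// gt_eqF.
rewrite mulrDr lamE mulrA -VE; move: value dualle; lra.
Qed.

End pairing_le.

Lemma convex_le_fun {R : realType} {d} {T : measurableType d} {d'} {T' : measurableType d'}
    (P : probability T R) (A : T -> R) (Q : probability T' R) (B : T' -> R) (k : R) :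
  k != 0 -> convex_le P (fun w => k^-1 * A w) Q B -> convex_le P A Q (fun w => k * B w).
Proof.
move=> k0 /(convex_le_scale (k := k)).
by rewrite (_ : (fun w => k * (k^-1 * A w)) = A)//; apply/funext => w; rewrite mulVKf.
Qed.

Theorem proposition8p2 (R : realType) :
  exists C : R, 1 <= C /\
  forall (d : nat)
    (dT : measure_display) (T : measurableType dT) (P : probability T R)
    (Y : 'I_d -> {RV P >-> R})
    (dT' : measure_display) (T' : measurableType dT') (Q : probability T' R)
    (Xi : 'I_d -> option nat -> {RV Q >-> R}),
  let N := fun i : 'I_d => tail_exponent P (Y i) in
  let H := fun i : 'I_d => slope_expansion (N i) (fun k => Xi i k : T' -> R) in
  mutually_independent P [set: 'I_d] (fun i => Y i : T -> R) ->
  (forall i, symmetric_rv P (Y i)) ->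
  (forall i, ~ {ae P, forall w, Y i w = 0}) ->
  (forall i, closed_fun (N i)) ->
  (forall i, convex_efun (N i)) ->
  (forall i, nondecreasing_efun (N i)) ->
  (forall i, N i 0 = 0%E) ->
  (forall i, qinv (N i) 1 = 1%E) ->
  slope_variables N Xi ->
  (forall i,
     convex_le P (fun w => C^-1 * Y i w) Q (H i) /\
     convex_le Q (H i) P (fun w => C * Y i w)) /\
  (forall mu : probability (d.-tuple R) R, finitely_supported mu ->
     (C^-1%:E * pairing (vector_law P (fun i => Y i : T -> R)) mu <=
        pairing (vector_law Q H) mu <=
        C%:E * pairing (vector_law P (fun i => Y i : T -> R)) mu)%E).
Proof.
exists (28 * expR 10); split.
  by have := expR_ge1Dx (10 : R); lra.
set C := 28 * expR 10; have C0 : 0 < C by rewrite mulr_gt0// expR_gt0.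
move=> d dT T P Y dT' T' Q Xi N H indY symY _ _ N_cvx N_nd N0 qN1 [indXi lawXi].
have coord i : P.-integrable setT (EFin \o Y i) /\
    (convex_le P (fun w => C^-1 * Y i w) Q (H i) /\
     convex_le Q (H i) P (fun w => C * Y i w)).
  split.
    exact: (coordinate_integrable (N_cvx i) (N_nd i) (N0 i) (qN1 i)
      (block_independent indXi (i := i)) (lawXi i)).
  exact: (coordinate_convex_le (symY i) (N_cvx i) (N_nd i) (N0 i) (qN1 i)
    (block_independent indXi (i := i)) (lawXi i)).
split=> [i|mu muF]; first exact: (coord i).2.
have boxY : box_independent P (fun i => Y i : T -> R).
  move=> D mD; have := independent_seq indY (enum_uniq 'I_d) (fun _ _ => I) mD.
  rewrite big_enum/= => <-; congr (P _).
  by apply/seteqP; split => w h i _; apply: h => //=; rewrite mem_enum.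
pose Hrv i : {RV Q >-> R} := HB.pack (H i)
  (isMeasurableFun.Build _ _ _ _ (H i) (measurable_expansion (N i) (Xi i))).
have boxH : box_independent Q (fun i => Hrv i : T' -> R).
  by move=> D mD; exact: expansions_independent.
have iY i := (coord i).1.
have iH i : Q.-integrable setT (EFin \o Hrv i) by exact: expansion_integrable (lawXi i).
(* Both bounds are instances of one inequality with the roles of [Y] and [H] exchanged; this one is
   divided by [C] at the end. *)
have YH := pairing_le boxY boxH iY iH C0
  (fun i => convex_le_fun (lt0r_neq0 C0) (coord i).2.1) muF.
have HY := pairing_le boxH boxY iH iY C0 (fun i => (coord i).2.2) muF.
apply/andP; split; last exact: HY.
by rewrite lee_pdivrMl.
Qed.
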